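(* Let $l\ge1$. Let $x\in\mathcal{A}^{\mathbb{Z}}$ be a Toeplitz sequence over a finite alphabet $\mathcal{A}$ with periodic structure $(n_k)_{k\ge1}$ such that $?_k=o(\varphi(n_k))$ as $k\to\infty$, where $\varphi$ is the Euler totient function. Then for every $F\in C(X_x)$ and every $y\in X_x$ the limit $$\lim_{N\to\infty}\frac{1}{\pi_l(N)}\sum_{q\in\mathbb{P}_l^{N}}F(S^{q}y)$$ exists.
   Context: A natural number is an $l$-almost prime if it is a product of $l$ primes (not necessarily distinct). $\mathbb{P}_l^N$ is the set of $l$-almost primes $\le N$ and $\pi_l(N)=\#\mathbb{P}_l^N$. $S$ is the left shift on $\mathcal{A}^{\mathbb{Z}}$. A sequence $x$ is Toeplitz if for every $a\in\mathbb{Z}$ there is $\ell\ge1$ with $x(a)=x(a+j\ell)$ for all $j\in\mathbb{Z}$; $X_x$ is the orbit closure of $x$ under $S$. Let $\mathrm{Per}_n(x)=\{a\in\mathbb{Z}:x(a)=x(a+jn)\text{ for all }j\in\mathbb{Z}\}$. A periodic structure of $x$ is a sequence $(n_k)$ with $n_k\mid n_{k+1}$ and $\bigcup_k\mathrm{Per}_{n_k}(x)=\mathbb{Z}$. The number $?_k$ is $\#\{0\le j<n_k: j\notin\mathrm{Per}_{n_k}(x)\}$ (the number of ''holes'' per period at level $k$). *)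

(* Defs.v *)
From HB Require Import structures.
From mathcomp Require Import all_boot all_order all_algebra.
From mathcomp Require Import all_classical all_reals all_analysis.
From mathcomp Require Export complex.

Set Implicit Arguments.
Unset Strict Implicit.
Unset Printing Implicit Defensive.

Import Order.TTheory GRing.Theory Num.Theory.
Import numFieldNormedType.Exports.

Local Open Scope classical_set_scope.
Local Open Scope ring_scope.

Definition almost_prime (l n : nat) : Prop :=
  exists s : seq nat, [/\ size s = l, all prime s & n = (\prod_(p <- s) p)%N].

Definition almost_primes (l N : nat) : {set 'I_N.+1} :=
  [set q : 'I_N.+1 | `[< almost_prime l q >]]%SET.

Definition almost_prime_pi (l N : nat) : nat := #|almost_primes l N|.

(* [A ^ Z] with the product of the discrete topologies. *)
Definition zseq (A : finType) : topologicalType :=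
  prod_topology (fun _ : int => discrete_topology A).

Definition left_shift (A : finType) (x : zseq A) : zseq A := fun a : int => x (a + 1).

(* The shift is invertible and the orbit is two-sided: the second disjunct
   says that z is S^-n x. *)
Definition shift_orbit (A : finType) (x : zseq A) : set (zseq A) :=
  [set z | exists n : nat, z = iter n (@left_shift A) x \/ x = iter n (@left_shift A) z].

Definition orbit_closure (A : finType) (x : zseq A) : set (zseq A) :=
  closure (shift_orbit x).

Definition toeplitz (A : finType) (x : zseq A) : Prop :=
  forall a : int, exists2 m : nat, (0 < m)%N & forall j : int, x a = x (a + j * m%:Z).

Definition Per (A : finType) (n : nat) (x : zseq A) : set int :=
  [set a : int | forall j : int, x a = x (a + j * n%:Z)].

(* Periods are positive: [Per 0 x] is all of Z, so allowing 0 would make the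
   notion trivial.  The sequence is indexed from 0: [n k] is n_(k+1). *)
Definition periodic_structure (A : finType) (x : zseq A) (n : nat -> nat) : Prop :=
  [/\ forall k, (0 < n k)%N,
      forall k, (n k %| n k.+1)%N
    & \bigcup_k Per (n k) x = setT].

Definition holes (A : finType) (x : zseq A) (n : nat) : nat :=
  #|[set j : 'I_n | (j : nat)%:Z \notin Per n x]%SET|.

(* Main.v *)
(** Fix eps.  Up to eps, F (S^q y) depends on finitely many coordinates of S^q y, and y
    coincides with a fixed shift of x wherever that shift reads a position of
    Per_{n_k}(x).  Hence q |-> F (S^q y) is eps-constant on every residue class modulo
    n_k except for at most a constant times ?_k = o(phi(n_k)) classes, and the averages
    form a Cauchy sequence as soon as the l-almost primes are equidistributed, relative
    to pi_l, among the phi(m) classes coprime to m.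

    The equidistribution is obtained without complex analysis.  Let M_a(N) be the sum of mu
    over n <= N in the class a.  The identity mu ln^2 = mu * (Lambda * Lambda - Lambda ln)
    and Selberg's asymptotics for Lambda ln + Lambda * Lambda = mu * ln^2 in classes bound
    |M_a(N)| ln^2 N by a logarithmic average of the |M_b|.  If the sums of mu(n)/n over a
    class are bounded, then M_b changes sign or is small in every window [u, lam u], which
    makes that average contract, so that M_a(N) = o(N).  The boundedness plays the role of
    L(1,chi) <> 0: the constants c_a in the expansion
    sum_{n <= N, n in a} 1/n = kap ln N + c_a + O(1/N) are invertible in the group ring
    after adding a common constant, since otherwise a kernel projector would be a real
    character with L(1,chi) = 0.  One passes from mu to Lambda by the hyperbola method,
    and from primes to l-almost primes by splitting off the largest prime factor. *)

Require Import Defs.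
From HB Require Import structures.
From mathcomp Require Import all_boot all_order all_fingroup all_algebra.
From mathcomp Require Import all_classical all_reals all_analysis.
From mathcomp Require Import complex.
From mathcomp Require Import zify ring lra.

Set Implicit Arguments.
Unset Strict Implicit.
Unset Printing Implicit Defensive.

Import Order.TTheory GRing.Theory Num.Theory.
Import numFieldNormedType.Exports.

Local Open Scope ring_scope.

(** * Dirichlet convolution *)

(** Complex characters are replaced by the real group ring of the unit group. If the shifted
    harmonic constants were singular there, with kernel projector e, the sum of Lambda(n)/n over a
    class a would be (1/h - e(a)) ln N + O(1), h being the number of classes. Positivity of Lambda
    gives e <= 1/h, and a symmetric idempotent with this bound is zero or 1/h times a single real
    character; so only real characters have to be excluded. The contraction must not gain less and
    less as the constant decreases, or its iteration could stall above zero: the gain depends only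
    on a lower bound for that constant and on the bound for the sums of mu(n)/n. No asymptotics of
    pi_l are used. Splitting off the largest prime leaves a bounded error for each cofactor, in
    total O(pi_{l-1}(N)), so pi_{l-1} = o(pi_l) suffices; this follows from the divergence of the
    sum of 1/p and the weak regularity pi_l(N) <= K r pi_l(N/r) + C. Little-o statements take the
    form eps X(N) + C for all N, which survives putting N/d for N inside sums over d. *)

Section DirichletConvolution.
Variable R : realType.
Implicit Types (f g h : nat -> R) (F : nat -> nat -> R) (n d k N p m : nat).

(** [F] takes both factors, so that conditions relating them can be carried, as in [al_max_conv]; a
    product f d * g k would not express those. *)
Definition dsum F n : R :=
  \sum_(1 <= d < n.+1) \sum_(1 <= k < n.+1 | (d * k == n)%N) F d k.

Definition dconv f g : nat -> R := fun n => dsum (fun d k => f d * g k) n.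

Lemma dsum0 F : dsum F 0 = 0.
Proof. by rewrite /dsum big_geq. Qed.

Lemma dsum1 F : dsum F 1 = F 1%N 1%N.
Proof. by rewrite /dsum big_nat1; under eq_bigl do rewrite mul1n; rewrite big_nat1_eq. Qed.

Lemma eq_dsum F1 F2 n :
  (forall d k, (0 < d)%N -> (0 < k)%N -> (d * k = n)%N -> F1 d k = F2 d k) ->
  dsum F1 n = dsum F2 n.
Proof.
move=> e; apply: eq_big_nat => d /andP[d0 _].
by rewrite [LHS]big_nat_cond [RHS]big_nat_cond; apply: eq_bigr => k /andP[/andP[k0 _] /eqP]; exact: e.
Qed.

Lemma dsum_widen F n N : (n <= N)%N ->
  dsum F n = \sum_(1 <= d < N.+1) \sum_(1 <= k < N.+1 | (d * k == n)%N && (0 < n)%N) F d k.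
Proof.
case: n => [|n] nN.
  rewrite dsum0; under eq_bigr do under eq_bigl do rewrite ltnn andbF.
  by rewrite big1 // => i _; rewrite big_pred0.
under [RHS]eq_bigr do under eq_bigl do rewrite andbT.
rewrite /dsum [LHS](big_nat_widen _ _ N.+1) // big_mkcond /=.
apply: eq_big_nat => d /andP[d0 dN].
case: ltnP => dn.
  rewrite (big_nat_widen _ _ N.+1) //; apply: eq_bigl => k /=.
  case: eqP => //= e; apply/idP; nia.
rewrite big_nat_cond big1 // => k /andP[/andP[k1 _] /eqP E]; exfalso; nia.
Qed.

Lemma sum_dsum F N :
  \sum_(1 <= n < N.+1) dsum F n =
  \sum_(1 <= d < N.+1) \sum_(1 <= k < (N %/ d).+1) F d k.
Proof.
transitivity (\sum_(1 <= n < N.+1) \sum_(1 <= d < N.+1) \sum_(1 <= k < N.+1)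
   (if (d * k == n)%N then F d k else 0)).
  apply: eq_big_nat => n /andP[n0 nN]; rewrite (@dsum_widen _ _ N) //.
  by apply: eq_bigr => d _; rewrite big_mkcond /=; apply: eq_bigr => k _; rewrite n0 andbT.
rewrite exchange_big /=; apply: eq_big_nat => d /andP[d0 dN].
rewrite exchange_big /= [RHS](big_nat_widen _ _ N.+1); last by rewrite ltnS leq_div.
rewrite [RHS]big_mkcond; apply: eq_big_nat => k /andP[k0 kN] /=.
rewrite -big_mkcond /=; under eq_bigl do rewrite eq_sym.
rewrite big_nat1_eq muln_gt0 d0 k0 /= ltnS ltnS leq_divRL // mulnC //.
Qed.

Lemma dsum_mulr F f n : dsum F n * f n = dsum (fun d k => F d k * f (d * k)%N) n.
Proof.
rewrite /dsum big_distrl; apply: eq_bigr => d _; rewrite big_distrl /=.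
by apply: eq_bigr => k /eqP ->.
Qed.

Lemma dsum_sym F n : dsum F n = dsum (fun d k => F k d) n.
Proof.
rewrite /dsum; under eq_bigr do rewrite big_mkcond; rewrite exchange_big /=.
apply: eq_bigr => d _; rewrite [RHS]big_mkcond; apply: eq_bigr => k _.
by rewrite mulnC.
Qed.

Lemma dsumD F1 F2 n : dsum (fun d k => F1 d k + F2 d k) n = dsum F1 n + dsum F2 n.
Proof. by rewrite /dsum -big_split; apply: eq_bigr => d _; rewrite big_split. Qed.

Lemma dsumZ c F n : dsum (fun d k => c * F d k) n = c * dsum F n.
Proof. by rewrite /dsum mulr_sumr; apply: eq_bigr => d _; rewrite mulr_sumr. Qed.

Lemma dsum_ge0 F n : (forall d k, 0 <= F d k) -> 0 <= dsum F n.
Proof. by move=> F0; apply: sumr_ge0 => d _; apply: sumr_ge0. Qed.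

Lemma dsum_dsum (G : nat -> nat -> nat -> R) n :
  dsum (fun d k => dsum (G d) k) n =
  \sum_(1 <= d < n.+1) \sum_(1 <= a < n.+1) \sum_(1 <= b < n.+1)
    (if (d * (a * b) == n)%N then G d a b else 0).
Proof.
apply: eq_big_nat => d /andP[d0 dn].
transitivity (\sum_(1 <= k < n.+1) \sum_(1 <= a < n.+1) \sum_(1 <= b < n.+1)
   (if (a * b == k)%N then if (d * (a * b) == n)%N then G d a b else 0 else 0)).
  rewrite big_mkcond; apply: eq_big_nat => k /andP[k0 kn].
  rewrite (@dsum_widen _ _ n) //; under eq_bigr do rewrite big_mkcond.
  rewrite k0; case: eqP => [E|NE].
    apply: eq_bigr => a _; apply: eq_bigr => b _; rewrite andbT.
    by case: eqP => // ->; rewrite E eqxx.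
  rewrite big1 // => a _; rewrite big1 // => b _.
  by case: eqP => // ->; case: eqP.
rewrite exchange_big /=; apply: eq_big_nat => a /andP[a0 _].
rewrite exchange_big /=; apply: eq_big_nat => b /andP[b0 _].
rewrite -big_mkcond /=; under eq_bigl do rewrite eq_sym.
rewrite big_nat1_eq; case: eqP => E; last by case: ifP.
by rewrite muln_gt0 a0 b0 ltnS -E leq_pmull.
Qed.

Lemma dconvC f g : dconv f g = dconv g f.
Proof.
by apply/funext => n; rewrite /dconv dsum_sym; apply: eq_dsum => *; rewrite mulrC.
Qed.

Lemma dconvA f g h : dconv f (dconv g h) = dconv (dconv f g) h.
Proof.
rewrite [RHS]dconvC; apply/funext => n; rewrite {1}/dconv [RHS]/dconv.
transitivity (dsum (fun d k => dsum (fun a b => f d * g a * h b) k) n).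
  by apply: eq_dsum => d k _ _ _; rewrite -dsumZ; apply: eq_dsum => *; rewrite mulrA.
transitivity (dsum (fun b k => dsum (fun d a => f d * g a * h b) k) n); last first.
  by apply: eq_dsum => d k _ _ _; rewrite -dsumZ; apply: eq_dsum => *; rewrite mulrC.
rewrite !dsum_dsum.
under [RHS]eq_bigr do (rewrite exchange_big /=).
rewrite [RHS]exchange_big /=; rewrite [LHS]exchange_big /=.
apply: eq_bigr => a _.
rewrite [RHS]exchange_big /=; apply: eq_bigr => d _; apply: eq_bigr => b _.
by rewrite [(b * _)%N]mulnC mulnA.
Qed.

Definition dunit n : R := (n == 1)%:R.
Definition done_fun n : R := (0 < n)%:R.
Definition lnn n : R := ln n%:R.

Lemma dconv1 f : f 0%N = 0 -> dconv dunit f = f.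
Proof.
move=> f0; apply/funext => -[|n]; first by rewrite /dconv dsum0.
rewrite /dconv /dsum big_ltn // [X in _ + X]big1_seq ?addr0 => [|d].
  by under eq_bigl do rewrite mul1n; rewrite big_nat1_eq ltnS leqnn /= /dunit mul1r.
rewrite mem_index_iota => /andP[_ /andP[d1 _]].
by rewrite big1 // => k _; rewrite /dunit gtn_eqF // mul0r.
Qed.

Lemma dconvDl f g h : dconv (fun n => f n + g n) h = (fun n => dconv f h n + dconv g h n).
Proof. by apply/funext => n; rewrite /dconv -dsumD; apply: eq_dsum => *; rewrite mulrDl. Qed.

Lemma dconvNl f h : dconv (fun n => - f n) h = (fun n => - dconv f h n).
Proof.
by apply/funext => n; rewrite /dconv -mulN1r -dsumZ; apply: eq_dsum => *; rewrite mulN1r mulNr.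
Qed.

Definition dln f n : R := f n * lnn n.

Lemma lnnM d k : (0 < d)%N -> (0 < k)%N -> lnn (d * k) = lnn d + lnn k.
Proof. by move=> d0 k0; rewrite /lnn natrM lnM // posrE ltr0n. Qed.

Lemma dln_dconv f g : dln (dconv f g) = (fun n => dconv (dln f) g n + dconv f (dln g) n).
Proof.
apply/funext => n; rewrite /dln /dconv dsum_mulr -dsumD; apply: eq_dsum => d k d0 k0 _.
by rewrite lnnM //; ring.
Qed.

(** Either p divides d, or it does not and then divides k. Identities can thus be proved by removing
    one prime at a time, without passing to coprime parts. *)
Lemma dsum_prime F p m : prime p -> (0 < m)%N ->
  dsum F (p * m) = dsum (fun d k => F (p * d)%N k) m +
                   dsum (fun d k => if (p %| d)%N then 0 else F d (p * k)%N) m.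
Proof.
move=> pp m0; have p0 := prime_gt0 pp.
have mpm : (m <= p * m)%N by rewrite leq_pmull.
rewrite ![dsum _ m](@dsum_widen _ _ (p * m)) // m0.
under eq_bigr do under eq_bigl do rewrite andbT.
under [X in _ = _ + X]eq_bigr do under eq_bigl do rewrite andbT.
have E1 : dsum F (p * m) = \sum_(1 <= d < (p * m).+1) \sum_(1 <= k < (p * m).+1)
   (if (d * k == p * m)%N && (p %| d)%N then F d k else 0) +
  \sum_(1 <= d < (p * m).+1) \sum_(1 <= k < (p * m).+1)
   (if (d * k == p * m)%N && ~~ (p %| d)%N then F d k else 0).
  rewrite -big_split; apply: eq_bigr => d _; rewrite -big_split big_mkcond; apply: eq_bigr => k _ /=.
  by case: (_ == _) => //=; case: (_ %| _)%N; rewrite ?addr0 ?add0r.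
rewrite E1; congr (_ + _).
  transitivity (\sum_(1 <= d < (p * m).+1) \sum_(1 <= d' < (p * m).+1)
     if (d == p * d')%N then \sum_(1 <= k < (p * m).+1 | (d' * k == m)%N) F (p * d')%N k else 0).
    apply: eq_big_nat => d /andP[d0 dn].
    have [/dvdnP[c Ec]|npd] := boolP (p %| d)%N; last first.
      rewrite big1 ?big1 // => [d' _|k _]; last by rewrite andbF.
      by case: eqP => // E; rewrite E dvdn_mulr in npd.
    rewrite mulnC in Ec; rewrite [RHS](bigD1_seq c) ?iota_uniq ?mem_index_iota //=; last first.
      apply/andP; split; nia.
    rewrite Ec eqxx [X in _ = _ + X]big1 ?addr0; last first.
      by move=> i; case: eqP => //; case: eqP => // ? ? _; exfalso; nia.
    rewrite [RHS]big_mkcond; apply: eq_bigr => k _.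
    by rewrite andbT -mulnA eqn_pmul2l.
  rewrite exchange_big /=; apply: eq_big_nat => d /andP[d0 dn].
  rewrite -big_mkcond /= big_nat1_eq ltnS; case: ifP => // /negbT H.
  rewrite big_nat_cond big_pred0 // => k; apply: negbTE; apply: contra H => /andP[/andP[k0 _] /eqP E].
  by rewrite muln_gt0 p0 d0 leq_mul2l; apply/orP; right; nia.
apply: eq_big_nat => d /andP[d0 dn].
have [pd|npd] := boolP (p %| d)%N.
  by rewrite big1 ?big1 // => k _; rewrite andbF.
rewrite [RHS]big_mkcond /=.
transitivity (\sum_(1 <= k < (p * m).+1) \sum_(1 <= k' < (p * m).+1)
     if (k == p * k')%N then if (d * k' == m)%N then F d (p * k')%N else 0 else 0).
  apply: eq_big_nat => k /andP[k0 kn]; rewrite andbT.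
  have [/dvdnP[c Ec]|npk] := boolP (p %| k)%N; last first.
    rewrite big1 ?big1 // => [|d' _]; last first.
      by case: eqP => // E; rewrite E dvdn_mulr in npk.
    case: eqP => // E; have : (p %| d * k)%N by rewrite E dvdn_mulr.
    by rewrite Euclid_dvdM // (negbTE npd) (negbTE npk).
  rewrite mulnC in Ec; rewrite [RHS](bigD1_seq c) ?iota_uniq ?mem_index_iota //=; last first.
    apply/andP; split; nia.
  rewrite Ec eqxx [X in _ = _ + X]big1 ?addr0; last first.
    by move=> i; case: eqP => //; case: eqP => // ? ? _; exfalso; nia.
  by rewrite mulnCA eqn_pmul2l.
rewrite exchange_big /=; apply: eq_big_nat => k /andP[k0 kn].
rewrite -big_mkcond /= big_nat1_eq ltnS; case: ifP => // /negbT H; case: eqP => // E.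
by move: H; rewrite muln_gt0 p0 k0 leq_mul2l /= -E leq_pmull ?orbT.
Qed.

Definition mu n : R :=
  if (0 < n)%N && all (fun p => logn p n == 1)%N (primes n) then (-1) ^+ size (primes n) else 0.

(** [primes n] lists the distinct prime divisors, so the singleton case is that of prime powers. *)
Definition mangoldt n : R := if primes n is [:: p] then lnn p else 0.

Lemma mu_norm n : `|mu n| <= 1.
Proof. by rewrite /mu; case: ifP => _; rewrite ?normr0 // normrX normrN1 expr1n. Qed.

Lemma mu0 : mu 0 = 0. Proof. by []. Qed.

Lemma mu_prime_mul p d : prime p -> (0 < d)%N ->
  mu (p * d) = if (p %| d)%N then 0 else - mu d.
Proof.
move=> pp d0; have p0 := prime_gt0 pp; rewrite /mu muln_gt0 p0 d0 /=.
have [pd|npd] := boolP (p %| d)%N.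
  case: ifP => // /allP /(_ p); rewrite primesM // primes_prime // inE eqxx => /(_ isT).
  by rewrite lognM // logn_prime // eqxx eqSS -leqn0 leqNgt logn_gt0 mem_primes pp d0 pd.
have pe : perm_eq (primes (p * d)) (p :: primes d).
  apply: uniq_perm; rewrite ?primes_uniq //=.
    by rewrite primes_uniq mem_primes (negbTE npd) !andbF.
  by move=> q; rewrite primesM // primes_prime // !inE.
rewrite (perm_all _ pe) (perm_size pe) /= lognM // logn_prime // eqxx.
have -> : logn p d = 0%N by apply/eqP; rewrite -leqn0 leqNgt logn_gt0 mem_primes (negbTE npd) !andbF.
have -> : all (fun q => logn q (p * d) == 1)%N (primes d) = all (fun q => logn q d == 1)%N (primes d).
  apply: eq_in_all => q; rewrite mem_primes => /and3P[pq _ qd].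
  have /negbTE qp : q != p by apply: contraNneq npd => <-.
  by rewrite lognM // logn_prime // qp.
by rewrite /=; case: ifP => _; rewrite ?oppr0 // exprS mulN1r.
Qed.

(** For n = p m the terms in which p divides the first factor cancel the others, as mu (p d) is - mu
    d, or 0 when p divides d. *)
Lemma mu_one : dconv mu done_fun = dunit.
Proof.
apply/funext => n; case: (leqP n 1) => n1.
  case: n n1 => [|[|//]] _; first by rewrite /dconv dsum0.
  by rewrite /dconv dsum1 /mu /done_fun /dunit /= mulr1.
have pp := pdiv_prime n1; set p := pdiv n in pp *.
have /dvdnP[m E] : (p %| n)%N := pdiv_dvd n.
have m0 : (0 < m)%N by rewrite lt0n; apply: contraTN n1 => /eqP m0; rewrite E m0.
rewrite {1}E /dconv mulnC dsum_prime // -dsumD.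
rewrite (@eq_dsum _ (fun _ _ => 0 * 0)) ?dsumZ ?mul0r.
  by rewrite /dunit; case: eqP n1 => // ->.
move=> d k d0 k0 _; rewrite mu_prime_mul // /done_fun k0 muln_gt0 k0 (prime_gt0 pp) /=.
by case: ifP => _; rewrite ?mul0r ?addr0 // mulNr addrC subrr.
Qed.

Lemma mangoldt_ge0 n : 0 <= mangoldt n.
Proof.
rewrite /mangoldt; case E : (primes n) => [//|p [|//]]; rewrite /lnn ln_ge0 // ler1n.
have : p \in primes n by rewrite E inE.
by rewrite mem_primes => /and3P[/prime_gt0].
Qed.

Lemma mangoldt_prime p : prime p -> mangoldt p = lnn p.
Proof. by move=> pp; rewrite /mangoldt primes_prime. Qed.

Lemma mangoldt_prime_mul p d : prime p -> (0 < d)%N ->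
  mangoldt (p * d) = (if (p %| d)%N then mangoldt d else 0) + (d == 1)%:R * lnn p.
Proof.
move=> pp d0; have p0 := prime_gt0 pp.
have [->|d1] := eqVneq d 1%N.
  by rewrite muln1 mangoldt_prime // Euclid_dvd1 // mul1r add0r.
rewrite mul0r addr0 /mangoldt.
have [pd|npd] := boolP (p %| d)%N.
  suff -> : primes (p * d) = primes d by [].
  apply: (irr_sorted_eq ltn_trans ltnn); rewrite ?sorted_primes // => q.
  rewrite primesM // primes_prime // inE; case: eqP => // ->.
  by rewrite mem_primes pp d0 pd.
have pe : perm_eq (primes (p * d)) (p :: primes d).
  apply: uniq_perm; rewrite ?primes_uniq //=.
    by rewrite primes_uniq mem_primes (negbTE npd) !andbF.
  by move=> q; rewrite primesM // primes_prime // !inE.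
have := perm_size pe; case E : (primes d) => [|q s] /=.
  by exfalso; move/eqP: E; rewrite primes_eq0 => H; lia.
by case: (primes (p * d)) => [|? [|]].
Qed.

(** Induction along ln (p m) = ln p + ln m: in [dsum_prime] the first sum restores the terms with p
    dividing d that the second one drops, and its term d = 1 adds the new ln p. *)
Lemma mangoldt_one : dconv mangoldt done_fun = lnn.
Proof.
apply/funext; elim/ltn_ind => n IH; case: (leqP n 1) => n1.
  case: n n1 {IH} => [|[|//]] _; first by rewrite /dconv dsum0 /lnn ln0.
  by rewrite /dconv dsum1 /mangoldt mul0r /lnn ln1.
have pp := pdiv_prime n1; set p := pdiv n in pp *.
have /dvdnP[m E] : (p %| n)%N := pdiv_dvd n.
have m0 : (0 < m)%N by rewrite lt0n; apply: contraTN n1 => /eqP m0; rewrite E m0.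
have p0 := prime_gt0 pp.
rewrite {1}E /dconv mulnC dsum_prime // -dsumD E lnnM // -(IH m); last first.
  by rewrite E ltn_Pmulr ?prime_gt1.
rewrite (@eq_dsum _ (fun d k => mangoldt d * done_fun k + lnn p * (dunit d * done_fun k))); last first.
  move=> d k d0 k0 _; rewrite mangoldt_prime_mul // /done_fun k0 muln_gt0 k0 p0 /dunit.
  by case: ifP => _; rewrite ?mulr1; ring.
rewrite dsumD dsumZ -[dsum (fun d k => dunit d * _) m]/(dconv dunit done_fun m) dconv1 //.
by rewrite /done_fun m0 mulr1.
Qed.

Lemma dconv_one_inj f : f 0%N = 0 -> dconv mu (dconv f done_fun) = f.
Proof. by move=> f0; rewrite dconvC -dconvA (dconvC done_fun) mu_one dconvC dconv1. Qed.

Lemma mangoldt_mu : mangoldt = dconv mu lnn.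
Proof. by rewrite -mangoldt_one dconv_one_inj. Qed.

Lemma dln_one : dln done_fun = lnn.
Proof. by apply/funext => -[|n]; rewrite /dln /done_fun ?mul1r // mul0r /lnn ln0. Qed.

(** [dln] is a derivation for [dconv]; it annihilates [dunit], the convolution of mu and 1, which
    determines [dln mu]. *)
Lemma dln_mu : dln mu = (fun n => - dconv mangoldt mu n).
Proof.
rewrite -[LHS]dconv_one_inj; last by rewrite /dln mu0 mul0r.
have e : dln (dconv mu done_fun) = (fun=> 0).
  rewrite mu_one; apply/funext => n; rewrite /dln /dunit; case: eqP => [->|_]; rewrite ?mul0r //.
  by rewrite /lnn ln1 mulr0.
have E : dconv (dln mu) done_fun = (fun n => - dconv mu lnn n).
  apply/funext => n; move: (congr1 (@^~ n) e); rewrite dln_dconv dln_one /= => /eqP.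
  by rewrite addr_eq0 => /eqP.
by rewrite E dconvC dconvNl -mangoldt_mu.
Qed.

Definition selberg_fun n : R := dln mangoldt n + dconv mangoldt mangoldt n.

Lemma selberg_fun_mu : selberg_fun = dconv mu (dln lnn).
Proof.
rewrite -mangoldt_one dln_dconv dln_one -mangoldt_one dconvA -dconvDl.
by rewrite dconv_one_inj // /selberg_fun /dln mul0r add0r /dconv dsum0.
Qed.

Lemma dln_dln_mu :
  dln (dln mu) = (fun n => dconv (dconv mangoldt mangoldt) mu n - dconv (dln mangoldt) mu n).
Proof.
apply/funext => n; transitivity (- dln (dconv mangoldt mu) n).
  by rewrite dln_mu /dln mulNr.
rewrite dln_dconv dln_mu [dconv mangoldt (fun _ => - _)]dconvC dconvNl.
by rewrite (dconvC _ mangoldt) dconvA opprD opprK addrC.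
Qed.

End DirichletConvolution.
Arguments mu {R} n.
Arguments mangoldt {R} n.
Arguments lnn {R} n.
Arguments done_fun {R} n.
Arguments dunit {R} n.
Arguments selberg_fun {R} n.

(** * Summation estimates *)

Section GrowthEstimates.
Variable R : realType.
Implicit Types (u v a g : nat -> R) (n j N : nat) (x y C : R).

(** A relation instead of a floor function: one estimate then serves at x = N and at x = N / d,
    whose floor is the quotient [N %/ d]. *)
Definition flr x j := (0 < j)%N && (j%:R <= x < j.+1%:R).

Lemma ltr0n' n : (0 < n)%N -> 0 < n%:R :> R. Proof. by rewrite ltr0n. Qed.

Lemma ler1n' n : (0 < n)%N -> 1 <= n%:R :> R. Proof. by rewrite ler1n. Qed.

Lemma flr_nat j : (0 < j)%N -> flr j%:R j.
Proof. by move=> j0; rewrite /flr j0 lexx ltr_nat ltnSn. Qed.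

Lemma flr_div N d : (0 < d <= N)%N -> flr (N%:R / d%:R) (N %/ d).
Proof.
move=> /andP[d0 dN]; have d0' := ltr0n' d0.
rewrite /flr divn_gt0 // dN ler_pdivlMr // -natrM ler_nat leq_trunc_div.
by rewrite ltr_pdivrMr // -natrM ltr_nat -ltn_divLR //= ltnS.
Qed.

Lemma ln_sub_le x y : 0 < x -> 0 < y -> ln y - ln x <= (y - x) / x.
Proof.
move=> x0 y0; rewrite -ln_div ?posrE //.
have -> : y / x = 1 + (y - x) / x by field; rewrite gt_eqF.
by apply: le_ln1Dx; rewrite ltr_pdivlMr // mulN1r ltrBrDl subrr.
Qed.

Lemma ln_sub_ge x y : 0 < x -> 0 < y -> (y - x) / y <= ln y - ln x.
Proof.
move=> x0 y0; have := ln_sub_le y0 x0.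
by rewrite -(opprB y x) mulNr lerNr opprB.
Qed.

Lemma lnn_ge0 n : 0 <= lnn n :> R.
Proof. by case: n => [|n]; [rewrite /lnn ln0 | rewrite /lnn ln_ge0 // ler1n]. Qed.

Lemma lnn1 : lnn 1 = 0 :> R. Proof. by rewrite /lnn ln1. Qed.

Lemma ler_lnn m n : (0 < m)%N -> (m <= n)%N -> lnn m <= lnn n :> R.
Proof.
by move=> m0 mn; rewrite /lnn ler_ln ?posrE ?ltr0n ?ler_nat // (leq_trans m0).
Qed.

Lemma lnnS n : (0 < n)%N -> n.+1%:R^-1 <= (lnn n.+1 - lnn n : R) <= n%:R^-1.
Proof.
move=> n0; have h : n.+1%:R - n%:R = 1 :> R by rewrite -addn1 natrD; ring.
have := @ln_sub_le n%:R n.+1%:R; have := @ln_sub_ge n%:R n.+1%:R.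
rewrite h !mul1r !ltr0n => /(_ n0 isT) -> /(_ n0 isT) -> //.
Qed.

Lemma flr_ln x j : flr x j ->
  [/\ 1 <= j%:R :> R, j%:R <= x, x < j%:R + 1, 0 <= ln x - lnn j & ln x - lnn j <= j%:R^-1].
Proof.
case/andP => j0 /andP[jx xj]; have j1 := ler1n' j0.
have j0' := ltr0n' j0; have x0 : 0 < x by apply: lt_le_trans jx.
rewrite -natr1 in xj.
split => //; first by rewrite subr_ge0 ler_ln ?posrE.
apply: le_trans (ln_sub_le j0' x0) _; rewrite ler_pdivrMr // mulVf ?gt_eqF //; lra.
Qed.

Lemma flr_inv x j : flr x j -> j%:R^-1 <= 2 / x.
Proof.
case/flr_ln => j1 jx xj _ _; have -> : 2 / x = (x / 2)^-1 by rewrite invf_div.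
by rewrite lef_pV2 ?posrE; lra.
Qed.

Lemma sqrt_facts x : 1 <= x -> 1 <= Num.sqrt x /\ Num.sqrt x * Num.sqrt x = x.
Proof.
move=> x1; split; last by rewrite -expr2 sqr_sqrtr //; lra.
by rewrite -[X in X <= _]sqrtr1 ler_sqrt //; lra.
Qed.

Lemma ln_le_sqrt x : 1 <= x -> ln x <= 2 * Num.sqrt x.
Proof.
move=> x1; have [s1 ss] := sqrt_facts x1; rewrite -{1}ss lnM ?posrE; [|lra|lra].
have := @ln_sublinear _ (Num.sqrt x); lra.
Qed.

Lemma ln2_le_sqrt x : 1 <= x -> ln x ^+ 2 <= 16 * Num.sqrt x.
Proof.
move=> x1; have [s1 ss] := sqrt_facts x1; have [t1 tt] := sqrt_facts s1.
have := ln_le_sqrt s1; have : 0 <= ln (Num.sqrt x) by rewrite ln_ge0.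
have -> : ln x = 2 * ln (Num.sqrt x) by rewrite -{1}ss lnM ?posrE; lra.
by set l := ln _ => l0 lt; nra.
Qed.

Lemma sqrtS n : (0 < n)%N ->
  [/\ 1 <= Num.sqrt n%:R :> R, Num.sqrt n%:R * Num.sqrt n%:R = n%:R :> R,
      Num.sqrt n%:R <= Num.sqrt n.+1%:R :> R, Num.sqrt n.+1%:R <= 2 * Num.sqrt n%:R :> R
     & Num.sqrt n.+1%:R * Num.sqrt n.+1%:R = n%:R + 1 :> R].
Proof.
move=> n0; have [s1 ss] := sqrt_facts (ler1n' n0).
have [t1 tt] := sqrt_facts (@ler1n' n.+1 isT); have n1 := ler1n' n0.
split => //; last by rewrite tt natr1.
  by rewrite ler_sqrt ?ler_nat // ltr0n.
by rewrite -natr1 in tt; rewrite -natr1 in t1 *; nra.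
Qed.

(** Makes errors of size n^(-3/2) telescope, which is the form that [limit_of_increments] and
    [abel_limit] ask for. *)
Lemma inv_sqrt_diff n : (0 < n)%N ->
  (n%:R * Num.sqrt n%:R)^-1 <= 6 / Num.sqrt n%:R - 6 / Num.sqrt n.+1%:R :> R.
Proof.
move=> n0; have [] := sqrtS n0; set s := Num.sqrt _; set t := Num.sqrt _ => s1 ss st ts tt.
have t0 : 0 < t by lra.
have -> : 6 / s - 6 / t = 6 * (t - s) / (s * t) by field; rewrite !gt_eqF //; lra.
rewrite -ss ler_pdivlMr ?mulr_gt0 //; [|lra].
rewrite mulrC ler_pdivrMr ?mulr_gt0 //; try lra.
have h : (t - s) * (t + s) = 1 by rewrite -subr_sqr !expr2 tt ss; ring.
suff : t <= 6 * (t - s) * (s * s) by nra.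
have : 1 <= (t - s) * (3 * s) by rewrite -{1}h; nra.
nra.
Qed.

Lemma inv_sqrt_le n : (0 < n)%N ->
  (Num.sqrt n%:R)^-1 <= 4 * (Num.sqrt n.+1%:R - Num.sqrt n%:R) :> R.
Proof.
move=> n0; have [] := sqrtS n0; set s := Num.sqrt _; set t := Num.sqrt _ => s1 ss st ts tt.
have h : (t - s) * (t + s) = 1 by rewrite -subr_sqr !expr2 tt ss; ring.
rewrite -div1r ler_pdivrMr; [|lra]; nra.
Qed.

Lemma sqrt_growth u C : (forall n, (0 < n)%N -> `|u n.+1 - u n| <= C / Num.sqrt n%:R) ->
  exists C' : R, 0 <= C' /\ forall n, (0 < n)%N -> `|u n| <= C' * Num.sqrt n%:R.
Proof.
move=> h; have C0 : 0 <= C by have := h 1%N isT; rewrite sqrtr1 divr1; apply: le_trans.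
exists (`|u 1%N| + 4 * C); split; first by have := normr_ge0 (u 1%N); lra.
elim=> [//|[|n] IH] _; first by rewrite sqrtr1 mulr1 lerDl; lra.
have := h n.+1 isT; have := IH isT; have := @inv_sqrt_le n.+1 isT.
have : `|u n.+2| <= `|u n.+1| + `|u n.+2 - u n.+1| by rewrite -{1}(subrKC (u n.+1) (u n.+2)) ler_normD.
move=> i0 i1 i2 i3.
have [_ _ st _ _] := @sqrtS n.+1 isT.
have : C / Num.sqrt n.+1%:R <= C * (4 * (Num.sqrt n.+2%:R - Num.sqrt n.+1%:R)) by rewrite ler_wpM2l.
have := normr_ge0 (u 1%N); nra.
Qed.

Lemma sum_inv_sqrt N : \sum_(1 <= n < N.+1) (Num.sqrt n%:R)^-1 <= 2 * Num.sqrt N%:R :> R.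
Proof.
elim: N => [|N IH]; first by rewrite big_geq // sqrtr0 mulr0.
rewrite big_nat_recr //=; case: N IH => [|N] IH.
  by rewrite big_geq // sqrtr1 invr1; lra.
have [] := @sqrtS N.+1 isT; set s := Num.sqrt _; set t := Num.sqrt _ => s1 ss st ts tt.
have h : (t - s) * (t + s) = 1 by rewrite -subr_sqr !expr2 tt ss; ring.
have : t^-1 <= 2 * (t - s) by rewrite -div1r ler_pdivrMr; [nra|lra].
rewrite -/s in IH; lra.
Qed.

Lemma sqrt_div N n : Num.sqrt (N%:R / n%:R) = Num.sqrt N%:R / Num.sqrt n%:R :> R.
Proof. by rewrite sqrtrM ?ler0n // sqrtrV ?ler0n. Qed.

Lemma sum_sqrt_ratio N : \sum_(1 <= n < N.+1) Num.sqrt (N%:R / n%:R) <= 2 * N%:R :> R.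
Proof.
under eq_bigr do rewrite sqrt_div.
rewrite -mulr_sumr; apply: le_trans (ler_wpM2l (sqrtr_ge0 _) (sum_inv_sqrt N)) _.
by rewrite mulrCA -expr2 sqr_sqrtr.
Qed.

Lemma sum_inv N : (0 < N)%N -> \sum_(1 <= n < N.+1) n%:R^-1 <= 1 + lnn N :> R.
Proof.
elim: N => [//|[|N] IH] _; first by rewrite big_nat1 lnn1 invr1 addr0.
have /andP[h _] := @lnnS N.+1 isT.
by rewrite big_nat_recr //=; apply: le_trans (lerD (IH isT) h) _; lra.
Qed.

(** This is N^N / N! <= e^N: passing from N to N + 1 adds N ln ((N + 1) / N) <= 1. *)
Lemma sum_ln_ratio N : \sum_(1 <= n < N.+1) (lnn N - lnn n) <= N%:R :> R.
Proof.
elim: N => [|N IH]; first by rewrite big_geq.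
rewrite big_nat_recr //= subrr addr0; case: N IH => [|N] IH; first by rewrite big_geq.
have -> : \sum_(1 <= n < N.+2) (lnn N.+2 - lnn n) =
  \sum_(1 <= n < N.+2) (lnn N.+1 - lnn n) + N.+1%:R * (lnn N.+2 - lnn N.+1) :> R.
  rewrite [X in _ = _ + X](_ : _ = \sum_(1 <= n < N.+2) (lnn N.+2 - lnn N.+1)).
    by rewrite -big_split; apply: eq_bigr => i _ /=; ring.
  by rewrite sumr_const_nat subn1 mulr_natl.
rewrite -[N.+2%:R]natr1; apply: lerD => //.
have /andP[_ h] := @lnnS N.+1 isT.
by apply: le_trans (ler_wpM2l _ h) _; rewrite ?mulfV.
Qed.

(* c is the common limit of the monotone sequences u - v and u + v. *)
Lemma limit_of_increments u v : (forall n, 0 <= v n) ->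
  (forall n, (0 < n)%N -> `|u n.+1 - u n| <= v n - v n.+1) ->
  exists c : R, forall n, (0 < n)%N -> `|u n - c| <= v n.
Proof.
move=> v0 h.
have mono i k : (0 < i)%N -> (i <= k)%N -> u i - v i <= u k - v k /\ u k + v k <= u i + v i.
  move=> i0 ik; elim: k ik => [|k IH] ik; first by move: i0; rewrite leqn0 in ik; rewrite (eqP ik).
  move: ik; rewrite leq_eqVlt => /orP[/eqP <- //|]; rewrite ltnS => ik.
  have [a1 a2] := IH ik; have := h k (leq_trans i0 ik); rewrite ler_norml => /andP[]; lra.
have sep i k : (0 < i)%N -> (0 < k)%N -> u i - v i <= u k + v k.
  move=> i0 k0; have := v0 i; have := v0 k.
  by case: (leqP i k) => [ik|/ltnW ki]; [have [] := mono i k i0 ik | have [] := mono k i k0 ki]; lra.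
pose E : set R := [set x | exists2 j, (0 < j)%N & x = u j - v j]%classic.
exists (sup E) => n n0; rewrite ler_distl; apply/andP; split.
  suff : sup E <= u n + v n by lra.
  by apply: ge_sup => [|_ [j j0 ->]]; [exists (u 1%N - v 1%N); exists 1%N | exact: sep].
suff : u n - v n <= sup E by lra.
by apply: ub_le_sup; [exists (u 1%N + v 1%N) => _ [j j0 ->]; exact: sep | exists n].
Qed.

Lemma abel a g N : \sum_(1 <= n < N.+1) a n * g n =
  (\sum_(1 <= n < N.+1) a n) * g N + \sum_(1 <= n < N) (\sum_(1 <= m < n.+1) a m) * (g n - g n.+1).
Proof.
elim: N => [|N IH]; first by rewrite !big_geq // mul0r addr0.
case: N IH => [|N] IH; first by rewrite !big_nat1 big_geq // addr0.
by rewrite big_nat_recr //= IH [in RHS]big_nat_recr //= [X in _ = _ + X]big_nat_recr //=; ring.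
Qed.

Lemma abel_nondecreasing a g C : 0 <= C ->
  (forall n, `|\sum_(1 <= m < n.+1) a m| <= C) -> (forall n, 0 <= g n) ->
  (forall n, (0 < n)%N -> g n <= g n.+1) ->
  forall N, `|\sum_(1 <= n < N.+1) a n * g n| <= 2 * C * g N.
Proof.
move=> C0 h g0 gm N; case: N => [|N]; first by rewrite big_geq // normr0 mulr_ge0 // mulr_ge0.
rewrite abel; apply: le_trans (ler_normD _ _) _.
have H1 : `|\sum_(1 <= n < N.+1) (\sum_(1 <= m < n.+1) a m) * (g n - g n.+1)| <=
   C * (g N.+1 - g 1%N).
  rewrite -(telescope_sumr g) // mulr_sumr.
  apply: le_trans (ler_norm_sum _ _ _) _; apply: ler_sum_nat => n /andP[n0 _].
  by rewrite normrM distrC (ger0_norm (x := _ - g n)) ?subr_ge0 ?gm // ler_wpM2r // subr_ge0 gm.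
have H2 : `|(\sum_(1 <= n < N.+2) a n) * g N.+1| <= C * g N.+1.
  by rewrite normrM (ger0_norm (g0 _)) ler_wpM2r.
have := g0 1%N; nra.
Qed.

(** With r the partial sums of a, the sum minus r N * g N has increments r n (g n - g n.+1),
    dominated by the telescoping C v; the boundary term r g is itself at most C v, whence 2 C v. *)
Lemma abel_limit a g v C : 0 <= C ->
  (forall n, `|\sum_(1 <= m < n.+1) a m| <= C) -> (forall n, 0 <= v n) ->
  (forall n, (0 < n)%N -> `|g n| <= v n) ->
  (forall n, (0 < n)%N -> `|g n - g n.+1| <= v n - v n.+1) ->
  exists c : R, forall N, (0 < N)%N -> `|\sum_(1 <= n < N.+1) a n * g n - c| <= 2 * C * v N.
Proof.
move=> C0 h v0 gv gm.
pose r n := \sum_(1 <= m < n.+1) a m.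
have [|n0|c hc] := @limit_of_increments (fun N => \sum_(1 <= n < N.+1) a n * g n - r N * g N) (fun n => C * v n).
  by move=> n; rewrite mulr_ge0.
  move=> n0_gt0; rewrite (@big_nat_recr _ _ _ n0.+1) //=.
  have -> : r n0.+1 = r n0 + a n0.+1 by rewrite /r big_nat_recr.
  set U := \sum_(1 <= _ < _) _.
  rewrite [X in `|X|](_ : _ = r n0 * (g n0 - g n0.+1)); last by ring.
  by rewrite normrM -mulrBr ler_pM ?gm // h.
exists c => N N0; have := hc N N0.
have : `|r N * g N| <= C * v N by rewrite normrM ler_pM ?gv // h.
rewrite !ler_norml => /andP[] ? ? /andP[]; lra.
Qed.

End GrowthEstimates.

(** * Weighted sums over a sequence of density kap with bounded error *)

Section Density.
Variable R : realType.
Variables (dl : nat -> R) (kap C : R).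
Hypothesis dens : forall N, `|\sum_(1 <= n < N.+1) dl n - kap * N%:R| <= C.
Implicit Types (n j N : nat) (x : R).

Let kap' : R := `|kap|.
Let C0 : 0 <= C. Proof. by apply: le_trans (dens 0). Qed.

(** The deviation has bounded partial sums and is handled by summation by parts; the constant part
    kap reduces to sums over all integers. Every estimate of the section is split in this way. *)
Let dev n := dl n - kap.

Let dev_le N : `|\sum_(1 <= n < N.+1) dev n| <= C.
Proof. by rewrite sumrB sumr_const_nat subn1 -[kap *+ _]mulr_natr. Qed.

Lemma density_flr x j : flr x j -> `|\sum_(1 <= n < j.+1) dl n - kap * x| <= C + kap'.
Proof.
case/flr_ln => j1 jx xj _ _.
have := dens j; have : `|kap * (j%:R - x)| <= kap'.
  by rewrite normrM ler_piMr // ler_norml; lra.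
rewrite mulrBr !ler_norml => /andP[? ?] /andP[? ?]; lra.
Qed.

Let split_sum (g : nat -> R) N : \sum_(1 <= n < N.+1) dl n * g n =
  \sum_(1 <= n < N.+1) dev n * g n + kap * \sum_(1 <= n < N.+1) g n.
Proof. by rewrite mulr_sumr -big_split; apply: eq_bigr => n _ /=; rewrite /dev; ring. Qed.

Let inv_diff n : (0 < n)%N -> 0 <= n%:R^-1 - n.+1%:R^-1 :> R.
Proof. by move=> n0; rewrite subr_ge0 lef_pV2 ?posrE ?ltr0n // ler_nat. Qed.

Lemma harmonic_density : exists c C' : R, forall x j, flr x j ->
  `|\sum_(1 <= n < j.+1) dl n / n%:R - kap * ln x - c| <= C' / x.
Proof.
have [c1 h1] : exists c : R, forall N, (0 < N)%N ->
    `|\sum_(1 <= n < N.+1) dev n / n%:R - c| <= 2 * C * N%:R^-1.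
  apply: (abel_limit (g := fun n => n%:R^-1) C0 dev_le) => n // n0; first by rewrite ger0_norm.
  by rewrite ger0_norm // inv_diff.
have [c2 h2] : exists c : R, forall N, (0 < N)%N ->
    `|\sum_(1 <= n < N.+1) n%:R^-1 - lnn N - c| <= N%:R^-1 :> R.
  apply: limit_of_increments => // n n0; rewrite (big_nat_recr n.+1) //=.
  by have := lnnS R n0; rewrite -natr1 => /andP[l1 l2]; rewrite ler_norml; lra.
exists (c1 + kap * c2), (2 * (2 * C + 2 * kap')) => x j xj.
have /andP[j0 _] := xj; have [j1 jx xj1 l0 l1] := flr_ln xj.
have := h1 j j0; rewrite split_sum; set S1 := \sum_(_ <= _ < _) _; set S2 := \sum_(_ <= _ < _) _.
move=> a1.
have a2 : `|kap * (S2 - lnn j - c2)| <= kap' * j%:R^-1.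
  by rewrite normrM ler_wpM2l // h2.
have a3 : `|kap * (lnn j - ln x)| <= kap' * j%:R^-1.
  by rewrite normrM ler_wpM2l // distrC ger0_norm.
have -> : S1 + kap * S2 - kap * ln x - (c1 + kap * c2) =
  (S1 - c1) + kap * (S2 - lnn j - c2) + kap * (lnn j - ln x) by ring.
apply: le_trans (ler_normD _ _) _; apply: le_trans (lerD (ler_normD _ _) (lexx _)) _.
have x0 : 0 < x by lra.
have b : j%:R^-1 <= 2 / x.
  exact: flr_inv.
apply: le_trans (_ : (2 * C + 2 * kap') * j%:R^-1 <= _); first lra.
have k0 : 0 <= kap' by exact: normr_ge0.
have C0' := C0.
have -> : 2 * (2 * C + 2 * kap') / x = (2 * C + 2 * kap') * (2 / x) by ring.
by rewrite ler_wpM2l //; lra.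
Qed.

(** ln n / n is not monotone from n = 1 on, so its variation is controlled through the decreasing
    majorant 18 / sqrt n. *)
Let lninv_sqrt n : (0 < n)%N ->
  `|lnn n / n%:R - lnn n.+1 / n.+1%:R| <= 18 / Num.sqrt n%:R - 18 / Num.sqrt n.+1%:R :> R.
Proof.
move=> n0; have := inv_sqrt_diff R n0; have := @ln_le_sqrt R n%:R (ler1n' R n0).
have [s1 ss _ _ _] := sqrtS R n0; have /andP[] := lnnS R n0; have := lnn_ge0 R n.
rewrite -!/(lnn _); set s := Num.sqrt n%:R in s1 ss *; set t := Num.sqrt n.+1%:R.
rewrite -[n.+1%:R]natr1 -ss; set a := lnn n; set b := lnn n.+1 => a0 l1 l2 as_ d.
have s0 : 0 < s by lra.
have -> : a / (s * s) - b / (s * s + 1) = (a / (s * s) - (b - a)) / (s * s + 1).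
  by field; rewrite !gt_eqF //; nra.
have -> : 18 / s - 18 / t = 3 * (6 / s - 6 / t) by ring.
apply: le_trans (_ : 3 * (s * s * s)^-1 <= _); last lra.
rewrite normrM normfV [`|s * s + 1|]ger0_norm; last nra.
rewrite ler_pdivrMr; last nra.
have h1 : a / (s * s) <= 2 / s.
  by rewrite ler_pdivrMr ?mulr_gt0 // mulrA -[_ / s * s]mulrA mulVf ?gt_eqF // mulr1.
have h2 : 0 <= a / (s * s) by rewrite divr_ge0 //; nra.
have h3 : (s * s)^-1 <= s^-1 by rewrite lef_pV2 ?posrE ?mulr_gt0 //; nra.
have h4 : 0 <= (s * s + 1)^-1 by rewrite invr_ge0; nra.
apply: le_trans (_ : 3 / s <= _).
  by rewrite ler_norml; lra.
have -> : 3 * (s * s * s)^-1 * (s * s + 1) = 3 / s + 3 / (s * s * s) by field; rewrite gt_eqF.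
by rewrite lerDl divr_ge0 // !mulr_ge0 // ltW.
Qed.

Lemma lnharmonic_density : exists c C' : R, forall x j, flr x j ->
  `|\sum_(1 <= n < j.+1) dl n * (lnn n / n%:R) - kap / 2 * ln x ^+ 2 - c| <= C' / Num.sqrt x.
Proof.
have [c1 h1] : exists c : R, forall N, (0 < N)%N ->
    `|\sum_(1 <= n < N.+1) dev n * (lnn n / n%:R) - c| <= 2 * C * (18 / Num.sqrt N%:R).
  apply: (abel_limit (g := fun n => lnn n / n%:R) (v := fun N => 18 / Num.sqrt N%:R) C0 dev_le) => n.
  - by rewrite divr_ge0 // sqrtr_ge0.
  - move=> n0; rewrite ger0_norm ?divr_ge0 ?lnn_ge0 //.
    have [s1 ss _ _ _] := sqrtS R n0; have := @ln_le_sqrt R n%:R (ler1n' R n0).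
    rewrite -/(lnn n); set s := Num.sqrt _ in s1 ss * => h.
    rewrite -ss ler_pdivrMr; last nra.
    by rewrite mulrA divfK ?gt_eqF //; lra.
  - exact: lninv_sqrt.
have [c2 h2] : exists c : R, forall N, (0 < N)%N ->
    `|\sum_(1 <= n < N.+1) (lnn n / n%:R) - lnn N ^+ 2 / 2 - c| <= 27 / Num.sqrt N%:R :> R.
  apply: (limit_of_increments (v := fun N => 27 / Num.sqrt N%:R)) => n.
    by rewrite divr_ge0 // sqrtr_ge0.
  move=> n0; rewrite (big_nat_recr n.+1) //=.
  have := inv_sqrt_diff R n0; have := @ln_le_sqrt R n.+1%:R (@ler1n' R n.+1 isT).
  have [s1 ss st ts tt] := sqrtS R n0; have /andP[] := lnnS R n0; have := lnn_ge0 R n.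
  rewrite -!/(lnn _); set s := Num.sqrt n%:R in s1 ss st ts *; set t := Num.sqrt n.+1%:R in st ts tt *.
  rewrite -[n.+1%:R]natr1 -ss; set a := lnn n; set b := lnn n.+1 => a0 l1 l2 as_ d.
  set S := \sum_(_ <= _ < _) _.
  (* Here n is [s * s], a = ln n and b = ln (n + 1). The first term is b times the O(1/n^2) gap
     between b - a and 1/(n + 1), the second is O(1/n^2); both are below a multiple of n^(-3/2). *)
  have -> : S + b / (s * s + 1) - b ^+ 2 / 2 - (S - a ^+ 2 / 2) =
    b * ((s * s + 1)^-1 - (b - a)) + (b - a) ^+ 2 / 2 by field; nra.
  have -> : 27 / s - 27 / t = 9 / 2 * (6 / s - 6 / t) by field; rewrite !gt_eqF //; nra.
  have s0 : 0 < s by lra.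
  apply: le_trans (_ : 9 / 2 * (s * s * s)^-1 <= _); last lra.
  have e1 : 0 <= (b - a) - (s * s + 1)^-1 <= (s * s)^-1 * (s * s)^-1.
    rewrite subr_ge0 l1 /=; apply: le_trans (_ : (s * s)^-1 - (s * s + 1)^-1 <= _); first lra.
    have -> : (s * s)^-1 - (s * s + 1)^-1 = (s * s)^-1 * (s * s + 1)^-1 by field; rewrite !gt_eqF //; nra.
    by rewrite ler_wpM2l ?invr_ge0 ?lef_pV2 ?posrE; nra.
  have e2 : (b - a) ^+ 2 <= (s * s)^-1 * (s * s)^-1.
    have h0 : 0 <= (s * s + 1)^-1 by rewrite invr_ge0; nra.
    have ba0 : 0 <= b - a by lra.
    by rewrite expr2 ler_pM.
  have e3 : (s * s)^-1 * (s * s)^-1 = (s * s * s)^-1 * s^-1 by field; rewrite gt_eqF.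
  have e4 : (s * s)^-1 * (s * s)^-1 <= (s * s * s)^-1.
    by rewrite e3 ler_piMr ?invr_ge0 ?invf_le1 // !mulr_ge0 // ltW.
  have e5 : b * ((b - a) - (s * s + 1)^-1) <= 4 * (s * s * s)^-1.
    apply: le_trans (_ : (4 * s) * ((s * s * s)^-1 * s^-1) <= _); last first.
      by have -> : 4 * s * ((s * s * s)^-1 / s) = 4 / (s * s * s) by field; rewrite gt_eqF.
    have b0 : 0 <= b by exact: lnn_ge0.
    by rewrite -e3; case/andP: e1 => ? ?; apply: ler_pM => //; nra.
  have b0 : 0 <= b by exact: lnn_ge0.
  have e6 : 0 <= b * ((b - a) - (s * s + 1)^-1) by case/andP: e1 => ? ?; apply: mulr_ge0 => //; nra.
  have e7 := sqr_ge0 (b - a).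
  rewrite ler_norml; lra.
exists (c1 + kap * c2), (2 * (36 * C + 27 * kap') + 4 * kap') => x j xj.
have /andP[j0 _] := xj; have [j1 jx xj1 l0 l1] := flr_ln xj.
have := h1 j j0; rewrite split_sum; set S1 := \sum_(_ <= _ < _) _; set S2 := \sum_(_ <= _ < _) _.
move=> a1; have x1 : 1 <= x by lra.
have [z1 zz] := sqrt_facts x1; have [s1 ss] := sqrt_facts j1.
have lx := ln_le_sqrt x1; have lx0 := ln_ge0 x1; have lj := lnn_ge0 R j.
set z := Num.sqrt x in z1 zz lx *; set s := Num.sqrt _ in s1 ss a1.
have a2 : `|kap * (S2 - lnn j ^+ 2 / 2 - c2)| <= kap' * (27 / s).
  by rewrite normrM ler_wpM2l // h2.
have a3 : `|kap * (lnn j ^+ 2 / 2 - ln x ^+ 2 / 2)| <= kap' * (4 / z).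
  rewrite normrM ler_wpM2l // ler_norml.
  have z0 : 0 < z by lra.
  have f1 : 0 <= ln x ^+ 2 / 2 - lnn j ^+ 2 / 2 by nra.
  suff f2 : ln x ^+ 2 / 2 - lnn j ^+ 2 / 2 <= 4 / z.
    have : 0 <= 4 / z by rewrite divr_ge0 // ltW.
    lra.
  apply: le_trans (_ : (ln x - lnn j) * ln x <= _); first nra.
  apply: le_trans (_ : (2 / (z * z)) * (2 * z) <= _).
    apply: ler_pM => //; apply: le_trans l1 _.
    by rewrite zz flr_inv.
  suff -> : 2 / (z * z) * (2 * z) = 4 / z by [].
  by field; rewrite gt_eqF.
have -> : S1 + kap * S2 - kap / 2 * ln x ^+ 2 - (c1 + kap * c2) =
  (S1 - c1) + kap * (S2 - lnn j ^+ 2 / 2 - c2) + kap * (lnn j ^+ 2 / 2 - ln x ^+ 2 / 2) by field.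
apply: le_trans (ler_normD _ _) _; apply: le_trans (lerD (ler_normD _ _) (lexx _)) _.
have b : s^-1 <= 2 * z^-1.
  have h : z <= 2 * s by nra.
  have -> : 2 * z^-1 = (z / 2)^-1 by rewrite invf_div.
  by rewrite lef_pV2 ?posrE; lra.
have k0 : 0 <= kap' by exact: normr_ge0.
have C0' := C0; apply: le_trans (_ : (36 * C + 27 * kap') * s^-1 + 4 * kap' * z^-1 <= _).
  lra.
have K0 : 0 <= 36 * C + 27 * kap' by lra.
have -> : (2 * (36 * C + 27 * kap') + 4 * kap') / z =
  (36 * C + 27 * kap') * (2 / z) + 4 * kap' / z by ring.
by rewrite lerD2r ler_wpM2l.
Qed.

Let dev_mono (g : nat -> R) : (forall n, 0 <= g n) -> (forall n, (0 < n)%N -> g n <= g n.+1) ->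
  forall N, `|\sum_(1 <= n < N.+1) dev n * g n| <= 2 * C * g N.
Proof. exact: abel_nondecreasing C0 dev_le. Qed.

(** The main terms here and in [ln2_density] are antiderivatives of [ln] and of its square;
    [sqrt_growth] sums the O(n^(-1/2)) error of each step. *)
Lemma ln_density : exists C' : R, forall x j, flr x j ->
  `|\sum_(1 <= n < j.+1) dl n * lnn n - kap * (x * ln x - x)| <= C' * Num.sqrt x.
Proof.
have h1 : forall N, `|\sum_(1 <= n < N.+1) dev n * lnn n| <= 2 * C * lnn N.
  by apply: (dev_mono (g := lnn)) => n; [exact: lnn_ge0 | move=> n0; rewrite ler_lnn].
have [D [D0 h2]] : exists D : R, 0 <= D /\ forall N, (0 < N)%N ->
    `|\sum_(1 <= n < N.+1) lnn n - (N%:R * lnn N - N%:R)| <= D * Num.sqrt N%:R.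
  apply: (sqrt_growth (C := 1)) => n n0; rewrite (big_nat_recr n.+1) //=.
  have [s1 ss _ _ _] := sqrtS R n0; have /andP[] := lnnS R n0.
  set s := Num.sqrt _ in s1 ss *; rewrite -[n.+1%:R]natr1 -ss.
  set a := lnn n; set b := lnn n.+1; set S := \sum_(_ <= _ < _) _ => l1 l2.
  have -> : S + b - ((s * s + 1) * b - (s * s + 1)) - (S - (s * s * a - s * s)) =
    1 - s * s * (b - a) by ring.
  have s0 : 0 < s by lra.
  have e1 : s * s * (b - a) <= 1.
    by have := ler_wpM2l (ltW (mulr_gt0 s0 s0)) l2; rewrite mulfV // gt_eqF // mulr_gt0.
  have e2 : 1 - s^-1 <= s * s * (b - a).
    have : s * s * (s * s + 1)^-1 <= s * s * (b - a) by rewrite ler_wpM2l //; nra.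
    have : s * s * (s * s + 1)^-1 = 1 - (s * s + 1)^-1 by field; rewrite gt_eqF //; nra.
    have : (s * s + 1)^-1 <= s^-1 by rewrite lef_pV2 ?posrE; nra.
    lra.
  by rewrite ler_norml; lra.
exists (4 * C + kap' * (D + 2)) => x j xj.
have /andP[j0 _] := xj; have [j1 jx xj1 l0 l1] := flr_ln xj.
have := h1 j; rewrite split_sum; set S1 := \sum_(_ <= _ < _) _; set S2 := \sum_(_ <= _ < _) _.
move=> a1; have x1 : 1 <= x by lra.
have [z1 zz] := sqrt_facts x1; have [s1 ss] := sqrt_facts j1.
have lx := ln_le_sqrt x1; have lx0 := ln_ge0 x1; have lj := lnn_ge0 R j.
have lj2 := ln_le_sqrt j1.
have sz : Num.sqrt j%:R <= Num.sqrt x by rewrite ler_sqrt //; lra.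
have a2 : `|kap * (S2 - (j%:R * lnn j - j%:R))| <= kap' * (D * Num.sqrt x).
  rewrite normrM ler_wpM2l //; apply: le_trans (h2 j j0) _.
  by rewrite ler_wpM2l.
have a3 : `|kap * ((j%:R * lnn j - j%:R) - (x * ln x - x))| <= kap' * (2 * Num.sqrt x).
  rewrite normrM ler_wpM2l // ler_norml.
  have f1 : j%:R * (ln x - lnn j) <= 1 by rewrite -ler_pdivlMl ?mulr1 //; lra.
  have f2 : x - j%:R <= j%:R * (ln x - lnn j) * 2 + 0 + 1 by nra.
  have f3 : 0 <= j%:R * (ln x - lnn j) by rewrite mulr_ge0.
  have f4 : 0 <= (x - j%:R) * ln x by rewrite mulr_ge0 // subr_ge0.
  have f5 : (x - j%:R) * ln x <= ln x by rewrite ler_piMl //; lra.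
  have -> : j%:R * lnn j - j%:R - (x * ln x - x) =
    (x - j%:R) - (x - j%:R) * ln x - j%:R * (ln x - lnn j) by ring.
  apply/andP; split; last lra.
  have f6 : j%:R * (ln x - lnn j) <= (x - j%:R).
    have := @ln_sub_le R j%:R x (ltr0n' R j0); rewrite -/(lnn j) => /(_ ltac:(lra)).
    by rewrite ler_pdivlMr ?(ltr0n' R j0) // mulrC.
  lra.
have -> : S1 + kap * S2 - kap * (x * ln x - x) = S1 + kap * (S2 - (j%:R * lnn j - j%:R)) +
   kap * ((j%:R * lnn j - j%:R) - (x * ln x - x)) by ring.
apply: le_trans (ler_normD _ _) _; apply: le_trans (lerD (ler_normD _ _) (lexx _)) _.
have C0' := C0; rewrite -/(lnn j) in lj2; nra.
Qed.

Lemma ln2_density : exists C' : R, forall x j, flr x j ->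
  `|\sum_(1 <= n < j.+1) dl n * lnn n ^+ 2 - kap * (x * ln x ^+ 2 - 2 * x * ln x + 2 * x)|
    <= C' * Num.sqrt x.
Proof.
have h1 : forall N, `|\sum_(1 <= n < N.+1) dev n * lnn n ^+ 2| <= 2 * C * lnn N ^+ 2.
  apply: (dev_mono (g := fun n => lnn n ^+ 2)) => n; first exact: sqr_ge0.
  by move=> n0; rewrite ler_sqr ?nnegrE ?lnn_ge0 // ler_lnn.
have [D [D0 h2]] : exists D : R, 0 <= D /\ forall N, (0 < N)%N ->
    `|\sum_(1 <= n < N.+1) lnn n ^+ 2 - N%:R * (lnn N ^+ 2 - 2 * lnn N + 2)| <= D * Num.sqrt N%:R.
  apply: (sqrt_growth (C := 7)) => n n0; rewrite (big_nat_recr n.+1) //=.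
  have [s1 ss st ts tt] := sqrtS R n0; have /andP[] := lnnS R n0.
  have := @ln_le_sqrt R n.+1%:R (@ler1n' R n.+1 isT); have := lnn_ge0 R n.+1; rewrite -!/(lnn _).
  set t := Num.sqrt n.+1%:R in st ts tt *.
  set s := Num.sqrt n%:R in s1 ss st ts *; rewrite -[n.+1%:R]natr1 -ss.
  set a := lnn n; set b := lnn n.+1; set S := \sum_(_ <= _ < _) _ => b0 bt l1 l2.
  have s0 : 0 < s by lra.
  (* w = n ln (1 + 1/n) lies between 1 - 1/(n + 1) and 1, and the increment is a combination of b (1
     - w), 1 - w and w (b - a), each O(n^(-1/2)). *)
  pose w := s * s * (b - a).
  have e1 : w <= 1.
    by have := ler_wpM2l (ltW (mulr_gt0 s0 s0)) l2; rewrite mulfV // gt_eqF // mulr_gt0.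
  have e2 : 1 - (s * s + 1)^-1 <= w.
    have : s * s * (s * s + 1)^-1 <= w by rewrite ler_wpM2l //; nra.
    have : s * s * (s * s + 1)^-1 = 1 - (s * s + 1)^-1 by field; rewrite gt_eqF //; nra.
    lra.
  have e3 : (s * s + 1)^-1 <= s^-1 by rewrite lef_pV2 ?posrE; nra.
  have e3' : 0 <= (s * s + 1)^-1 by rewrite invr_ge0; nra.
  have ba0 : 0 <= b - a by lra.
  have w0 : 0 <= w by rewrite !mulr_ge0 // ltW.
  have e4 : w * (b - a) <= s^-1.
    have : w * (b - a) <= 1 * (s * s)^-1 by apply: ler_pM.
    have h : (s * s)^-1 <= s^-1 by rewrite lef_pV2 ?posrE; nra.
    lra.
  have e5 : 0 <= w * (b - a) by apply: mulr_ge0; nra.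
  have e6 : b * (1 - w) <= 2 * s^-1.
    apply: le_trans (_ : (2 * t) * (s * s + 1)^-1 <= _); first by apply: ler_pM => //; lra.
    rewrite ler_pdivrMr; last nra.
    have -> : 2 / s * (s * s + 1) = 2 * s + 2 * (1 / s) by field; rewrite gt_eqF.
    have : t - s <= 1 / s by rewrite ler_pdivlMr; nra.
    lra.
  have e7 : 0 <= b * (1 - w) by apply: mulr_ge0 => //; lra.
  have -> : S + b ^+ 2 - (s * s + 1) * (b ^+ 2 - 2 * b + 2) - (S - s * s * (a ^+ 2 - 2 * a + 2)) =
    2 * (b * (1 - w)) - 2 * (1 - w) + w * (b - a) by rewrite /w; ring.
  rewrite ler_norml; lra.
exists (32 * C + kap' * (D + 60)) => x j xj.
have /andP[j0 _] := xj; have [j1 jx xj1 l0 l1] := flr_ln xj.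
have := h1 j; rewrite split_sum; set S1 := \sum_(_ <= _ < _) _; set S2 := \sum_(_ <= _ < _) _.
move=> a1; have x1 : 1 <= x by lra.
have [z1 zz] := sqrt_facts x1; have [s1 ss] := sqrt_facts j1.
have lx := ln_le_sqrt x1; have lx0 := ln_ge0 x1; have lj := lnn_ge0 R j.
have lj2 := ln2_le_sqrt j1; have lx2 := ln2_le_sqrt x1.
have sz : Num.sqrt j%:R <= Num.sqrt x by rewrite ler_sqrt //; lra.
pose Fj : R := j%:R * (lnn j ^+ 2 - 2 * lnn j + 2).
pose Fx : R := x * ln x ^+ 2 - 2 * x * ln x + 2 * x.
have a2 : `|kap * (S2 - Fj)| <= kap' * (D * Num.sqrt x).
  by rewrite normrM ler_wpM2l //; apply: le_trans (h2 j j0) _; rewrite ler_wpM2l.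
have a3 : `|kap * (Fj - Fx)| <= kap' * (60 * Num.sqrt x).
  rewrite normrM ler_wpM2l //.
  have f1 : j%:R * (ln x - lnn j) <= 1 by rewrite -ler_pdivlMl ?mulr1 //; lra.
  have f3 : 0 <= j%:R * (ln x - lnn j) by rewrite mulr_ge0.
  have -> : Fj - Fx = - ((x - j%:R) * (ln x ^+ 2 - 2 * ln x + 2)) -
     j%:R * (ln x - lnn j) * (ln x + lnn j - 2) by rewrite /Fj /Fx; ring.
  set d := x - j%:R; set e := j%:R * _ in f1 f3 *; set p := ln x in lx lx0 lx2 l0 *.
  have g0 : 0 <= p ^+ 2 - 2 * p + 2 by nra.
  have g1 : 0 <= d * (p ^+ 2 - 2 * p + 2) by apply: mulr_ge0 => //; rewrite /d; lra.
  have g2 : d * (p ^+ 2 - 2 * p + 2) <= p ^+ 2 - 2 * p + 2 by apply: ler_piMl => //; rewrite /d; lra.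
  have g3 : `|e * (p + lnn j - 2)| <= 2 * p + 2.
    rewrite normrM (ger0_norm f3) -[X in _ <= X]mul1r ler_pM // ler_norml; lra.
  move: g3; rewrite !ler_norml => /andP[? ?]; lra.
have -> : S1 + kap * S2 - kap * Fx = S1 + kap * (S2 - Fj) + kap * (Fj - Fx) by ring.
apply: le_trans (ler_normD _ _) _; apply: le_trans (lerD (ler_normD _ _) (lexx _)) _.
have C0' := C0; rewrite -/(lnn j) in lj2; nra.
Qed.

End Density.

Section SumBounds.
Variable R : realType.

(** Turns a constant found for each class into one valid for all classes. *)
Lemma fin_bound (T : finType) (P : T -> R -> Prop) :
  (forall a C C', C <= C' -> P a C -> P a C') -> (forall a, exists C, P a C) ->
  exists C : R, 0 <= C /\ forall a, P a C.
Proof.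
move=> mono /choice [f hf]; exists (\sum_a `|f a|); split; first exact: sumr_ge0.
move=> a; apply: mono (hf a); apply: le_trans (ler_norm _) _.
by rewrite (bigD1 a) //= lerDl sumr_ge0.
Qed.

Lemma sum_approx (u S M e : nat -> R) N :
  (forall d, (0 < d <= N)%N -> `|S d - M d| <= e d) ->
  `|\sum_(1 <= d < N.+1) u d * S d - \sum_(1 <= d < N.+1) u d * M d| <=
  \sum_(1 <= d < N.+1) `|u d| * e d.
Proof.
move=> h; rewrite -sumrB; apply: le_trans (ler_norm_sum _ _ _) _.
apply: ler_sum_nat => d dN; rewrite -mulrBr normrM ler_wpM2l //; exact: h.
Qed.

Lemma norm_scale (M x B : R) : 0 < M -> `|M * x| <= M * B -> `|x| <= B.
Proof. by move=> M0; rewrite normrM gtr0_norm // ler_pM2l. Qed.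

Lemma ler_norm_sum_nat (F e : nat -> R) m n :
  (forall d, (m <= d < n)%N -> `|F d| <= e d) ->
  `|\sum_(m <= d < n) F d| <= \sum_(m <= d < n) e d.
Proof. by move=> h; apply: le_trans (ler_norm_sum _ _ _) _; exact: ler_sum_nat. Qed.

Lemma sum_tail (f : nat -> R) Q M : \sum_(1 <= n < M.+1) ((Q < n)%N)%:R * f n =
  \sum_(1 <= n < M.+1) f n - \sum_(1 <= n < (minn Q M).+1) f n.
Proof.
have le : ((minn Q M).+1 <= M.+1)%N by rewrite ltnS geq_minr.
rewrite (@big_cat_nat _ _ _ (minn Q M).+1) //= [X in _ = X - _](@big_cat_nat _ _ _ (minn Q M).+1) //=.
rewrite addrAC subrr add0r big1_seq ?add0r; last first.
  move=> n; rewrite mem_index_iota ltnS leq_min => /andP[_ /andP[_ /andP[nQ _]]].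
  by rewrite ltnNge nQ mul0r.
apply: eq_big_nat => n /andP[n1 n2]; suff -> : (Q < n)%N by rewrite mul1r.
by move: n1 n2; clear; lia.
Qed.

End SumBounds.

(** * Group rings and real characters *)

Section GroupRing.
Variables (R : realType) (G : finGroupType).
Hypothesis mulGC : forall a b : G, (a * b = b * a)%g.
Implicit Types (f g k : G -> R) (a b : G).

Definition gconv f g : G -> R := fun a => \sum_b f b * g (b^-1 * a)%g.
Definition gdelta a : R := (a == 1%g)%:R.
(** Convolution by [grev f] is the adjoint of convolution by [f] for the Euclidean product on
    functions. *)
Definition grev f : G -> R := fun a => f a^-1%g.

Lemma gconvC f g : gconv f g = gconv g f.
Proof.
apply/funext => a; rewrite /gconv.
rewrite (reindex_inj (h := fun b => (b^-1 * a)%g)) /=; last first.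
  by move=> b c /mulIg /invg_inj.
apply: eq_bigr => b _; rewrite mulrC invMg invgK; congr (g _ * f _).
by rewrite mulGC mulKVg.
Qed.

Lemma gconvA f g k : gconv f (gconv g k) = gconv (gconv f g) k.
Proof.
apply/funext => a; rewrite /gconv.
transitivity (\sum_b \sum_c f b * (g (b^-1 * c)%g * k (c^-1 * a)%g)).
  apply: eq_bigr => b _; rewrite mulr_sumr.
  rewrite (reindex_inj (h := fun c => (b^-1 * c)%g)) /=; last exact: mulgI.
  by apply: eq_bigr => c _; rewrite invMg invgK -!mulgA mulKVg.
rewrite exchange_big /=; apply: eq_bigr => c _; rewrite mulr_suml.
by apply: eq_bigr => b _; rewrite mulrA.
Qed.

Lemma sum_shift f a : \sum_b f (b^-1 * a)%g = \sum_b f b.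
Proof.
rewrite [RHS](reindex_inj (h := fun b => (b^-1 * a)%g)) //= => b c.
by move=> /mulIg /invg_inj.
Qed.

Lemma gconv_delta f : gconv f gdelta = f.
Proof.
rewrite gconvC; apply/funext => a; rewrite /gconv (bigD1 1%g) //= big1 ?addr0.
  by rewrite /gdelta eqxx mul1r invg1 mul1g.
by move=> b /negbTE nb; rewrite /gdelta nb mul0r.
Qed.

Lemma gconvDr f g k : gconv f (fun a => g a + k a) = (fun a => gconv f g a + gconv f k a).
Proof. by apply/funext => a; rewrite -big_split; apply: eq_bigr => b _; rewrite mulrDr. Qed.

Lemma gconv0 f : gconv f (fun=> 0) = (fun=> 0).
Proof. by apply/funext => a; rewrite /gconv big1 // => b _; rewrite mulr0. Qed.

Lemma grevK f : grev (grev f) = f.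
Proof. by apply/funext => a; rewrite /grev invgK. Qed.

Lemma grev_gconv f g : grev (gconv f g) = gconv (grev f) (grev g).
Proof.
apply/funext => a; rewrite /grev /gconv (reindex_inj invg_inj) /=.
by apply: eq_bigr => b _; rewrite -invMg mulGC.
Qed.

Lemma gconv_grev f : gconv f (grev f) 1%g = \sum_b f b ^+ 2.
Proof. by apply: eq_bigr => b _; rewrite /grev mulg1 invgK expr2. Qed.

Lemma sum_sqr_eq0 (T : finType) (F : T -> R) : \sum_i F i ^+ 2 = 0 -> forall i, F i = 0.
Proof.
move=> /eqP; rewrite psumr_eq0 => [/allP h i|i _]; last exact: sqr_ge0.
by have := h i (mem_index_enum i); rewrite sqrf_eq0 => /eqP.
Qed.

(** The squared norm of f * e is the value at 1 of the convolution of f, e and their reverses, and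
    f, its reverse and e already convolve to 0. *)
Lemma gconv_kernel0 f e : gconv (gconv f (grev f)) e = (fun=> 0) -> gconv f e = (fun=> 0).
Proof.
move=> h; apply/funext; apply: sum_sqr_eq0; rewrite -gconv_grev grev_gconv.
rewrite -gconvA (gconvC e) -gconvA (gconvC (grev e)) gconvA gconvA h gconvC.
by rewrite gconv0.
Qed.

Lemma sum_gconv f g : \sum_a gconv f g a = (\sum_a f a) * (\sum_a g a).
Proof.
rewrite /gconv exchange_big mulr_suml; apply: eq_bigr => b _ /=; rewrite mulr_sumr.
by rewrite [RHS](reindex_inj (h := fun c => (b^-1 * c)%g)) //=; exact: mulgI.
Qed.

(** A vector v in both the image and the kernel of a symmetric real S satisfies v v^T = 0, so S and
    its square have the same rank. *)
Lemma symmetric_sqr_submx n (S : 'M[R]_n) : S^T = S -> (S <= S *m S)%MS.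
Proof.
move=> sym.
have k0 : (S :&: kermx S)%MS = 0.
  apply/eqP/rowV0P => v; rewrite sub_capmx => /andP[/submxP[u ->] /sub_kermxP h].
  have : (u *m S) *m (u *m S)^T = 0 by rewrite trmx_mul sym mulmxA h mul0mx.
  move=> /matrixP /(_ 0 0); rewrite !mxE => h0; apply/rowP => j; rewrite [RHS]mxE.
  apply: (@sum_sqr_eq0 _ (fun j => (u *m S) 0 j)).
  by rewrite -[RHS]h0; apply: eq_bigr => i _; rewrite expr2; congr (_ * _); rewrite [RHS]mxE.
have := mxrank_mul_ker S S; rewrite k0 mxrank0 addn0 => rk.
have h : (S *m S <= S)%MS by exact: submxMl.
by have := (mxrank_leqif_sup h).2; rewrite rk eqxx => <-.
Qed.

(* The spectral projector e onto the kernel of convolution by c: the symmetric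
   operator S = c * c^rev satisfies R[G] = ker S + im S. *)
Lemma gconv_kernel c : exists e k, [/\ gdelta = (fun a => e a + gconv c k a),
  gconv c e = (fun=> 0), grev e = e & gconv e e = e].
Proof.
pose s := gconv c (grev c).
have srev : grev s = s by rewrite /s grev_gconv grevK gconvC.
pose S : 'M[R]_#|G| := \matrix_(i, j) s ((enum_val i)^-1 * enum_val j)%g.
have Ssym : S^T = S.
  apply/matrixP => i j; rewrite !mxE -[in LHS]srev /grev; congr (s _).
  by rewrite invMg invgK.
have /submxP[D SD] := symmetric_sqr_submx Ssym.
pose fn (u : 'rV[R]_#|G|) : G -> R := fun a => u 0 (enum_rank a).
have fnS u : fn (u *m S) = gconv (fn u) s.
  apply/funext => a; rewrite /fn mxE /gconv [RHS](reindex_onto enum_val enum_rank) /=; last first.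
    by move=> b _; rewrite enum_rankK.
  by apply: eq_big => [i|i _]; rewrite ?enum_valK ?eqxx // mxE enum_rankK.
pose d : 'rV[R]_#|G| := \row_i gdelta (enum_val i).
have fnd : fn d = gdelta by apply/funext => a; rewrite /fn mxE enum_rankK.
(* S = D S S, read on the unit vector d, says s = w * s * s; hence e, the unit minus w * s, is
   annihilated by s. *)
pose w := fn (d *m D); pose e a := gdelta a - gconv w s a.
have es : gconv e s = (fun=> 0).
  have h : gconv gdelta s = gconv (gconv w s) s.
    by rewrite -fnd -fnS {1}SD !mulmxA !fnS.
  apply/funext => a; rewrite {1}/gconv /e; under eq_bigr do rewrite mulrBl.
  by rewrite sumrB -/(gconv gdelta s a) -/(gconv (gconv w s) s a) h subrr.
have ce : gconv c e = (fun=> 0) by apply: gconv_kernel0; rewrite gconvC.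
have ce' : gconv (grev c) e = (fun=> 0).
  by apply: gconv_kernel0; rewrite grevK (gconvC (grev c)) gconvC.
have de : gdelta = (fun a => e a + gconv c (gconv (grev c) w) a).
  by apply/funext => a; rewrite gconvA gconvC /e subrK.
have drev : grev gdelta = gdelta.
  by apply/funext => a; rewrite /grev /gdelta -(inj_eq invg_inj) invgK invg1.
have ee : gconv e e = e.
  rewrite -[RHS]gconv_delta {1}de gconvDr gconvA (gconvC e c) ce.
  by apply/funext => a; rewrite (gconvC (fun=> 0)) gconv0 addr0.
have de' : gdelta = (fun a => grev e a + gconv (grev c) (grev (gconv (grev c) w)) a).
  rewrite -[LHS]drev {1}de -grev_gconv; by [].
have ee1 : gconv e (grev e) = e.
  rewrite -[RHS]gconv_delta {1}de' gconvDr gconvA (gconvC e (grev c)) ce'.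
  by apply/funext => a; rewrite (gconvC (fun=> 0)) gconv0 addr0.
have ee2 : gconv (grev e) e = grev e.
  rewrite -[RHS]gconv_delta {1}de gconvDr gconvA.
  have -> : gconv (grev e) c = (fun=> 0).
    by rewrite -[c]grevK -grev_gconv gconvC ce'.
  by apply/funext => a; rewrite (gconvC (fun=> 0)) gconv0 addr0.
exists e, (gconv (grev c) w); split => //.
by rewrite -ee2 gconvC ee1.
Qed.

(** Over the complex numbers e is 1/h times a sum of distinct characters, and e 1 <= 1/h leaves only
    one. Over R: E = e 1 is the sum of e^2, positivity gives |e| <= E, hence E <= h E^2; with E <=
    1/h this forces h E = 1 and |e| = E everywhere. *)
Lemma idempotent_is_character e : grev e = e -> gconv e e = e ->
  (forall a, e a <= #|G|%:R^-1) -> (exists a, e a != 0) ->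
  forall chi : G -> R, chi = (fun a => #|G|%:R * e a) ->
  (forall a, chi a = 1 \/ chi a = -1) /\ (forall a b, chi (a * b)%g = chi a * chi b).
Proof.
move=> er ee eh [a0 ea0] chi chiE.
set h := #|G|%:R in eh chiE; have h0 : 0 < h by rewrite ltr0n; apply/card_gt0P; exists 1%g.
pose E := e 1%g.
have E2 : \sum_b e b ^+ 2 = E by rewrite -gconv_grev er ee.
have E2' a : \sum_b e (b^-1 * a)%g ^+ 2 = E.
  rewrite -E2 [RHS](reindex_inj (h := fun b => (b^-1 * a)%g)) //= => b c.
  by move=> /mulIg /invg_inj.
have conv a : \sum_b e b * e (b^-1 * a)%g = e a by rewrite -[in RHS]ee.
(* Nonnegativity for s = 1 and s = -1 bounds |e a| by E. Once e a = s E with s = chi a, the sum is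
   0, so every e b equals chi a times e at b^-1 a: this is multiplicativity. *)
have sq (s : R) a : s * s = 1 -> \sum_b (e b - s * e (b^-1 * a)%g) ^+ 2 = 2 * E - 2 * s * e a.
  move=> ss; transitivity (\sum_b (e b ^+ 2 + e (b^-1 * a)%g ^+ 2 + (- 2 * s) * (e b * e (b^-1 * a)%g))).
    apply: eq_bigr => b _; set x := e (_ * _)%g.
    transitivity (e b ^+ 2 + (s * s) * x ^+ 2 + (- 2 * s) * (e b * x)); first by ring.
    by rewrite ss mul1r.
  by rewrite !big_split /= E2 E2' -mulr_sumr conv; ring.
have eE a : `|e a| <= E.
  have h1 : 0 <= 2 * E - 2 * 1 * e a by rewrite -sq ?mulr1 // sumr_ge0 // => b _; exact: sqr_ge0.
  have h2 : 0 <= 2 * E - 2 * -1 * e a by rewrite -sq ?mulrNN ?mulr1 // sumr_ge0 // => b _; exact: sqr_ge0.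
  by rewrite ler_norml; lra.
have E0 : 0 < E by apply: lt_le_trans (eE a0); rewrite normr_gt0.
have le2 b : e b ^+ 2 <= E ^+ 2 by rewrite -real_normK ?num_real // ler_sqr ?nnegrE // ltW.
have Eh : h * E = 1.
  apply/eqP; rewrite eq_le; apply/andP; split.
    by have := eh 1%g; rewrite -/E -(ler_pM2l h0) mulfV ?gt_eqF.
  have : E <= h * E ^+ 2.
    rewrite -{1}E2; apply: le_trans (ler_sum _ (fun b _ => le2 b)) _.
    by rewrite sumr_const -[_ *+ _]mulr_natl.
  by rewrite expr2 mulrA -{1}[E]mul1r ler_pM2r.
have eqE b : e b ^+ 2 = E ^+ 2.
  have s0 : \sum_b (E ^+ 2 - e b ^+ 2) == 0.
    rewrite sumrB E2 sumr_const -[_ *+ _]mulr_natl -/h expr2 mulrA Eh mul1r subrr //.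
  move: s0; rewrite psumr_eq0 => [/allP/(_ b (mem_index_enum b))|c _]; last by rewrite subr_ge0.
  by rewrite subr_eq0 eq_sym => /eqP.
have chi1 a : chi a = 1 \/ chi a = -1.
  have : chi a ^+ 2 == 1 by rewrite chiE exprMn eqE -exprMn Eh expr1n.
  by rewrite sqrf_eq1 => /orP[/eqP|/eqP]; [left|right].
have inv_h x : h * x = 1 -> x = E.
  by move=> hx; rewrite -[x]mul1r -[E]mul1r -(mulVf (lt0r_neq0 h0)) -!mulrA hx Eh.
have key a b : chi (b^-1 * a)%g = chi a * chi b.
  have ss : chi a * chi a = 1 by have [->|->] := chi1 a; rewrite ?mulrNN mulr1.
  have eaE : chi a * e a = E.
    by apply: inv_h; rewrite mulrCA -{1}ss chiE.
  have := sq _ a ss; rewrite -mulrA eaE subrr => /sum_sqr_eq0 /(_ b) /eqP.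
  rewrite subr_eq0 => /eqP eb.
  transitivity (h * (chi a * (chi a * e (b^-1 * a)%g))).
    by rewrite mulrA ss mul1r chiE.
  by rewrite -eb mulrCA -[h * e b]/((fun a => h * e a) b) -chiE.
split=> // a b.
by rewrite -[a]invgK key mulrC; congr (_ * _); rewrite chiE -[in LHS]er /grev.
Qed.

End GroupRing.

(** * Nonvanishing of L(1, chi) for a real character *)

Section RealCharacter.
Variables (R : realType) (chi : nat -> R) (C : R).
Hypothesis chiM : forall m n, chi (m * n)%N = chi m * chi n.
Hypothesis chi_val : forall n, [\/ chi n = 0, chi n = 1 | chi n = -1].
Hypothesis chi1 : chi 1%N = 1.
Hypothesis chi_sum : forall N, `|\sum_(1 <= n < N.+1) chi n| <= C.
(** Encodes L(1, chi) = 0, together with a tail of size O(1/N). *)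
Hypothesis chi_harm : forall N, (0 < N)%N -> `|\sum_(1 <= n < N.+1) chi n / n%:R| <= C / N%:R.

Let C_ge0 : 0 <= C. Proof. exact: le_trans (normr_ge0 _) (chi_sum 0). Qed.

Let g n := dsum (fun d _ => chi d) n.

(** Horner form of 1 + chi p + ... + (chi p)^k, the value of [g] at p^k. *)
Let s p k : R := iter k (fun x => 1 + chi p * x) 1.

Lemma dsum_char_prime p k m : prime p -> ~~ (p %| m)%N -> g (p ^ k * m) = s p k * g m.
Proof.
move=> pp npm; have m0 : (0 < m)%N by case: m npm => //; rewrite dvdn0.
have pm0 j : (0 < p ^ j * m)%N by rewrite muln_gt0 expn_gt0 (prime_gt0 pp) m0.
pose u := fun d (_ : nat) => if (p %| d)%N then 0 else chi d.
have ue j : dsum u (p ^ j * m) = g m.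
  elim: j => [|j IH].
    rewrite expn0 mul1n; apply: eq_dsum => d i _ _ dm; rewrite /u.
    by case: ifP => // pd; rewrite -dm dvdn_mulr in npm.
  rewrite expnS -mulnA (dsum_prime _ pp) //.
  rewrite -[in RHS]IH -[RHS]add0r; congr (_ + _).
    have <- : 0 * dsum u (p ^ j * m) = 0 by rewrite mul0r.
    rewrite -dsumZ; apply: eq_dsum => d i _ _ _.
    by rewrite /u dvdn_mulr // mul0r.
  by apply: eq_dsum => d i _ _ _; rewrite /u; case: (p %| d)%N.
elim: k => [|k IH]; first by rewrite expn0 mul1n mul1r.
rewrite expnS -mulnA /g (dsum_prime _ pp) //.
rewrite -[X in _ + X]/(dsum u _) ue.
rewrite (@eq_dsum _ _ (fun d _ => chi p * chi d)); last by move=> *; rewrite chiM.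
have -> : dsum (fun d _ => chi p * chi d) (p ^ k * m) = chi p * (s p k * g m) by rewrite dsumZ -IH.
by transitivity ((1 + chi p * s p k) * g m); first by ring.
Qed.

Let s_ge0 p k : 0 <= s p k.
Proof.
suff : 0 <= s p k /\ 0 <= s p k.+1 by case.
elim: k => [|k [IH1 IH2]]; rewrite /s /= -?/(s _ _).
  by split => //; case: (chi_val p) => ->; lra.
by split => //; rewrite -/(s p k); case: (chi_val p) => ->; rewrite -/(s p k); lra.
Qed.

Let s_double p k : 1 <= s p k.*2.
Proof.
elim: k => [//|k IH]; rewrite doubleS /s /= -/(s p k.*2).
by case: (chi_val p) => ->; lra.
Qed.

Lemma pdiv_split n : (1 < n)%N -> exists p k m,
  [/\ prime p, (0 < k)%N, ~~ (p %| m)%N, (0 < m < n)%N & n = (p ^ k * m)%N].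
Proof.
move=> n1; have pp := pdiv_prime n1; have n0 := ltnW n1.
have [m cm E] := pfactor_coprime pp n0; exists (pdiv n), (logn (pdiv n) n), m.
have k0 : (0 < logn (pdiv n) n)%N by rewrite logn_gt0 mem_primes pp n0 pdiv_dvd.
have m0 : (0 < m)%N by move: n0; rewrite {1}E muln_gt0 => /andP[].
split => //; last by rewrite mulnC.
  by rewrite prime_coprime in cm.
rewrite m0 /= [X in (_ < X)%N]E ltn_Pmulr //.
exact: leq_ltn_trans k0 (ltn_expl _ (prime_gt1 pp)).
Qed.

Lemma dsum_char_ge0 n : 0 <= g n.
Proof.
elim/ltn_ind: n => n IH; case: (leqP n 1) => [|n1].
  by case: n {IH} => [|[|//]] _; rewrite /g ?dsum0 ?dsum1 ?chi1.
have [p [k [m [pp k0 pm /andP[m0 mn] E]]]] := pdiv_split n1.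
by rewrite {1}E dsum_char_prime // mulr_ge0 // IH.
Qed.

Lemma dsum_char_sqr n : (0 < n)%N -> 1 <= g (n ^ 2).
Proof.
elim/ltn_ind: n => n IH n0; case: (leqP n 1) => [|n1].
  by case: n n0 {IH} => [|[|//]] // _; rewrite /g dsum1 chi1.
have [p [k [m [pp k0 pm /andP[m0 mn] E]]]] := pdiv_split n1.
rewrite {1}E expnMn -expnM muln2 dsum_char_prime ?Euclid_dvdX ?(negbTE pm) //.
by rewrite -[X in X <= _]mulr1 ler_pM // IH.
Qed.

(** The weight 1 - n/N vanishes at n = N, which brings the error in [A_approx] down to d/N. A bare
    count errs by O(1) for each d, and D = i^6 such errors would exceed the lower bound of order
    i^5. *)
Let A N d : R := \sum_(1 <= k < (N %/ d).+1) (1 - (d * k)%:R / N%:R).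

Let A_term N d k : (0 < N)%N -> (d * k <= N)%N -> 0 <= 1 - (d * k)%:R / N%:R :> R.
Proof.
by move=> N0 h; rewrite subr_ge0 ler_pdivrMr ?ltr0n // mul1r ler_nat.
Qed.

Let A_le N d : (0 < d)%N -> (0 < N)%N -> 0 <= A N d <= (N %/ d)%:R.
Proof.
move=> d0 N0; apply/andP; split.
  rewrite /A big_nat_cond; apply: sumr_ge0 => k /andP[/andP[_ kN] _]; apply: A_term => //.
  by rewrite ltnS leq_divRL // in kN; rewrite mulnC.
apply: le_trans (_ : \sum_(1 <= k < (N %/ d).+1) 1 <= _); last by rewrite sumr_const_nat subn1.
by apply: ler_sum_nat => k _; rewrite gerBl divr_ge0.
Qed.

Let A_mono N d : (0 < d)%N -> (0 < N)%N -> A N d.+1 <= A N d.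
Proof.
move=> d0 N0; have le : (N %/ d.+1 <= N %/ d)%N by rewrite leq_div2l.
rewrite [X in _ <= X](@big_cat_nat _ _ _ (N %/ d.+1).+1) //=.
rewrite -[X in X <= _]addr0 lerD //.
  apply: ler_sum_nat => k _; rewrite lerD2l lerN2 ler_wpM2r ?invr_ge0 // ler_nat leq_mul //.
rewrite big_nat_cond; apply: sumr_ge0 => k /andP[/andP[_ kN] _]; apply: A_term => //.
by rewrite ltnS leq_divRL // in kN; rewrite mulnC.
Qed.

Let A_approx N d : (0 < d <= N)%N ->
  `|A N d - (N%:R / d%:R / 2 - 2^-1)| <= d%:R / N%:R.
Proof.
move=> dN; have /andP[d0 dN'] := dN; have N0 : (0 < N)%N by apply: leq_trans dN'.
have d0' := ltr0n' R d0; have N0' := ltr0n' R N0.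
have [j1 jx xj _ _] := flr_ln (flr_div R dN).
have sumk j : \sum_(1 <= k < j.+1) k%:R = j%:R * (j%:R + 1) / 2 :> R.
  elim: j => [|j IH]; first by rewrite big_geq // mul0r mul0r.
  by rewrite big_nat_recr //= IH -natr1; field.
have -> : A N d = (N %/ d)%:R - (N %/ d)%:R * ((N %/ d)%:R + 1) / 2 / (N%:R / d%:R).
  rewrite /A sumrB sumr_const_nat subn1; congr (_ - _).
  rewrite -sumk mulr_suml; apply: eq_bigr => k _; rewrite natrM; field.
  by rewrite !gt_eqF.
rewrite -[d%:R / N%:R]invf_div; set x := _ / _ in jx xj *; set j := _%:R in j1 jx xj *.
have x0 : 0 < x by lra.
have -> : j - j * (j + 1) / 2 / x - (x / 2 - 2^-1) = ((x - j) * (1 - (x - j)) / 2) / x.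
  by field; rewrite gt_eqF.
have x0' : 0 <= x^-1 by rewrite invr_ge0 ltW.
rewrite normrM (ger0_norm x0') ler_piMl //.
rewrite ler_norml; nra.
Qed.

(* Bounds S = sum_{n <= N} (1 * chi)(n) (1 - n/N) with N = 4 i^10 from both sides: the squares
   alone give S >= (3/4) i^5, since 1 * chi >= 0 is at least 1 on squares, whereas summing
   over d <= D = i^6 and d > D separately gives S = O(i^4). *)
Lemma real_character_absurd : False.
Proof.
(* Dominates all coefficients of the upper bound [Sle] relative to i^4; i > 4 K / 3 then contradicts
   (3/4) i^5 <= K i^4. *)
pose K := (2 * C + C / 2 + 1 + 16 * C).
have [i0 hi0] : exists i : nat, 4 / 3 * K < i%:R.
  exists (Num.bound `|4 / 3 * K|); apply: le_lt_trans (ler_norm _) _.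
  exact: archi_boundP.
pose i := i0.+1.
have i1 : (1 <= i%:R :> R) by rewrite ler1n.
have hi : 4 / 3 * K < i%:R by apply: lt_le_trans hi0 _; rewrite ler_nat leqnSn.
pose N := (4 * i ^ 10)%N; pose D := (i ^ 6)%N.
have N0 : (0 < N)%N by rewrite muln_gt0 expn_gt0.
have D0 : (0 < D)%N by rewrite expn_gt0.
have DN : (D <= N)%N.
  by apply: leq_trans (leq_pmull _ _) => //; rewrite leq_pexp2l.
have N0' := ltr0n' R N0; have D0' := ltr0n' R D0.
have NE : N%:R = 4 * i%:R ^+ 10 :> R by rewrite natrM natrX.
have DE : D%:R = i%:R ^+ 6 :> R by rewrite natrX.
pose S := \sum_(1 <= n < N.+1) g n * (1 - n%:R / N%:R).
have SE : S = \sum_(1 <= d < N.+1) chi d * A N d.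
  rewrite /S /g; under eq_bigr do rewrite (dsum_mulr _ (fun n => 1 - n%:R / N%:R)).
  by rewrite sum_dsum; apply: eq_bigr => d _; rewrite mulr_sumr.
have lower : 3 / 4 * i%:R ^+ 5 <= S.
  pose F n := g n * (1 - n%:R / N%:R).
  have F0 n : (n <= N)%N -> 0 <= F n.
    by move=> nN; rewrite mulr_ge0 ?dsum_char_ge0 // -[n in n%:R]mul1n A_term // mul1n.
  have sq M : (M ^ 2 <= N)%N -> \sum_(1 <= m < M.+1) F (m ^ 2)%N <= \sum_(1 <= n < (M ^ 2).+1) F n.
    elim: M => [|M IH] MN; first by rewrite !big_geq.
    have lt : (M ^ 2 < M.+1 ^ 2)%N by rewrite ltn_exp2r.
    rewrite big_nat_recr //= [X in _ <= X](@big_cat_nat _ _ _ (M ^ 2).+1) //=; last exact: leqW.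
    apply: lerD; first by apply: IH; apply: leq_trans MN; apply: ltnW.
    rewrite big_nat_recr //= lerDr big_nat_cond; apply: sumr_ge0 => n /andP[/andP[_ h] _].
    by apply: F0; apply: leq_trans (ltnW h) MN.
  have MN : ((i ^ 5) ^ 2 <= N)%N by rewrite -expnM leq_pmull.
  apply: le_trans (_ : \sum_(1 <= m < (i ^ 5).+1) F (m ^ 2)%N <= _).
    rewrite -natrX -[(i ^ 5)%N in X in X <= _](subn1 (i ^ 5).+1) mulr_natr -sumr_const_nat.
    apply: ler_sum_nat => m /andP[m0 mi]; rewrite -[X in X <= _]mul1r.
    apply: ler_pM => //; first exact: dsum_char_sqr.
    rewrite lerBrDr -lerBrDl ler_pdivrMr // NE.
    have : (m ^ 2)%:R <= i%:R ^+ 10 :> R.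
      by rewrite -natrX ler_nat (_ : 10 = 5 * 2)%N // expnM leq_exp2r.
    lra.
  apply: le_trans (sq _ MN) _.
  rewrite /S (@big_cat_nat _ _ _ ((i ^ 5) ^ 2).+1 1 N.+1) //= lerDl big_nat_cond.
  by apply: sumr_ge0 => n /andP[/andP[_ h] _]; apply: F0.
have part1 : `|\sum_(1 <= d < D.+1) chi d * A N d| <= N%:R / 2 * (C / D%:R) + C / 2 + D%:R * (D%:R / N%:R).
  have e1 : `|\sum_(1 <= d < D.+1) chi d * A N d - \sum_(1 <= d < D.+1) chi d * (N%:R / d%:R / 2 - 2^-1)| <=
     D%:R * (D%:R / N%:R).
    apply: le_trans (sum_approx (e := fun=> D%:R / N%:R) _ _) _.
      move=> d /andP[d0 dD]; apply: le_trans (A_approx _) _; first by rewrite d0 (leq_trans dD).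
      by rewrite ler_wpM2r ?invr_ge0 // ler_nat.
    apply: le_trans (_ : \sum_(1 <= d < D.+1) D%:R / N%:R <= _).
      apply: ler_sum_nat => d _; rewrite ler_piMl ?divr_ge0 //.
      by case: (chi_val d) => ->; rewrite ?normr0 ?normrN1 ?normr1.
    by rewrite sumr_const_nat subn1 -[_ *+ _]mulr_natl.
  have e2 : \sum_(1 <= d < D.+1) chi d * (N%:R / d%:R / 2 - 2^-1) =
     N%:R / 2 * (\sum_(1 <= d < D.+1) chi d / d%:R) - 2^-1 * \sum_(1 <= d < D.+1) chi d.
    by rewrite !mulr_sumr -sumrB; apply: eq_bigr => d _; ring.
  have e3 : `|N%:R / 2 * (\sum_(1 <= d < D.+1) chi d / d%:R)| <= N%:R / 2 * (C / D%:R).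
    by rewrite normrM ger0_norm ?ler_wpM2l ?divr_ge0 // chi_harm.
  have := chi_sum D; move: e1 e3; rewrite e2 !ler_norml => /andP[? ?] /andP[? ?] /andP[? ?].
  by apply/andP; split; lra.
have part2 : `|\sum_(D.+1 <= d < N.+1) chi d * A N d| <= 2 * C * (N%:R / D%:R).
  (* Cutting chi off below D and freezing [A N] up to D + 1 lets summation by parts run over 1..N:
     the partial sums stay below 2 C and [gg] is nonincreasing. *)
  pose a d := if (D < d)%N then chi d else 0; pose gg d := A N (maxn d D.+1).
  have -> : \sum_(D.+1 <= d < N.+1) chi d * A N d = \sum_(1 <= d < N.+1) a d * gg d.
    have h0 : \sum_(1 <= d < D.+1) a d * gg d = 0.
      rewrite big_nat_cond big1 // => d /andP[/andP[_ dD] _].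
      by rewrite /a ltnNge -ltnS dD mul0r.
    rewrite [RHS](@big_cat_nat _ _ _ D.+1) //= h0 add0r.
    by apply: eq_big_nat => d /andP[Dd _]; rewrite /a /gg Dd (maxn_idPl _).
  have pa M : `|\sum_(1 <= d < M.+1) a d| <= 2 * C.
    case: (leqP M D) => MD.
      rewrite big_nat_cond big1 ?normr0; first by have := C_ge0; lra.
      by move=> d /andP[/andP[_ dM] _]; rewrite /a ltnNge (leq_trans _ MD).
    have -> : \sum_(1 <= d < M.+1) a d = \sum_(1 <= d < M.+1) chi d - \sum_(1 <= d < D.+1) chi d.
      rewrite !(@big_cat_nat _ _ _ D.+1 1 M.+1) //=; try by rewrite ltnS ltnW.
      rewrite [X in X + _]big_nat_cond big1 ?add0r.
        rewrite addrAC subrr add0r; apply: eq_big_nat => d /andP[Dd _]; by rewrite /a Dd.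
      by move=> d /andP[/andP[_ dD] _]; rewrite /a ltnNge -ltnS dD.
    by apply: le_trans (ler_normB _ _) _; rewrite mulr_natl mulr2n lerD.
  have gg_mono d : (0 < d)%N -> gg d.+1 <= gg d.
    move=> d0; rewrite /gg; case: (ltnP D d) => h.
      by rewrite (maxn_idPl _) ?(maxn_idPl _) // ?A_mono //; apply: leq_trans h _.
    by rewrite (maxn_idPr _) ?(maxn_idPr _) //; apply: leq_trans h _.
  have gg_ge0 d : 0 <= gg d.
    by have /andP[] := @A_le N (maxn d D.+1) (leq_trans (isT : 0 < D.+1)%N (leq_maxr _ _)) N0.
  rewrite abel; apply: le_trans (ler_normD _ _) _.
  have h1 : `|(\sum_(1 <= n < N.+1) a n) * gg N| <= 2 * C * gg N.
    by rewrite normrM (ger0_norm (gg_ge0 _)) ler_wpM2r.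
  have h2 : `|\sum_(1 <= n < N) (\sum_(1 <= m < n.+1) a m) * (gg n - gg n.+1)| <= 2 * C * (gg 1%N - gg N).
    rewrite -[gg 1%N - _]opprB -(telescope_sumr gg) // -sumrN mulr_sumr.
    apply: le_trans (ler_norm_sum _ _ _) _; apply: ler_sum_nat => n /andP[n0 _].
    by rewrite normrM opprB (ger0_norm (x := gg n - _)) ?subr_ge0 ?gg_mono // ler_wpM2r // subr_ge0 gg_mono.
  apply: le_trans (_ : 2 * C * gg 1%N <= _); first by lra.
  rewrite ler_wpM2l ?mulr_ge0 //.
  have /andP[_ h] := @A_le N D.+1 isT N0; rewrite /gg (maxn_idPr _) //; apply: le_trans h _.
  have DN' : (0 < D <= N)%N by rewrite D0.
  have [_ h' _ _ _] := flr_ln (flr_div R DN').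
  by apply: le_trans h'; rewrite ler_nat leq_div2l.
have S12 : S = \sum_(1 <= d < D.+1) chi d * A N d + \sum_(D.+1 <= d < N.+1) chi d * A N d.
  by rewrite SE (@big_cat_nat _ _ _ D.+1).
have i0' : 0 < i%:R :> R by lra.
have ND : N%:R / D%:R = 4 * i%:R ^+ 4 :> R.
  by rewrite NE DE; field; rewrite gt_eqF.
have DDN : D%:R * (D%:R / N%:R) = i%:R ^+ 2 / 4 :> R.
  by rewrite NE DE; field; rewrite gt_eqF.
have E1 : N%:R / 2 * (C / D%:R) = 2 * C * i%:R ^+ 4.
  by transitivity (N%:R / D%:R * (C / 2)); [ring | rewrite ND; field].
move: part1 part2; rewrite E1 ND DDN => part1 part2.
have Sle : S <= 2 * C * i%:R ^+ 4 + C / 2 + i%:R ^+ 2 / 4 + 2 * C * (4 * i%:R ^+ 4).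
  move: part1 part2; rewrite S12 !ler_norml => /andP[_ h1] /andP[_ h2]; lra.
have i4 : 1 <= i%:R ^+ 4 :> R by rewrite exprn_ege1.
have i2 : i%:R ^+ 2 <= i%:R ^+ 4 :> R by rewrite ler_weXn2l.
have fin : 3 / 4 * i%:R ^+ 5 <= K * i%:R ^+ 4.
  apply: le_trans lower (le_trans Sle _); rewrite /K; have C0 := C_ge0; nra.
have : 3 / 4 * i%:R <= K.
  have e5 : i%:R ^+ 5 = i%:R * i%:R ^+ 4 :> R by rewrite -exprS.
  by rewrite e5 mulrA in fin; rewrite -(ler_pM2r (lt_le_trans ltr01 i4)).
lra.
Qed.

End RealCharacter.

(** * Logarithmic averages *)

Section LogAverage.
Variable R : realType.
Implicit Types (n j k N u : nat).

Lemma sum_floor_swap (F : nat -> nat -> R) N :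
  \sum_(1 <= d < N.+1) \sum_(1 <= k < (N %/ d).+1) F d k =
  \sum_(1 <= k < N.+1) \sum_(1 <= d < (N %/ k).+1) F d k.
Proof. by rewrite -!sum_dsum; apply: eq_bigr => n _; rewrite dsum_sym. Qed.

Let one_dens N : `|\sum_(1 <= n < N.+1) 1 - 1 * N%:R| <= 0 :> R.
Proof. by rewrite sumr_const_nat subn1 mul1r subrr normr0. Qed.

Lemma sum_lnn_floor : exists E : R, 0 <= E /\ forall N d, (0 < d <= N)%N ->
  `|\sum_(1 <= n < (N %/ d).+1) lnn n - (N%:R / d%:R * (lnn N - lnn d) - N%:R / d%:R)| <=
  E * Num.sqrt (N%:R / d%:R).
Proof.
have [E hE] := ln_density one_dens; exists `|E|; split => // N d dN.
have := hE _ _ (flr_div R dN); under eq_bigr do rewrite mul1r; rewrite mul1r.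
have -> : ln (N%:R / d%:R) = lnn N - lnn d :> R.
  by case/andP: dN => d0 dN; rewrite ln_div // posrE ltr0n // (leq_trans d0).
by move=> /le_trans; apply; rewrite ler_wpM2r ?sqrtr_ge0 // ler_norm.
Qed.

Lemma sum_lnn_div : exists E : R, forall N, (0 < N)%N ->
  \sum_(1 <= n < N.+1) lnn n / n%:R <= lnn N ^+ 2 / 2 + E.
Proof.
have [c [E hE]] := lnharmonic_density one_dens; exists (`|c| + `|E|) => N N0.
have := hE _ _ (flr_nat R N0); under eq_bigr do rewrite mul1r.
have [s1 _] := sqrt_facts (ler1n' R N0).
have : E / Num.sqrt N%:R <= `|E|.
  by rewrite ler_pdivrMr; [apply: le_trans (ler_norm _) _; rewrite ler_peMr | lra].
have := ler_norm c; rewrite -/(lnn N) ler_norml => ? ? /andP[? ?]; lra.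
Qed.

(** A change of sign would need a jump larger than b1 + b2 >= 1. *)
Lemma sgr_stable (x y b1 b2 : R) : 0 <= b1 -> 0 <= b2 -> 1 <= b1 + b2 ->
  b1 < `|x| -> b2 < `|y| -> `|y - x| <= 1 -> Num.sg y = Num.sg x.
Proof.
move=> b10 b20 b12 bx by_; rewrite ler_norml => /andP[c1 c2]; move: bx by_.
case: (ltrgt0P x) => hx; case: (ltrgt0P y) => hy; rewrite ?(gtr0_sg hx) ?(gtr0_sg hy) ?(ltr0_sg hx) ?(ltr0_sg hy) //; lra.
Qed.

(** The weight 1/k - 1/(k + 1) is what summation by parts against 1/k produces; on f k = k the
    average grows like ln j. *)
Definition logavg (f : nat -> R) j : R := \sum_(1 <= k < j.+1) f k / (k%:R * k.+1%:R).

Lemma inv_diffE k : (0 < k)%N -> k%:R^-1 - k.+1%:R^-1 = (k%:R * k.+1%:R)^-1 :> R.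
Proof.
move=> k0; have k1 := ltr0n' R k0; have k2 : 0 < k%:R + 1 :> R by lra.
by rewrite -[k.+1%:R]natr1; field; rewrite !gt_eqF.
Qed.

(** Writing f (N/n) as a sum of increments D k over k <= N/n and exchanging the sums leaves inner
    sums of ln n, known by Stirling's formula; summation by parts returns from the increments to f.
    The Lipschitz bound keeps the errors at O(N (1 + ln N)). *)
Lemma sum_ln_floor_le (f : nat -> R) : (forall n, 0 <= f n) -> (forall n, `|f n.+1 - f n| <= 1) ->
  f 0%N = 0 -> exists E : R, 0 <= E /\ forall N, (0 < N)%N ->
  \sum_(1 <= n < N.+1) lnn n * f (N %/ n)%N <=
  N%:R * (\sum_(1 <= j < N) logavg f j / j%:R) + E * N%:R * (1 + lnn N).
Proof.
move=> f_ge0 lip f0; have [E [E0 hE]] := sum_lnn_floor.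
exists (2 * E + 2); split => [|N N0]; first lra.
have f_le n : f n <= n%:R.
  elim: n => [|n IH]; first by rewrite f0.
  by have := lip n; rewrite ler_norml -natr1 => /andP[_ ?]; lra.
pose D k := f k - f k.-1.
have fD j : f j = \sum_(1 <= k < j.+1) D k.
  by rewrite big_add1 /= /D telescope_sumr // f0 subr0.
have D1 k : (0 < k)%N -> `|D k| <= 1 by case: k => // k _; exact: lip.
have N0' := ltr0n' R N0; have lN := lnn_ge0 R N.
have -> : \sum_(1 <= n < N.+1) lnn n * f (N %/ n)%N =
   \sum_(1 <= k < N.+1) D k * \sum_(1 <= n < (N %/ k).+1) lnn n.
  under eq_bigr do rewrite fD mulr_sumr.
  rewrite sum_floor_swap; apply: eq_bigr => k _; rewrite mulr_sumr.
  by apply: eq_bigr => n _; rewrite mulrC.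
have e1 := sum_approx D (hE N).
have e1' : \sum_(1 <= d < N.+1) `|D d| * (E * Num.sqrt (N%:R / d%:R)) <= 2 * E * N%:R.
  apply: le_trans (_ : \sum_(1 <= d < N.+1) E * Num.sqrt (N%:R / d%:R) <= _).
    by apply: ler_sum_nat => d /andP[d0 _]; rewrite ler_piMl ?mulr_ge0 ?sqrtr_ge0 // D1.
  by rewrite -mulr_sumr -mulrA mulrCA ler_wpM2l // sum_sqrt_ratio.
pose g k : R := (lnn N - lnn k) / k%:R.
have e2 : \sum_(1 <= d < N.+1) D d * (N%:R / d%:R * (lnn N - lnn d) - N%:R / d%:R) =
   N%:R * (\sum_(1 <= d < N.+1) D d * g d) - N%:R * \sum_(1 <= d < N.+1) D d / d%:R.
  by rewrite !mulr_sumr -sumrB; apply: eq_bigr => d _; rewrite /g; ring.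
have e3 : `|\sum_(1 <= d < N.+1) D d / d%:R| <= 1 + lnn N.
  apply: le_trans (sum_inv R N0); apply: ler_norm_sum_nat => d /andP[d0 _].
  by rewrite normrM (ger0_norm (x := _^-1)) ?invr_ge0 // ler_piMl ?invr_ge0 // D1.
pose q k := f k / (k%:R * k.+1%:R).
have q0 k : 0 <= q k by rewrite divr_ge0 // mulr_ge0.
have e4 : \sum_(1 <= d < N.+1) D d * g d <= \sum_(1 <= k < N) q k * (lnn N - lnn k) + \sum_(1 <= k < N) q k.
  rewrite abel {1}/g subrr mul0r mulr0 add0r -big_split /=.
  apply: ler_sum_nat => k /andP[k0 kN]; rewrite -fD /q -mulrA -[f k / _]mulr1 -mulrA -mulrDr -mulrDr.
  rewrite ler_wpM2l //.
  have -> : g k - g k.+1 = (k%:R^-1 - k.+1%:R^-1) * (lnn N - lnn k) + (lnn k.+1 - lnn k) / k.+1%:R.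
    by rewrite /g; ring.
  rewrite inv_diffE // mulrDr mulr1 lerD2l.
  have /andP[_ l] := lnnS R k0.
  by rewrite invfM ler_wpM2r ?invr_ge0.
have e5 : \sum_(1 <= k < N) q k <= 1 + lnn N.
  apply: le_trans (sum_inv R N0).
  rewrite big_nat_recl // -[X in X <= _]add0r; apply: lerD; first by rewrite invr_ge0.
  case: (N) N0 => [//|n] _; rewrite [X in X <= _]big_add1 /= [X in _ <= X]big_add1 /=.
  rewrite !big_mkord; apply: ler_sum => k _; rewrite /q ler_pdivrMr ?mulr_gt0 ?ltr0n //.
  by rewrite mulrCA mulVf ?mulr1 ?f_le // pnatr_eq0.
(* Summation by parts once more: the partial sums of q are [logavg f], and ln (k + 1) - ln k <=
   1/k. *)
have e6 : \sum_(1 <= k < N) q k * (lnn N - lnn k) <= \sum_(1 <= j < N) logavg f j / j%:R.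
  have -> : \sum_(1 <= k < N) q k * (lnn N - lnn k) = \sum_(1 <= k < N.+1) q k * (lnn N - lnn k).
    by rewrite [RHS]big_nat_recr //= subrr mulr0 addr0.
  rewrite abel subrr mulr0 add0r; apply: ler_sum_nat => k /andP[k0 _].
  have -> : \sum_(1 <= m < k.+1) q m = logavg f k by [].
  apply: ler_wpM2l; first by apply: sumr_ge0 => i _; exact: q0.
  by have /andP[_ l] := lnnS R k0; apply: le_trans l; lra.
have e7 : N%:R * (\sum_(1 <= d < N.+1) D d * g d) <=
   N%:R * (\sum_(1 <= j < N) logavg f j / j%:R + (1 + lnn N)).
  by rewrite ler_wpM2l //; lra.
have e8 : `|N%:R * \sum_(1 <= d < N.+1) D d / d%:R| <= N%:R * (1 + lnn N).
  by rewrite normrM (gtr0_norm N0') ler_wpM2l // ltW.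
have e9 : 0 <= E * N%:R * lnn N by rewrite !mulr_ge0 // ltW.
move: e1 e8; rewrite e2 !ler_norml => /andP[_ ?] /andP[? ?]; lra.
Qed.

(** * Contraction of the logarithmic average of |M| *)

Section Contraction.
Variables (B be : R).
Hypotheses (be_gt0 : 0 < be) (be_le1 : be <= 1) (B_ge0 : 0 <= B).

Section OneFunction.
Variables (M : nat -> R) (al C : R).
Hypothesis lip : forall n, `|M n.+1 - M n| <= 1.
Hypothesis bound : forall n, `|M n| <= al * n%:R + C.
Hypothesis avg : forall j, `|\sum_(1 <= k < j) M k / (k%:R * k.+1%:R)| <= B.
Hypothesis be_al : be <= al.
Hypothesis C_ge0 : 0 <= C.
Variables (lam u0 : nat).
Hypothesis lam_large : 2 * B < be / 2 * ln (lam%:R / 2).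
Hypothesis lam_gt1 : (1 < lam)%N.
Hypothesis u0_large : 1 <= be * u0%:R.
Hypothesis u0_large' : (8 <= u0)%N.

Lemma sum_inv_ge u v : (0 < u)%N -> (u <= v)%N ->
  lnn v.+1 - lnn u.+1 <= \sum_(u <= k < v) k.+1%:R^-1 :> R.
Proof.
move=> u0'; elim: v => [|v IH] uv; first by rewrite leqn0 in uv; rewrite (eqP uv) in u0'.
move: uv; rewrite leq_eqVlt => /orP[/eqP <-|]; first by rewrite subrr big_geq.
rewrite ltnS => uv; rewrite big_nat_recr //=.
have /andP[_ l] := @lnnS R v.+1 isT.
have -> : lnn v.+2 - lnn u.+1 = (lnn v.+1 - lnn u.+1) + (lnn v.+2 - lnn v.+1) :> R by ring.
exact: lerD (IH uv) l.
Qed.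

(** Were |M k| > be/2 k on the whole window, M could not change sign there, and the window sum of M
    k / (k (k + 1)) would have modulus at least be/2 ln (lam/2) > 2 B, against [avg]. *)
Let small_value u : (u0 <= u)%N -> exists k0, (u <= k0 < lam * u)%N /\ `|M k0| <= be / 2 * k0%:R.
Proof.
move=> uu; apply: contrapT => H.
have big k : (u <= k < lam * u)%N -> be / 2 * k%:R < `|M k|.
  by move=> uk; rewrite ltNge; apply/negP => h; apply: H; exists k.
have u_gt0 : (0 < u)%N by apply: leq_trans uu; apply: leq_trans u0_large'.
have bu k : (u <= k)%N -> 1 <= be * k%:R.
  move=> uk; apply: le_trans u0_large _; rewrite ler_wpM2l ?(ltW be_gt0) //.
  by rewrite ler_nat (leq_trans uu).
have ulu : (u < lam * u)%N by rewrite -[X in (X < _)%N]mul1n ltn_pmul2r.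
have sgn k : (u <= k < lam * u)%N -> Num.sg (M k) = Num.sg (M u).
  elim: k => [|k IH] /andP[uk kl]; first by rewrite leqn0 in uk; rewrite (eqP uk).
  move: uk; rewrite leq_eqVlt => /orP[/eqP <- //|]; rewrite ltnS => uk.
  have kl' := ltnW kl; rewrite -IH ?uk //.
  have := big k; have := big k.+1; rewrite uk kl' kl (leqW uk) => /(_ isT) b1 /(_ isT) b2.
  apply: (sgr_stable _ _ _ b2 b1 (lip k)); rewrite ?mulr_ge0 ?divr_ge0 ?(ltW be_gt0) //.
  by have := bu k uk; have := be_gt0; rewrite -[k.+1%:R]natr1; lra.
have key : `|\sum_(u <= k < lam * u) M k / (k%:R * k.+1%:R)| <= 2 * B.
  have -> : \sum_(u <= k < lam * u) M k / (k%:R * k.+1%:R) =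
    \sum_(1 <= k < lam * u) M k / (k%:R * k.+1%:R) - \sum_(1 <= k < u) M k / (k%:R * k.+1%:R).
    by rewrite [X in _ = X - _](@big_cat_nat _ _ _ u) ?(ltnW ulu) //= addrAC subrr add0r.
  by apply: le_trans (ler_normB _ _) _; have := avg (lam * u); have := avg u; lra.
have e1 : `|\sum_(u <= k < lam * u) M k / (k%:R * k.+1%:R)| = \sum_(u <= k < lam * u) `|M k| / (k%:R * k.+1%:R).
  have sM : `|Num.sg (M u)| = 1.
    rewrite normr_sg; have := big u; rewrite leqnn ulu => /(_ isT) h.
    have -> : M u != 0; last by [].
    by rewrite -normr_gt0; apply: le_lt_trans h; rewrite mulr_ge0 // divr_ge0 // ltW.
  have -> : \sum_(u <= k < lam * u) M k / (k%:R * k.+1%:R) =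
     Num.sg (M u) * \sum_(u <= k < lam * u) `|M k| / (k%:R * k.+1%:R).
    rewrite mulr_sumr; apply: eq_big_nat => k uk.
    by rewrite mulrA -(sgn k uk) -numEsg.
  by rewrite normrM sM mul1r ger0_norm // sumr_ge0 // => k _; rewrite divr_ge0 // mulr_ge0.
have e2 : be / 2 * \sum_(u <= k < lam * u) k.+1%:R^-1 <= \sum_(u <= k < lam * u) `|M k| / (k%:R * k.+1%:R).
  rewrite mulr_sumr; apply: ler_sum_nat => k uk.
  have k0 : 0 < k%:R :> R by rewrite ltr0n; case/andP: uk => h _; apply: leq_trans h.
  rewrite invfM mulrA ler_wpM2r ?invr_ge0 // ler_pdivlMr //.
  exact/ltW/big.
have e3 : ln (lam%:R / 2) <= \sum_(u <= k < lam * u) k.+1%:R^-1 :> R.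
  apply: le_trans (sum_inv_ge u_gt0 (ltnW ulu)).
  rewrite -ln_div ?posrE ?ltr0n // ler_ln ?posrE ?divr_gt0 ?ltr0n ?(ltnW lam_gt1) //.
  rewrite ler_pdivlMr ?ltr0n // mulrAC ler_pdivrMr // -!natrM ler_nat.
  by have := leq_pmulr lam u_gt0; rewrite mulnS; clear; lia.
have := ler_wpM2l (_ : 0 <= be / 2) e3; rewrite divr_ge0 ?(ltW be_gt0) // => /(_ isT).
move: key; rewrite e1; have := lam_large; lra.
Qed.

(* Slack between |M| and its bound; it gains a fixed amount on every window. *)
Definition deficit j : R := \sum_(1 <= k < j) ((al * k%:R + C) - `|M k|) / (k%:R * k.+1%:R).

Let term_ge0 k : 0 <= ((al * k%:R + C) - `|M k|) / (k%:R * k.+1%:R).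
Proof. by rewrite divr_ge0 ?mulr_ge0 // subr_ge0. Qed.

Lemma deficit_mono i j : (i <= j)%N -> deficit i <= deficit j.
Proof.
move=> ij; case: (leqP 1 i) => i1; last first.
  by rewrite {1}/deficit big_geq ?sumr_ge0 // ltnW.
by rewrite [deficit j](@big_cat_nat _ _ _ i) //= lerDl sumr_ge0.
Qed.

(** At k0 from [small_value], |M| <= be/2 k0. As M moves by at most 1 per step, |M k| <= 5 be/8 k
    over the next be k0/8 integers, so the slack against al k >= be k is at least 3 be/8 k. With k +
    1 <= 3 k0 each term is at least be/(8 k0), in total be^2/64. *)
Let window u : (u0 <= u)%N -> deficit u + be ^+ 2 / 64 <= deficit (2 * lam * u).
Proof.
move=> uu; have [k0 [/andP[uk kl] mk]] := small_value uu.
have b1 := be_le1; have b0 := be_gt0.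
have u_gt0 : (0 < u)%N by apply: leq_trans uu; apply: leq_trans u0_large'.
have k0_8 : (8 <= k0)%N by apply: leq_trans uk; apply: leq_trans uu.
have k0_gt0 : 0 < k0%:R :> R by rewrite ltr0n (leq_trans _ k0_8).
have bk_ge0 : 0 <= be / 8 * k0%:R by rewrite mulr_ge0 ?ltW // divr_gt0.
pose m := Num.truncn (be / 8 * k0%:R).
have /andP[m1 m2] := truncn_itv bk_ge0; rewrite -/m in m1 m2.
have mk0 : (m <= k0)%N.
  by rewrite -(ler_nat R); apply: le_trans m1 _; rewrite ler_piMl ?(ltW k0_gt0) //; lra.
pose k1 := (k0 + m)%N.
have k1l : (k1.+1 <= 2 * lam * u)%N by rewrite /k1 -mulnA; move: mk0 kl; clear; lia.
have split : deficit (2 * lam * u) =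
   deficit k0 + \sum_(k0 <= k < k1.+1) ((al * k%:R + C) - `|M k|) / (k%:R * k.+1%:R) +
   \sum_(k1.+1 <= k < 2 * lam * u) ((al * k%:R + C) - `|M k|) / (k%:R * k.+1%:R).
  have k01 : (k0 <= k1.+1)%N by rewrite /k1 leqW ?leq_addr.
  rewrite /deficit (@big_cat_nat _ _ _ k1.+1 1 (2 * lam * u)) //= (@big_cat_nat _ _ _ k0 1 k1.+1) //=.
  by apply: leq_trans k0_8.
rewrite split.
have := deficit_mono uk.
have : 0 <= \sum_(k1.+1 <= k < 2 * lam * u) ((al * k%:R + C) - `|M k|) / (k%:R * k.+1%:R).
  by apply: sumr_ge0.
suff : be ^+ 2 / 64 <= \sum_(k0 <= k < k1.+1) ((al * k%:R + C) - `|M k|) / (k%:R * k.+1%:R) by lra.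
have lipk i : `|M (k0 + i)%N| <= be / 2 * k0%:R + i%:R.
  elim: i => [|i IH]; first by rewrite addn0 addr0.
  rewrite addnS -[i.+1%:R]natr1 -(subrK (M (k0 + i)%N) (M _.+1)) addrC.
  by apply: le_trans (ler_normD _ _) _; have := lip (k0 + i)%N; lra.
apply: le_trans (_ : \sum_(k0 <= k < k1.+1) (3 * be / 8) / (3 * k0%:R) <= _).
  rewrite sumr_const_nat /k1 -addnS addKn -(mulr_natl _ m.+1) -[m.+1%:R]natr1.
  have -> : (m%:R + 1) * (3 * be / 8 / (3 * k0%:R)) = (be / 8) * (m%:R + 1) / k0%:R.
    by field; rewrite gt_eqF.
  rewrite ler_pdivlMr //; rewrite -[m.+1%:R]natr1 in m2.
  have b8 : 0 <= be / 8 by rewrite divr_ge0 // ltW.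
  by have := ler_wpM2l b8 (ltW m2); rewrite expr2; lra.
apply: ler_sum_nat => k /andP[kk kk1].
have k_gt0 : 0 < k%:R :> R by rewrite ltr0n; apply: leq_trans kk; apply: leq_trans k0_8.
have [i ki] : exists i, k = (k0 + i)%N by exists (k - k0)%N; rewrite subnKC.
have im : i%:R <= m%:R :> R by rewrite ler_nat; move: kk1; rewrite ki /k1; clear; lia.
have hM : `|M k| <= 5 * be / 8 * k%:R.
  have bi : 0 <= be * i%:R by rewrite mulr_ge0 // ltW.
  by rewrite ki natrD; apply: le_trans (lipk i) _; lra.
apply: le_trans (_ : (3 * be / 8) * k%:R / (k%:R * k.+1%:R) <= _).
  have -> : 3 * be / 8 * k%:R / (k%:R * k.+1%:R) = 3 * be / 8 / k.+1%:R.
    have := @ltr0n' R k.+1 isT; set y := k.+1%:R => y0; set z := k%:R in k_gt0 *.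
    by field; rewrite !gt_eqF.
  rewrite ler_wpM2l ?divr_ge0 ?mulr_ge0 ?(ltW be_gt0) //.
  have hk : k.+1%:R <= (3 * k0)%:R :> R.
    by rewrite ler_nat; move: kk1 mk0 k0_8; rewrite /k1; clear; lia.
  rewrite natrM in hk.
  by rewrite lef_pV2 // posrE ?ltr0n // mulr_gt0.
rewrite ler_wpM2r ?invr_ge0 ?mulr_ge0 //.
have : be * k%:R <= al * k%:R by rewrite ler_wpM2r.
have C0 := C_ge0; lra.
Qed.

(** The windows from La^i u0 to La^(i+1) u0, La = 2 lam, are disjoint; about ln (j / u0) / ln La of
    them fit below j. *)
Lemma deficit_ge j : (0 < j)%N ->
  be ^+ 2 / 64 / lnn (2 * lam) * (lnn j - lnn u0 - lnn (2 * lam)) <= deficit j.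
Proof.
move=> j0; pose La := (2 * lam)%N.
have La1 : (1 < La)%N by rewrite /La; lia.
have lL : 0 < lnn La :> R by rewrite /lnn ln_gt0 // ltr1n.
have e0 : 0 < be ^+ 2 / 64 by rewrite divr_gt0 // exprn_gt0.
have u_gt0 : (0 < u0)%N by apply: leq_trans u0_large'.
have def0 i : 0 <= deficit i by apply: sumr_ge0.
have iter m : be ^+ 2 / 64 * m%:R <= deficit (La ^ m * u0).
  elim: m => [|m IH]; first by rewrite mulr0.
  rewrite expnS -mulnA -[m.+1%:R]natr1 mulrDr mulr1; apply: le_trans (window _); first by rewrite lerD2r.
  by rewrite leq_pmull // expn_gt0 (ltnW La1).
case: (leqP u0 j) => ju; last first.
  apply: le_trans (def0 _); rewrite mulr_ge0_le0 //; first by rewrite divr_ge0 // ltW.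
  have : lnn j <= lnn u0 :> R by apply: ler_lnn => //; exact: ltnW.
  rewrite -/La; lra.
have ju0 : (0 < j %/ u0)%N by rewrite divn_gt0.
have /andP[t1 t2] := trunc_log_bounds La1 ju0; set m := trunc_log La (j %/ u0) in t1 t2.
apply: le_trans (_ : be ^+ 2 / 64 * m%:R <= _); last first.
  by apply: le_trans (iter m) (deficit_mono _); rewrite -leq_divRL.
rewrite -/La; set E := be ^+ 2 / 64 in e0 iter *.
rewrite -mulrA ler_wpM2l ?(ltW e0) // mulrC ler_pdivrMr //.
have : lnn j <= lnn (La ^ m.+1 * u0) :> R.
  by apply: ler_lnn => //; apply: ltnW; rewrite -ltn_divLR.
rewrite lnnM ?expn_gt0 ?(ltnW La1) //.
have -> : lnn (La ^ m.+1) = m.+1%:R * lnn La :> R.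
  by rewrite /lnn natrX lnXn ?ltr0n ?(ltnW La1) // mulr_natl.
rewrite -natr1; lra.
Qed.

End OneFunction.

(* The gain ka depends on be and B only, not on the bound al (as long as al >= be). *)
Lemma logavg_contraction : exists ka : R, 0 < ka /\ ka <= be / 2 /\
  forall M al C, (forall n, `|M n.+1 - M n| <= 1) -> (forall n, `|M n| <= al * n%:R + C) ->
  (forall j, `|\sum_(1 <= k < j) M k / (k%:R * k.+1%:R)| <= B) -> be <= al -> 0 <= C ->
  exists E : R, 0 <= E /\ forall j, (0 < j)%N ->
    logavg (fun k => `|M k|) j <= (al - ka) * lnn j + E.
Proof.
(* Makes be/2 ln (lam/2) exceed 2 B, so that a window of ratio lam is too long for M to stay large
   throughout. *)
have [lam0 hlam0] : exists n : nat, 2 * expR (4 * B / be + 1) < n%:R.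
  by exists (Num.bound (2 * expR (4 * B / be + 1))); apply: archi_boundP; rewrite mulr_ge0 // expR_ge0.
pose lam := lam0.+2.
have lamE : expR (4 * B / be + 1) < lam%:R / 2.
  rewrite ltr_pdivlMr // mulrC; apply: lt_trans hlam0 _; rewrite ltr_nat; lia.
have lam_large : 2 * B < be / 2 * ln (lam%:R / 2).
  have h : 4 * B / be + 1 < ln (lam%:R / 2).
    rewrite -ltr_expR lnK // posrE; exact: lt_trans (expR_gt0 _) lamE.
  have := ltr_pM2l (_ : 0 < be / 2) (4 * B / be + 1) (ln (lam%:R / 2)).
  rewrite divr_gt0 // => /(_ isT); rewrite h => h2; apply: lt_trans h2.
  have -> : be / 2 * (4 * B / be + 1) = 2 * B + be / 2 by field; rewrite gt_eqF.
  by rewrite ltrDl divr_gt0.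
have [w hw] : exists n : nat, be^-1 < n%:R.
  by exists (Num.bound be^-1); apply: archi_boundP; rewrite invr_ge0 ltW.
pose u0 := (w + 8)%N.
have u0l : 1 <= be * u0%:R.
  rewrite -ler_pdivrMl // mulr1; apply: le_trans (ltW hw) _; rewrite ler_nat leq_addr //.
have lL : 0 < lnn (2 * lam) :> R by rewrite /lnn ln_gt0 // ltr1n /lam; lia.
pose ka0 := be ^+ 2 / 64 / lnn (2 * lam).
have ka0_gt0 : 0 < ka0 by rewrite divr_gt0 // divr_gt0 // exprn_gt0.
(* The cap be/2 keeps al - ka nonnegative for every al >= be. *)
exists (Num.min ka0 (be / 2)); split; first by rewrite lt_min ka0_gt0 divr_gt0.
split; first by rewrite ge_min lexx orbT.
move=> M al C lip bound avg be_al C0.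
exists (al + C + ka0 * (lnn u0 + lnn (2 * lam))); split.
  have al0 : 0 <= al by apply: le_trans be_al; rewrite ltW.
  have l0 : 0 <= lnn u0 + lnn (2 * lam) :> R by rewrite addr_ge0 ?lnn_ge0.
  by have := mulr_ge0 (ltW ka0_gt0) l0; lra.
move=> j j0.
have al0 : 0 <= al by apply: le_trans be_al; rewrite ltW.
have d := @deficit_ge M al C lip bound avg be_al C0 lam u0 lam_large isT u0l (leq_addl _ _) j.+1 isT.
have lj : lnn j <= lnn j.+1 :> R by apply: ler_lnn.
have lj' : lnn j.+1 <= lnn j + 1 :> R.
  have /andP[_ l] := lnnS R j0; have : j%:R^-1 <= 1 :> R by rewrite invf_le1 ?ltr0n // ler1n.
  lra.
have e1 : logavg (fun k => `|M k|) j = \sum_(1 <= k < j.+1) (al * k%:R + C) / (k%:R * k.+1%:R) - deficit M al C j.+1.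
  by rewrite /deficit -sumrB; apply: eq_bigr => k _; rewrite -mulrBl; congr (_ / _); ring.
have e2 : \sum_(1 <= k < j.+1) (al * k%:R + C) / (k%:R * k.+1%:R) <= al * lnn j.+1 + C.
  have -> : \sum_(1 <= k < j.+1) (al * k%:R + C) / (k%:R * k.+1%:R) =
    al * \sum_(1 <= k < j.+1) k.+1%:R^-1 + C * \sum_(1 <= k < j.+1) (k%:R^-1 - k.+1%:R^-1).
    rewrite !mulr_sumr -big_split; apply: eq_big_nat => k /andP[k0 _] /=.
    have := ltr0n' R k0; have := @ltr0n' R k.+1 isT; rewrite inv_diffE //.
    by set x := k%:R; set y := k.+1%:R => y0 x0; field; rewrite !gt_eqF.
  apply: lerD.
    rewrite ler_wpM2l //; apply: le_trans (_ : \sum_(1 <= k < j.+1) (lnn k.+1 - lnn k) <= _).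
      by apply: ler_sum_nat => k /andP[k0 _]; have /andP[] := lnnS R k0.
    by rewrite (telescope_sumr (lnn (R := R))) // lnn1 subr0.
  rewrite ler_piMr // -[X in X <= _]opprK -sumrN; under eq_bigr do rewrite opprB.
  by rewrite (telescope_sumr (fun k => k%:R^-1)) // opprB invr1 gerBl invr_ge0.
have mm : Num.min ka0 (be / 2) <= ka0 by rewrite ge_min lexx.
have e3 : Num.min ka0 (be / 2) * lnn j <= ka0 * lnn j by rewrite ler_wpM2r // lnn_ge0.
have e4 : ka0 * lnn j <= ka0 * lnn j.+1 by rewrite ler_wpM2l // ltW.
have e5 : al * lnn j.+1 <= al * (lnn j + 1) by rewrite ler_wpM2l.
move: d; rewrite -/ka0 e1; lra.
Qed.

End Contraction.
End LogAverage.

(** * Primes and almost primes *)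

Section Chebyshev.
Variable R : realType.
Implicit Types (N n d k : nat).

Definition psi N : R := \sum_(1 <= n < N.+1) mangoldt n.

Lemma sum_mangoldt_floor N :
  \sum_(1 <= n < N.+1) mangoldt n * (N %/ n)%:R = \sum_(1 <= n < N.+1) lnn n :> R.
Proof.
rewrite -(mangoldt_one R) sum_dsum; apply: eq_bigr => d _.
rewrite -mulr_sumr; congr (_ * _); rewrite -[LHS]mul1r mulr_natr.
rewrite -[X in _ *+ X](subn1 _.+1) -sumr_const_nat; apply: eq_big_nat => k /andP[k0 _].
by rewrite /done_fun k0.
Qed.

Lemma sum_lnn_le N : \sum_(1 <= n < N.+1) lnn n <= N%:R * lnn N :> R.
Proof.
rewrite mulr_natl -[X in _ *+ X](subn1 N.+1) -sumr_const_nat.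
by apply: ler_sum_nat => n /andP[n0 nN]; apply: ler_lnn.
Qed.

Lemma sum_lnn_ge N : N%:R * lnn N - N%:R <= \sum_(1 <= n < N.+1) lnn n :> R.
Proof.
have := sum_ln_ratio R N; rewrite sumrB sumr_const_nat subn1 /= -[lnn N *+ _]mulr_natl; lra.
Qed.

Lemma lnn3 : lnn 3 <= 3 :> R.
Proof. by have := @ln_sublinear R 3; rewrite ltr0n => /(_ isT) /ltW. Qed.

(** Chebyshev's argument: in ln N! - 2 ln (N/2)! the multiplicity of Lambda n is floor (N/n) - 2
    floor ((N/2)/n), which is nonnegative, and at least 1 for N/2 < n <= N. *)
Lemma psi_half N : psi N - psi (N %/ 2) <= 6 * N%:R.
Proof.
have [N0|N0] := posnP (N %/ 2).
  rewrite N0 {2}/psi big_geq // subr0.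
  have : (N < 2)%N by lia.
  case: N {N0} => [|[|//]] _; rewrite /psi; first by rewrite big_geq // mulr0.
  by rewrite big_nat1 /mangoldt /= mulr1.
set j := (N %/ 2)%N in N0 *.
have jN : (j <= N)%N by rewrite leq_div.
have step : psi N - psi j <= \sum_(1 <= n < N.+1) lnn n - 2 * \sum_(1 <= n < j.+1) lnn n.
  rewrite -!sum_mangoldt_floor {1}/psi (@big_cat_nat _ _ _ j.+1) //=.
  rewrite [X in _ <= X - _](@big_cat_nat _ _ _ j.+1) //=.
  have h1 : \sum_(j.+1 <= n < N.+1) mangoldt n <= \sum_(j.+1 <= n < N.+1) mangoldt n * (N %/ n)%:R :> R.
    apply: ler_sum_nat => n /andP[jn nN]; rewrite ler_peMr ?mangoldt_ge0 // ler1n divn_gt0 //; lia.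
  have h2 : 0 <= \sum_(1 <= n < j.+1) mangoldt n * (N %/ n)%:R -
     2 * \sum_(1 <= n < j.+1) mangoldt n * (j %/ n)%:R :> R.
    rewrite mulr_sumr -sumrB; apply: sumr_ge0 => n _.
    rewrite mulrCA -mulrBr mulr_ge0 ?mangoldt_ge0 // subr_ge0 -natrM ler_nat.
    case: n => [|n]; first by rewrite !divn0.
    rewrite leq_divRL // -mulnA; have := leq_trunc_div j n.+1; have := leq_trunc_div N 2.
    rewrite -/j; lia.
  rewrite /psi; lra.
apply: le_trans step _.
have := sum_lnn_le N; have := sum_lnn_ge j.
have l1 : lnn N <= lnn 3 + lnn j :> R.
  by rewrite -lnnM //; apply: ler_lnn; rewrite /j in N0 *; lia.
have l2 := lnn3; have l3 : lnn j <= j%:R :> R by exact/ltW/ln_sublinear/ltr0n'.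
have l4 := lnn_ge0 R j.
have e1 : N%:R = 2 * j%:R + (N %% 2)%:R :> R.
  by rewrite {1}(divn_eq N 2) natrD natrM -/j mulrC.
have e2 : (N %% 2)%:R <= 1 :> R by rewrite lern1; have := ltn_pmod N (isT : 0 < 2)%N; lia.
have e3 : 0 <= (N %% 2)%:R :> R by [].
have e4 : 0 <= j%:R :> R by [].
move: e1 e2 e3 e4 l1 l2 l3 l4; set n := N%:R; set e := (_ %% _)%:R; set J := j%:R.
move=> -> ? ? ? ? ? ? ? ? ?.
have : (2 * J + e) * lnn N <= (2 * J + e) * (3 + lnn j) by apply: ler_wpM2l; lra.
nra.
Qed.

Lemma chebyshev_psi N : psi N <= 12 * N%:R.
Proof.
elim/ltn_ind: N => -[|N] IH; first by rewrite /psi big_geq // mulr0.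
have := psi_half N.+1; have := IH (N.+1 %/ 2)%N (@ltn_Pdiv N.+1 2 isT isT).
have : (N.+1 %/ 2)%:R * 2 <= N.+1%:R :> R by rewrite -natrM ler_nat leq_trunc_div.
lra.
Qed.

End Chebyshev.

(** * Prime counting bounds of Chebyshev and Mertens type *)

Section Primes.
Variable R : realType.
Implicit Types (n k p r N : nat) (eps : R).

Definition ip n : R := (prime n)%:R.
Definition ppi N : R := \sum_(1 <= n < N.+1) ip n.
Definition theta N : R := \sum_(1 <= n < N.+1) ip n * lnn n.

Lemma ppi_ge0 N : 0 <= ppi N. Proof. exact: sumr_ge0. Qed.

Lemma ppi_le N : ppi N <= N%:R.
Proof.
apply: le_trans (_ : \sum_(1 <= n < N.+1) 1 <= _); last by rewrite sumr_const_nat subn1.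
by apply: ler_sum_nat => n _; rewrite lern1 leq_b1.
Qed.

Lemma ppi_mono m n : (m <= n)%N -> ppi m <= ppi n.
Proof. by move=> mn; rewrite [ppi n](@big_cat_nat _ _ _ m.+1) //= lerDl sumr_ge0. Qed.

Lemma sum_leq_nat (s N : nat) : \sum_(1 <= r < N.+1) ((r <= s)%N)%:R = (minn N s)%:R :> R.
Proof.
elim: N => [|N IH]; first by rewrite big_geq // min0n.
rewrite big_nat_recr //= IH -natrD; congr (_%:R).
by case: (leqP N.+1 s) => h; lia.
Qed.

Lemma count_squares N : \sum_(1 <= r < N.+1) ((r ^ 2 <= N)%N)%:R <= Num.sqrt N%:R :> R.
Proof.
have /andP[t1 t2] := truncn_itv (sqrtr_ge0 (N%:R : R)).
set s := Num.truncn _ in t1 t2; apply: le_trans t1.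
apply: le_trans (_ : \sum_(1 <= r < N.+1) ((r <= s)%N)%:R <= _); last first.
  by rewrite sum_leq_nat ler_nat geq_minr.
apply: ler_sum_nat => r _; case: (leqP (r ^ 2) N) => [h|_]; last exact: ler0n.
suff -> : (r <= s)%N by [].
rewrite -ltnS -(ltr_nat R); apply: le_lt_trans t2.
rewrite -(ger0_norm (ler0n R r)) -sqrtr_sqr ler_sqrt ?ler0n //.
by rewrite -natrX ler_nat.
Qed.

Lemma primes_sing n p : primes n = [:: p] -> prime p /\ n = (p ^ logn p n)%N.
Proof.
move=> E; have pin : p \in primes n by rewrite E inE.
move: (pin); rewrite mem_primes => /and3P[pp n0 _]; split => //.
have [m cm nE] := pfactor_coprime pp n0.
suff m1 : m = 1%N by rewrite {1}nE m1 mul1n.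
apply/eqP; rewrite -[_ == _]negbK; apply/negP => m1.
have m0 : (0 < m)%N by move: n0; rewrite nE muln_gt0 => /andP[].
have m2 : (1 < m)%N by rewrite ltn_neqAle eq_sym m1.
have : pdiv m \in primes n.
  by rewrite mem_primes pdiv_prime // n0 nE dvdn_mulr // pdiv_dvd.
rewrite E inE => /eqP pm; move: cm; rewrite prime_coprime // -pm pdiv_dvd //.
Qed.

(** A proper prime power p^k is r^2 or r^2 p with r = p^(k/2) rounded down in the exponent and p =
    [pdiv r], so those up to N are counted by the squares up to N. *)
Lemma mangoldt_nonprime n N : (0 < n <= N)%N -> mangoldt n - ip n * lnn n <=
  lnn N * \sum_(1 <= r < N.+1) ((n == r ^ 2)%N%:R + (n == r ^ 2 * pdiv r)%N%:R).
Proof.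
move=> /andP[n0 nN]; have lN := lnn_ge0 R N.
have s0 : 0 <= \sum_(1 <= r < N.+1) ((n == r ^ 2)%N%:R + (n == r ^ 2 * pdiv r)%N%:R) :> R.
  by apply: sumr_ge0 => r _; rewrite addr_ge0.
have l0 : 0 <= ip n * lnn n by rewrite mulr_ge0 ?lnn_ge0.
rewrite /mangoldt; case E : (primes n) => [|p [|]].
- by apply: le_trans (_ : 0 <= _); [lra | rewrite mulr_ge0].
- have [pp nE] := primes_sing E; set k := logn p n in nE.
  have k0 : (0 < k)%N.
    by rewrite logn_gt0 E inE.
  case: (leqP k 1) => k1.
    have k1' : k = 1%N by lia.
    rewrite nE k1' expn1 /ip pp mul1r subrr mulr_ge0 //.
    by apply: sumr_ge0 => r _; rewrite addr_ge0.
  pose r := (p ^ k./2)%N; have h0 : (0 < k./2)%N by rewrite half_gt0.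
  have r1 : (1 < r)%N by rewrite -(exp1n k./2) ltn_exp2r // prime_gt1.
  have rN : (r < N.+1)%N.
    rewrite ltnS; apply: leq_trans nN; rewrite nE leq_exp2l ?prime_gt1 //.
    by rewrite -{2}(odd_double_half k) -addnn; lia.
  have nr : n = (r ^ 2)%N \/ n = (r ^ 2 * pdiv r)%N.
    have -> : pdiv r = p by rewrite /r; case: (k./2) h0 => // m _; rewrite pdiv_pfactor.
    rewrite /r -expnM muln2; case ok : (odd k); [right|left]; rewrite nE.
      by rewrite -{1}(odd_double_half k) ok addnC addn1 expnS mulnC.
    by rewrite -{1}(odd_double_half k) ok.
  have pN : lnn p <= lnn N :> R.
    apply: ler_lnn; rewrite ?prime_gt0 //; apply: leq_trans nN; rewrite nE -{1}[p]expn1.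
    by rewrite leq_exp2l ?prime_gt1.
  apply: le_trans (_ : lnn N * 1 <= _); first by rewrite mulr1; lra.
  rewrite ler_wpM2l // (bigD1_seq r) ?iota_uniq ?mem_index_iota ?(ltnW r1) //=.
  apply: le_trans (_ : (n == r ^ 2)%N%:R + (n == r ^ 2 * pdiv r)%N%:R <= _).
    by case: nr => /eqP ->; rewrite [true%:R]mulr1n ?lerDl ?lerDr.
  by rewrite lerDl; apply: sumr_ge0 => i _; rewrite addr_ge0.
- by apply: le_trans (_ : 0 <= _); [lra | rewrite mulr_ge0].
Qed.

Lemma prime_le_mangoldt n : ip n * lnn n <= mangoldt n.
Proof.
rewrite /ip; case: (boolP (prime n)) => [pn|_]; first by rewrite mangoldt_prime // mul1r.
by rewrite [false%:R]mulr0n mul0r mangoldt_ge0.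
Qed.

Lemma psi_theta N : 0 <= psi R N - theta N <= 2 * lnn N * Num.sqrt N%:R.
Proof.
apply/andP; split.
  by rewrite subr_ge0; apply: ler_sum => n _; exact: prime_le_mangoldt.
rewrite -sumrB; apply: le_trans (_ : \sum_(1 <= n < N.+1) lnn N *
   \sum_(1 <= r < N.+1) ((n == r ^ 2)%N%:R + (n == r ^ 2 * pdiv r)%N%:R) <= _).
  by apply: ler_sum_nat => n nN; exact: mangoldt_nonprime.
rewrite -mulr_sumr [2 * _]mulrC -mulrA ler_wpM2l ?lnn_ge0 //.
apply: le_trans (_ : 2 * \sum_(1 <= r < N.+1) ((r ^ 2 <= N)%N)%:R <= _); last first.
  by rewrite ler_wpM2l // count_squares.
rewrite exchange_big /= mulr_sumr; apply: ler_sum_nat => r /andP[r0 _].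
have cnt (m : nat) : (r ^ 2 <= m)%N -> \sum_(1 <= n < N.+1) (n == m)%:R <= ((r ^ 2 <= N)%N)%:R :> R.
  move=> rm; have -> : \sum_(1 <= n < N.+1) (n == m)%N%:R = \sum_(1 <= n < N.+1 | n == m) (1 : R).
    by rewrite [RHS]big_mkcond; apply: eq_bigr => n _; case: (n == m).
  rewrite big_nat1_eq; case: ifP => // /andP[_]; rewrite ltnS => mN.
  by rewrite (leq_trans rm mN).
rewrite big_split /= mulr_natl mulr2n; apply: lerD; apply: cnt => //.
by rewrite leq_pmulr // pdiv_gt0.
Qed.

Lemma sqrt_ln_small eps : 0 < eps -> exists C, 0 <= C /\
  forall N, lnn N * Num.sqrt N%:R <= eps * N%:R + C :> R.
Proof.
move=> e0; pose t0 := 4 / eps; have t00 : 0 < t0 by rewrite divr_gt0.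
exists (4 * t0 ^+ 3); split => [|[|N]]; first by rewrite mulr_ge0 // exprn_ge0 // ltW.
  by rewrite /lnn ln0 // mul0r mulr0 add0r mulr_ge0 // exprn_ge0 // ltW.
have n1 := @ler1n' R N.+1 isT; have [s1 ss] := sqrt_facts n1; have [t1 tt] := sqrt_facts s1.
have l := ln_le_sqrt s1; set s := Num.sqrt N.+1%:R in s1 ss t1 tt l *.
set t := Num.sqrt s in t1 tt l.
have -> : lnn N.+1 = 2 * ln s by rewrite /lnn -ss lnM ?posrE; lra.
rewrite -ss -tt; apply: le_trans (_ : 4 * t ^+ 3 <= _).
  have e3 : t ^+ 3 = t * s by rewrite -tt !exprS expr0 mulr1.
  have s0 : 0 <= s by lra.
  have l' : ln s * s <= 2 * t * s by rewrite ler_wpM2r.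
  rewrite tt e3; lra.
have t3 : 0 <= t ^+ 3 by rewrite exprn_ge0 //; lra.
case: (leP t t0) => h.
  have : t ^+ 3 <= t0 ^+ 3 by rewrite lerXn2r // nnegrE; lra.
  have : 0 <= eps * (t * t * (t * t)) by rewrite !mulr_ge0 //; lra.
  lra.
have -> : t * t * (t * t) = t * t ^+ 3 by rewrite !exprS expr0 mulr1; ring.
have h2 : 4 <= eps * t by rewrite -ler_pdivrMl // mulrC; exact: ltW.
have : 4 * t ^+ 3 <= eps * t * t ^+ 3 by rewrite ler_wpM2r.
have : 0 <= 4 * t0 ^+ 3 by rewrite mulr_ge0 // exprn_ge0 // ltW.
lra.
Qed.

Lemma psi_theta_small eps : 0 < eps -> exists C, 0 <= C /\ forall N, psi R N - theta N <= eps * N%:R + C.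
Proof.
move=> e0; have e2 : 0 < eps / 2 by rewrite divr_gt0.
have [C [C0 hC]] := sqrt_ln_small e2; exists (2 * C); split => [|N]; first lra.
have /andP[_ h] := psi_theta N; apply: le_trans h _; have := hC N; lra.
Qed.

(** Mertens: N times the sum exceeds ln N! by at most psi N <= 12 N. *)
Lemma sum_mangoldt_div N : (0 < N)%N ->
  `|\sum_(1 <= n < N.+1) mangoldt n / n%:R - lnn N| <= 12 :> R.
Proof.
move=> N0; have N0' := ltr0n' R N0; apply: (norm_scale N0').
have e1 : \sum_(1 <= n < N.+1) mangoldt n * (N %/ n)%:R <= N%:R * \sum_(1 <= n < N.+1) mangoldt n / n%:R :> R.
  rewrite mulr_sumr; apply: ler_sum_nat => n /andP[n0 nN].
  have nN' : (0 < n <= N)%N by rewrite n0.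
  have [_ h _ _ _] := flr_ln (flr_div R nN').
  by rewrite mulrCA ler_wpM2l // mangoldt_ge0.
have e2 : N%:R * \sum_(1 <= n < N.+1) mangoldt n / n%:R <= \sum_(1 <= n < N.+1) mangoldt n * (N %/ n)%:R + psi R N.
  rewrite mulr_sumr -big_split; apply: ler_sum_nat => n /andP[n0 nN] /=.
  have nN' : (0 < n <= N)%N by rewrite n0.
  have [_ _ h _ _] := flr_ln (flr_div R nN').
  rewrite mulrCA -[X in _ + X]mulr1 -mulrDr ler_wpM2l ?mangoldt_ge0 //; exact: ltW.
move: e1 e2; rewrite sum_mangoldt_floor mulrBr.
have := sum_lnn_le R N; have := sum_lnn_ge R N; have := chebyshev_psi R N.
by rewrite ler_norml => ? ? ? ? ?; apply/andP; split; lra.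
Qed.

(** [sum_mangoldt_div] at N and at N/Q, each with error 12, leaves at least ln Q - 24 >= 1 for the
    sum over N/Q < n <= N once ln Q > 25; there 1/n is at most Q/N. *)
Lemma psi_lower : exists c : R, 0 < c /\ exists N0 : nat, forall N, (N0 <= N)%N -> c * N%:R <= psi R N.
Proof.
have [Q Q0 hQ] : exists2 Q, (0 < Q)%N & 25 < lnn Q :> R.
  exists (Num.bound (expR (25 : R))).+1 => //.
  rewrite -[25 in X in X < _](expRK (25 : R)) /lnn ltr_ln ?posrE ?expR_gt0 // ?ltr0n //.
  by apply: lt_le_trans (archi_boundP (expR_ge0 _)) _; rewrite ler_nat.
exists (Q%:R^-1); split; first by rewrite invr_gt0 ltr0n.
exists Q => N QN; have N0 : (0 < N)%N by apply: leq_trans QN.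
have j0 : (0 < N %/ Q)%N by rewrite divn_gt0.
set j := (N %/ Q)%N in j0; have jN : (j <= N)%N by rewrite leq_div.
have h1 := sum_mangoldt_div N0; have h2 := sum_mangoldt_div j0.
rewrite (@big_cat_nat _ _ _ j.+1 1 N.+1) //= in h1.
have l : lnn Q + lnn j <= lnn N :> R.
  by rewrite -lnnM //; apply: ler_lnn; rewrite ?muln_gt0 ?Q0 // mulnC leq_trunc_div.
have e1 : 1 <= \sum_(j.+1 <= n < N.+1) mangoldt n / n%:R :> R.
  move: h1 h2; rewrite !ler_norml => /andP[? ?] /andP[? ?]; lra.
have e2 : \sum_(j.+1 <= n < N.+1) mangoldt n / n%:R <= Q%:R / N%:R * psi R N :> R.
  rewrite /psi mulr_sumr [X in _ <= X](@big_cat_nat _ _ _ j.+1) //=.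
  apply: ler_wpDl.
    by apply: sumr_ge0 => n _; rewrite mulr_ge0 ?mangoldt_ge0 // divr_ge0.
  apply: ler_sum_nat => n /andP[jn nN]; rewrite mulrC ler_wpM2r ?mangoldt_ge0 //.
  have n0 : (0 < n)%N by apply: leq_trans jn.
  rewrite -[Q%:R / _]invf_div lef_pV2 ?posrE ?divr_gt0 ?ltr0n //.
  rewrite ler_pdivrMr ?ltr0n // -natrM ler_nat.
  by apply: ltnW; rewrite -ltn_divLR.
have e3 : 1 <= Q%:R / N%:R * psi R N by apply: le_trans e2.
rewrite mulrC ler_pdivrMr ?ltr0n //.
have := ler_wpM2l (ler0n R N) e3; rewrite mulr1 => h; apply: le_trans h _.
suff -> : N%:R * (Q%:R / N%:R * psi R N) = psi R N * Q%:R by [].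
by field; rewrite pnatr_eq0 -lt0n.
Qed.

Lemma theta_lower : exists c : R, 0 < c /\ exists N0 : nat, forall N, (N0 <= N)%N -> c * N%:R <= theta N.
Proof.
have [c [c0 [N0 h]]] := psi_lower; have c4 : 0 < c / 4 by rewrite divr_gt0.
have [C [C0 hC]] := psi_theta_small c4.
exists (c / 2); split; first by rewrite divr_gt0.
exists (maxn N0 (Num.bound (4 * C / c))) => N; rewrite geq_max => /andP[h1 h2].
have := hC N; have := h N h1.
have : 4 * C / c <= N%:R.
  have h3 : 4 * C / c < (Num.bound (4 * C / c))%:R by apply: archi_boundP; rewrite divr_ge0 ?mulr_ge0 // ltW.
  by apply: le_trans (ltW h3) _; rewrite ler_nat.
rewrite ler_pdivrMr //; lra.
Qed.

Lemma theta_le_ppi_ln N : theta N <= ppi N * lnn N.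
Proof.
rewrite /ppi mulr_suml; apply: ler_sum_nat => n /andP[n0 nN].
by rewrite ler_wpM2l // ler_lnn.
Qed.

Lemma ppi_ln_upper N : ppi N * lnn N <= 13 * N%:R.
Proof.
have -> : ppi N * lnn N = theta N + \sum_(1 <= n < N.+1) ip n * (lnn N - lnn n).
  by rewrite /ppi mulr_suml -big_split; apply: eq_bigr => n _ /=; ring.
have e1 : \sum_(1 <= n < N.+1) ip n * (lnn N - lnn n) <= N%:R.
  apply: le_trans (sum_ln_ratio R N); apply: ler_sum_nat => n /andP[n0 nN].
  by rewrite ler_piMl ?lern1 ?leq_b1 // subr_ge0 ler_lnn.
have /andP[e2 _] := psi_theta N; have := chebyshev_psi R N; lra.
Qed.

Lemma lnn_large (B : R) : exists2 N0 : nat, (0 < N0)%N & forall N, (N0 <= N)%N -> B < lnn N.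
Proof.
exists (Num.bound (expR B)).+1 => // N NN; apply: lt_le_trans (ler_lnn R _ NN) => //.
rewrite -{1}[B]expRK /lnn ltr_ln ?posrE ?expR_gt0 ?ltr0n //.
by apply: lt_le_trans (archi_boundP (expR_ge0 _)) _; rewrite ler_nat.
Qed.

Lemma ppi_lower : exists c : R, 0 < c /\ exists2 N0 : nat, (2 <= N0)%N &
  forall N, (N0 <= N)%N -> c * N%:R <= ppi N * lnn N.
Proof.
have [c [c0 [N0 h]]] := theta_lower; exists c; split => //; exists N0.+2 => // N NN.
by apply: le_trans (h N _) (theta_le_ppi_ln N); lia.
Qed.

Lemma ppi_small eps : 0 < eps -> exists C, 0 <= C /\ forall N, ppi N <= eps * N%:R + C.
Proof.
move=> e0; have [N0 N00 hN0] := lnn_large (13 / eps); exists N0%:R; split => // N.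
case: (leqP N0 N) => NN; last first.
  apply: le_trans (ppi_le N) _; apply: ler_wpDl; first by rewrite mulr_ge0 // ltW.
  by rewrite ler_nat ltnW.
apply: ler_wpDr => //; have l := hN0 N NN.
have l0 : 0 < lnn N :> R by apply: lt_trans l; rewrite divr_gt0.
rewrite -(ler_pM2r l0); apply: le_trans (ppi_ln_upper N) _.
rewrite mulrAC ler_wpM2r // -ler_pdivrMl // mulrC; exact: ltW.
Qed.

Lemma lnn_small eps : 0 < eps -> exists C, 0 <= C /\ forall N, lnn N <= eps * N%:R + C.
Proof.
move=> e0; have [C [C0 hC]] := sqrt_ln_small e0; exists C; split => // -[|N].
  by rewrite /lnn ln0 // mulr0 add0r.
apply: le_trans (hC N.+1); rewrite ler_peMr ?lnn_ge0 //.
by have [] := sqrt_facts (@ler1n' R N.+1 isT).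
Qed.

Lemma sum_prime_ln_ratio_small eps : 0 < eps -> exists C, 0 <= C /\ forall N,
  \sum_(1 <= n < N.+1) ip n * (lnn N - lnn n) <= eps * N%:R + C.
Proof.
move=> e0; have e2 : 0 < eps / 2 by rewrite divr_gt0.
have [C [C0 hC]] := ppi_small e2.
have e3 : 0 < eps / 2 / (C + 1) by rewrite divr_gt0 //; lra.
have [D [D0 hD]] := lnn_small e3.
exists (C * (1 + D)); split => [|N]; first by rewrite mulr_ge0 //; lra.
case: N => [|N]; first by rewrite big_geq // mulr0 add0r mulr_ge0 //; lra.
rewrite abel subrr mulr0 add0r.
apply: le_trans (_ : \sum_(1 <= n < N.+1) (eps / 2 + C * n%:R^-1) <= _).
  apply: ler_sum_nat => n /andP[n0 _]; rewrite -/(ppi n).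
  have /andP[_ l] := lnnS R n0.
  have -> : lnn N.+1 - lnn n - (lnn N.+1 - lnn n.+1) = lnn n.+1 - lnn n :> R by ring.
  apply: le_trans (ler_wpM2l (ppi_ge0 n) l) _.
  have n0' := ltr0n' R n0; rewrite ler_pdivrMr //.
  have -> : (eps / 2 + C / n%:R) * n%:R = eps / 2 * n%:R + C by field; rewrite gt_eqF.
  exact: hC.
rewrite big_split /= sumr_const_nat subn1 /= -mulr_sumr.
have s1 : \sum_(1 <= n < N.+1) n%:R^-1 <= 1 + lnn N.+1 :> R.
  apply: le_trans (sum_inv R (isT : 0 < N.+1)%N).
  by rewrite [X in _ <= X]big_nat_recr //= lerDl.
have := ler_wpM2l C0 s1; have := ler_wpM2l C0 (hD N.+1).
have ce : C * (eps / 2 / (C + 1) * N.+1%:R) <= eps / 2 * N.+1%:R.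
  rewrite mulrA ler_wpM2r // mulrCA ler_piMr ?(ltW e2) // ler_pdivrMr; lra.
have : (eps / 2) *+ N <= eps / 2 * N.+1%:R.
  by rewrite -mulr_natr ler_wpM2l ?(ltW e2) // ler_nat.
lra.
Qed.

Lemma ppi_ratio : exists K : R, 0 < K /\ forall r, (0 < r)%N -> exists C, 0 <= C /\
  forall N, ppi N <= K * r%:R * ppi (N %/ r) + C.
Proof.
have [c [c0 [N0 N02 h]]] := ppi_lower.
exists (26 / c); split => [|r r0]; first by rewrite divr_gt0.
exists (r * N0)%:R; split => // N.
case: (leqP (r * N0) N) => NN; last first.
  apply: le_trans (ppi_le N) _; apply: ler_wpDl.
    by rewrite mulr_ge0 ?ppi_ge0 // mulr_ge0 // divr_ge0 // ltW.
  by rewrite ler_nat ltnW.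
apply: ler_wpDr => //; set M := (N %/ r)%N.
have MN0 : (N0 <= M)%N by rewrite leq_divRL // mulnC.
have M2 : (2 <= M)%N by apply: leq_trans MN0.
have MN : (M <= N)%N by rewrite leq_div.
have l0 : 0 < lnn N :> R by rewrite /lnn ln_gt0 // ltr1n; lia.
rewrite -(ler_pM2r l0); apply: le_trans (ppi_ln_upper N) _.
have h1 : c * M%:R <= ppi M * lnn N.
  apply: le_trans (h M MN0) _; rewrite ler_wpM2l ?ppi_ge0 // ler_lnn //; lia.
have h2 : N%:R <= 2 * r%:R * M%:R :> R.
  rewrite -!natrM ler_nat; have := ltn_ceil N r0; rewrite -/M; nia.
have := ler_wpM2l (_ : 0 <= 26 / c * r%:R) h1; rewrite mulr_ge0 ?divr_ge0 ?(ltW c0) // => /(_ isT).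
have -> : 26 / c * r%:R * (c * M%:R) = 13 * (2 * r%:R * M%:R) by field; rewrite gt_eqF.
have := ler_wpM2l (ler0n R 13) h2; rewrite [_ * (ppi M * _)]mulrA; lra.
Qed.

(** By summation by parts and ppi n >= c n / ln n the sum dominates a multiple of the sum of 1/(n ln
    n), which grows like ln ln N. *)
Lemma sum_recip_primes_unbounded (B : R) : exists N, B < \sum_(1 <= n < N.+1) ip n / n%:R.
Proof.
have [c [c0 [N0 N02 h]]] := ppi_lower.
pose m := maxn N0 3; have m3 : (3 <= m)%N by rewrite leq_maxr.
have lpos n : (m <= n)%N -> 0 < lnn n :> R.
  by move=> mn; rewrite /lnn ln_gt0 // ltr1n; lia.
have step n : (m <= n)%N -> c / 2 * (ln (lnn n.+1) - ln (lnn n)) <= ppi n * (n%:R^-1 - n.+1%:R^-1).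
  move=> mn; have n0 : (0 < n)%N by lia.
  have l0 := lpos n mn; have l1 := lpos n.+1 (leqW mn); have /andP[_ l] := lnnS R n0.
  apply: le_trans (_ : c / 2 * ((lnn n.+1 - lnn n) / lnn n) <= _).
    by rewrite ler_wpM2l ?ln_sub_le // divr_ge0 // ltW.
  rewrite inv_diffE //.
  have hn : c * n%:R <= ppi n * lnn n by apply: h; apply: leq_trans mn; rewrite leq_maxl.
  have n0' := ltr0n' R n0; have n1' := @ltr0n' R n.+1 isT.
  apply: le_trans (_ : c / 2 * (n%:R^-1 / lnn n) <= _).
    by rewrite ler_wpM2l ?divr_ge0 ?(ltW c0) // ler_wpM2r // invr_ge0 ltW.
  rewrite ler_pdivlMr ?mulr_gt0 // -(ler_pM2r l0).
  have -> : c / 2 * (n%:R^-1 / lnn n) * (n%:R * n.+1%:R) * lnn n = c / 2 * n.+1%:R.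
    by move: n1' n0' l0; set x := n.+1%:R; set y := n%:R; set z := lnn n => *; field; rewrite !gt_eqF.
  apply: le_trans hn; rewrite -mulrA ler_pM2l // mulrC ler_pdivrMr // -natrM ler_nat; lia.
have [N1 N10 hN1] := lnn_large (expR (2 * (B / c) + ln (lnn m))).
pose N := maxn N1 m; have mN : (m <= N)%N by rewrite leq_maxr.
exists N; rewrite (abel ip (fun n => n%:R^-1)).
apply: lt_le_trans (_ : c / 2 * (ln (lnn N) - ln (lnn m)) <= _).
  have : 2 * (B / c) + ln (lnn m) < ln (lnn N).
    rewrite -ltr_expR lnK ?posrE ?lpos //; apply: hN1; by rewrite leq_maxl.
  move=> hh; have hh' : 2 * (B / c) < ln (lnn N) - ln (lnn m) by lra.
  have c2 : 0 < c / 2 by rewrite divr_gt0.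
  have := ltr_pM2l c2 (2 * (B / c)) (ln (lnn N) - ln (lnn m)); rewrite hh'.
  have -> : c / 2 * (2 * (B / c)) = B by field; rewrite gt_eqF.
  by move=> ->.
apply: ler_wpDl; first by rewrite mulr_ge0 ?sumr_ge0 // invr_ge0.
rewrite -(telescope_sumr (fun n => ln (lnn n))) // mulr_sumr.
rewrite (@big_cat_nat _ _ _ m 1 N) //=; last by lia.
apply: ler_wpDl.
  rewrite big_nat_cond; apply: sumr_ge0 => n /andP[/andP[n0 _] _].
  by rewrite mulr_ge0 ?sumr_ge0 // inv_diffE // invr_ge0 mulr_ge0.
by apply: ler_sum_nat => n /andP[mn _]; exact: step.
Qed.

End Primes.

(** * Growth of the counts of almost primes *)

Section AlmostPrimes.
Variable R : realType.
Implicit Types (n m k p r l N : nat) (eps : R).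

Definition al l n : R := (`[< almost_prime l n >])%:R.
Definition pil l N : R := \sum_(1 <= n < N.+1) al l n.

Lemma al_ge0 l n : 0 <= al l n. Proof. by []. Qed.

Lemma al_le1 l n : al l n <= 1. Proof. by rewrite lern1 leq_b1. Qed.

Lemma pil_ge0 l N : 0 <= pil l N. Proof. exact: sumr_ge0. Qed.

Lemma pil_le l N : pil l N <= N%:R.
Proof.
apply: le_trans (_ : \sum_(1 <= n < N.+1) 1 <= _); last by rewrite sumr_const_nat subn1.
by apply: ler_sum_nat => n _; exact: al_le1.
Qed.

Lemma pil_mono l m n : (m <= n)%N -> pil l m <= pil l n.
Proof. by move=> mn; rewrite [pil l n](@big_cat_nat _ _ _ m.+1) //= lerDl sumr_ge0. Qed.

Lemma prod_primes_gt0 (s : seq nat) : all prime s -> (0 < \prod_(p <- s) p)%N.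
Proof.
elim: s => [|p s IH] /=; first by rewrite big_nil.
by move=> /andP[pp /IH h]; rewrite big_cons muln_gt0 prime_gt0.
Qed.

Lemma pilS l N : pil l N.+1 = pil l N + al l N.+1.
Proof. by rewrite /pil big_nat_recr. Qed.

Lemma almost_prime_gt0 l n : almost_prime l n -> (0 < n)%N.
Proof. by case=> s [_ ps ->]; exact: prod_primes_gt0. Qed.

Lemma almost_prime_mul l p n : prime p -> almost_prime l n -> almost_prime l.+1 (p * n).
Proof.
move=> pp [s [ss ps ->]]; exists (p :: s); split; rewrite /= ?ss ?pp //.
by rewrite big_cons.
Qed.

Lemma prime_dvd_prod (s : seq nat) p : prime p -> all prime s ->
  (p %| \prod_(i <- s) i)%N -> p \in s.
Proof.
move=> pp; elim: s => [|q s IH] /=; first by rewrite big_nil dvdn1 => _ /eqP p1; move: pp; rewrite p1.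
move=> /andP[qp ps]; rewrite big_cons Euclid_dvdM // inE dvdn_prime2 // => /orP[->//|].
by move=> /(IH ps) ->; rewrite orbT.
Qed.

Lemma almost_prime_div l p n : prime p -> (p %| n)%N -> almost_prime l.+1 n ->
  almost_prime l (n %/ p).
Proof.
move=> pp pn [s [ss ps nE]]; have ins : p \in s by apply: prime_dvd_prod => //; rewrite -nE.
exists (rem p s); split; first by rewrite size_rem // ss.
  by apply/allP => q /mem_rem /(allP ps).
by rewrite nE (perm_big _ (perm_to_rem ins)) big_cons mulKn ?prime_gt0.
Qed.

Lemma al_prime_mul l p n : prime p -> al l.+1 (p * n) = al l n.
Proof.
move=> pp; congr (_%:R); congr (nat_of_bool _); apply/asboolP/asboolP => [h|]; last exact: almost_prime_mul.
by have := almost_prime_div pp (dvdn_mulr n (dvdnn p)) h; rewrite mulKn ?prime_gt0.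
Qed.

Lemma dsum_dvd (F : nat -> nat -> R) n : (0 < n)%N ->
  dsum F n = \sum_(1 <= d < n.+1 | (d %| n)%N) F d (n %/ d)%N.
Proof.
move=> n0; rewrite /dsum [RHS]big_mkcond; apply: eq_big_nat => d /andP[d0 dn].
case: ifP => dvd; last first.
  by rewrite big_pred0 // => k; apply/eqP => E; move: dvd; rewrite -E dvdn_mulr.
rewrite (eq_bigl (fun k => k == n %/ d)%N); last first.
  by move=> k; rewrite mulnC -eqn_div.
by rewrite big_nat1_eq ltnS leq_div divn_gt0 // dvdn_leq.
Qed.

(** At an (l+1)-almost prime the convolution counts the distinct prime divisors: at least one, and
    at most l + 1 in [conv_le_al]. *)
Lemma al_le_conv l n : (0 < n)%N -> al l.+1 n <= dconv (ip R) (al l) n.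
Proof.
move=> n0; rewrite /dconv dsum_dvd //.
rewrite {1}/al; case: asboolP => [ap|_]; last by apply: sumr_ge0 => d _; rewrite mulr_ge0.
have [p pp pn] : exists2 p, prime p & (p %| n)%N.
  case: ap => -[|p s] [// _ /= /andP[pp _] nE]; exists p => //.
  by rewrite nE big_cons dvdn_mulr.
have inP : p \in index_iota 1 n.+1 by rewrite mem_index_iota prime_gt0 // ltnS dvdn_leq.
rewrite big_mkcond (bigD1_seq p inP (iota_uniq _ _)) pn.
have -> : al l (n %/ p) = 1 by rewrite -(al_prime_mul l _ pp) mulnC divnK // /al asboolT.
set S := (X in _ <= _ _ X); rewrite /= /ip pp mulr1 lerDl.
by apply: sumr_ge0 => d _; case: ifP => // _; rewrite mulr_ge0.
Qed.

Lemma conv_le_al l n : (0 < n)%N -> dconv (ip R) (al l) n <= l.+1%:R * al l.+1 n.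
Proof.
move=> n0; rewrite /dconv dsum_dvd // {2}/al.
case: asboolP => [[s [ss ps nE]]|ap]; last first.
  rewrite mulr0 big1_seq // => d /andP[dn _]; rewrite /ip.
  case: (boolP (prime d)) => [pd|_]; last by rewrite [false%:R]mulr0n mul0r.
  rewrite -(@al_prime_mul l d) // mulnC divnK //.
  by rewrite /al asboolF // mulr0.
rewrite mulr1 (@le_trans _ _ (\sum_(1 <= d < n.+1 | prime d && (d %| n)%N) 1)) //.
  rewrite [X in X <= _]big_mkcond [X in _ <= X]big_mkcond; apply: ler_sum => d _.
  rewrite /ip; case: (d %| n)%N; rewrite ?andbF // andbT.
  by case: (prime d); rewrite ?mul1r ?al_le1 // [false%:R]mulr0n mul0r.
rewrite -big_filter big_const_seq count_predT iter_addr addr0 ler_nat -ss.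
apply: uniq_leq_size; first by rewrite filter_uniq // iota_uniq.
move=> d; rewrite mem_filter => /andP[/andP[pd dn] _].
by apply: prime_dvd_prod => //; rewrite -nE.
Qed.

Lemma sum_conv_al l N : \sum_(1 <= n < N.+1) dconv (ip R) (al l) n =
  \sum_(1 <= m < N.+1) al l m * ppi R (N %/ m).
Proof.
rewrite dconvC sum_dsum; apply: eq_bigr => m _.
by rewrite /ppi mulr_sumr.
Qed.

Lemma pil_le_sum l N : pil l.+1 N <= \sum_(1 <= m < N.+1) al l m * ppi R (N %/ m).
Proof.
by rewrite -sum_conv_al; apply: ler_sum_nat => n /andP[n0 _]; exact: al_le_conv.
Qed.

Lemma sum_le_pil l N : \sum_(1 <= m < N.+1) al l m * ppi R (N %/ m) <= l.+1%:R * pil l.+1 N.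
Proof.
rewrite -sum_conv_al mulr_sumr.
by apply: ler_sum_nat => n /andP[n0 _]; exact: conv_le_al.
Qed.

Lemma sum_prime_pil l N : \sum_(1 <= p < N.+1) ip R p * pil l (N %/ p) <= l.+1%:R * pil l.+1 N.
Proof.
apply: le_trans (sum_le_pil l N); rewrite -sum_conv_al sum_dsum.
by apply: ler_sum_nat => p _; rewrite /pil mulr_sumr.
Qed.

(** K must not depend on r, since [ratio_small] sums the bound over many primes r. *)
Definition ratio_bound l (K : R) := 0 < K /\ forall r, (0 < r)%N -> exists C : R, 0 <= C /\
  forall N, pil l N <= K * r%:R * pil l (N %/ r) + C.

(** By the ratio bound the sum of pil l (N / p) over primes p <= P is at least (pil l N) / K times
    the sum of 1/p, up to a constant; [sum_prime_pil] bounds it by l + 1 times pil l.+1 N. The sum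
    of 1/p is unbounded. *)
Lemma ratio_small l K : ratio_bound l K -> forall eps, 0 < eps -> exists C : R, 0 <= C /\
  forall N, pil l N <= eps * pil l.+1 N + C.
Proof.
move=> [K0 hK] eps e0.
pose B := K * l.+1%:R / eps; have [P hP] := sum_recip_primes_unbounded B.
have ex r : exists C : R, 0 <= C /\ ((0 < r)%N -> forall N, pil l N <= K * r%:R * pil l (N %/ r) + C).
  case: (posnP r) => [->|r0]; first by exists 0.
  by have [C [C0 hC]] := hK r r0; exists C.
have [CC hCC] := choice ex.
pose D := \sum_(1 <= p < P.+1) CC p.
have D0 : 0 <= D by apply: sumr_ge0 => p _; have [] := hCC p.
have B0 : 0 < B by rewrite divr_gt0 // mulr_gt0.
exists (D / B + P%:R); split => [|N]; first by rewrite addr_ge0 // divr_ge0 // ltW.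
case: (leqP P N) => PN; last first.
  apply: le_trans (pil_le l N) _; apply: ler_wpDl; first by rewrite mulr_ge0 ?pil_ge0 // ltW.
  apply: ler_wpDl; first by rewrite divr_ge0 // ltW.
  by rewrite ler_nat ltnW.
have e1 : B * pil l N <= K * (\sum_(1 <= p < P.+1) ip R p * pil l (N %/ p)) + D.
  apply: le_trans (ler_wpM2r (pil_ge0 l N) (ltW hP)) _.
  rewrite mulr_suml mulr_sumr /D -big_split; apply: ler_sum_nat => p /andP[p0 _] /=.
  have [c0 hC] := hCC p; have p0' := ltr0n' R p0.
  have h := hC p0 N; rewrite /ip; case: (prime p); last by rewrite !mul0r mulr0 add0r.
  rewrite !mul1r mulrC ler_pdivrMr //; apply: le_trans h _.
  rewrite mulrDl mulrAC lerD2l ler_peMr // ler1n //.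
have e2 : \sum_(1 <= p < P.+1) ip R p * pil l (N %/ p) <= l.+1%:R * pil l.+1 N.
  apply: le_trans (sum_prime_pil l N); rewrite [X in _ <= X](@big_cat_nat _ _ _ P.+1) //=.
  by rewrite lerDl sumr_ge0 // => p _; rewrite mulr_ge0 ?pil_ge0.
have e3 : B * pil l N <= B * (eps * pil l.+1 N + D / B).
  have -> : B * (eps * pil l.+1 N + D / B) = K * (l.+1%:R * pil l.+1 N) + D.
    rewrite mulrDr; congr (_ + _); last by field; rewrite gt_eqF.
    by rewrite /B; field; rewrite gt_eqF.
  by apply: le_trans e1 _; rewrite lerD2r ler_pM2l.
rewrite ler_pM2l // in e3; apply: le_trans e3 _; rewrite addrA lerDl //.
Qed.

(** [ppi_ratio] leaves an error Cr * pil l N whose constant depends on r. The ratio bound at level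
    l, then [ratio_small] with eps = 1/(Cr K + 1), turn it into r * pil l.+1 (N / r) plus a
    constant: hence the + 1 in the new ratio. *)
Lemma pil_ratio l : exists K : R, ratio_bound l K.
Proof.
elim: l => [|l [K hK]].
  exists 1; split => // r r0; exists 1; split => // N.
  have z : pil 0 N <= 1.
    rewrite /pil; case: N => [|N]; first by rewrite big_geq.
    rewrite big_ltn // big1_seq ?addr0 ?al_le1 // => n; rewrite mem_index_iota => /andP[_ /andP[n1 _]].
    rewrite /al asboolF // => -[s [/size0nil -> _]]; rewrite big_nil => n1'.
    by rewrite n1' in n1.
  by apply: ler_wpDl; rewrite ?mulr_ge0 ?pil_ge0.
have small := ratio_small hK; case: hK => K0 hK.
have [Kp [Kp0 hKp]] := ppi_ratio R.
exists (Kp * l.+1%:R + 1); split => [|r r0]; first by rewrite ltr_wpDl // mulr_ge0 // ltW.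
have [Cr [Cr0 h1]] := hKp r r0; have [C2 [C20 h2]] := hK r r0.
have d0 : 0 < (Cr * K + 1)^-1 by rewrite invr_gt0 ltr_wpDl // mulr_ge0 // ltW.
have [C3 [C30 h3]] := small _ d0.
have r0' := ltr0n' R r0.
exists (Cr * (K * r%:R * C3 + C2)); split => [|N].
  by rewrite mulr_ge0 // addr_ge0 // mulr_ge0 // mulr_ge0 // ltW.
apply: le_trans (pil_le_sum l N) _.
apply: le_trans (_ : Kp * r%:R * (\sum_(1 <= m < N.+1) al l m * ppi R (N %/ r %/ m)) + Cr * pil l N <= _).
  rewrite /pil !mulr_sumr -big_split; apply: ler_sum_nat => m _ /=.
  rewrite -divnMA mulnC divnMA.
  have := ler_wpM2l (al_ge0 l m) (h1 (N %/ m)%N); lra.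
have e1 : \sum_(1 <= m < N.+1) al l m * ppi R (N %/ r %/ m) <= l.+1%:R * pil l.+1 (N %/ r).
  apply: le_trans (sum_le_pil l _); rewrite [X in X <= _](@big_cat_nat _ _ _ (N %/ r).+1) //=; last by rewrite ltnS leq_div.
  rewrite gerDl le_eqVlt big1_seq ?eqxx // => m; rewrite mem_index_iota => /andP[_ /andP[m1 _]].
  by rewrite divn_small // /ppi big_geq // mulr0.
have e2 : Cr * pil l N <= r%:R * pil l.+1 (N %/ r) + Cr * (K * r%:R * C3 + C2).
  apply: le_trans (ler_wpM2l Cr0 (h2 N)) _.
  have t := ler_wpM2l (_ : 0 <= Cr * K * r%:R) (h3 (N %/ r)%N).
  have t0 : 0 <= Cr * K * r%:R by rewrite !mulr_ge0 // ltW.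
  have := t t0; move: (pil_ge0 l.+1 (N %/ r)); set X := pil l.+1 _ => X0.
  have : Cr * K * r%:R * ((Cr * K + 1)^-1 * X) <= r%:R * X.
    have -> : Cr * K * r%:R * ((Cr * K + 1)^-1 * X) = r%:R * X * (Cr * K / (Cr * K + 1)) by ring.
    rewrite ler_piMr ?mulr_ge0 // ler_pdivrMr; last by rewrite -invr_gt0.
    by rewrite mul1r lerDl.
  lra.
have := ler_wpM2l (_ : 0 <= Kp * r%:R) e1; rewrite mulr_ge0 ?(ltW Kp0) // => /(_ isT); lra.
Qed.

Lemma pil_small l eps : 0 < eps -> exists C : R, 0 <= C /\
  forall N, pil l N <= eps * pil l.+1 N + C.
Proof. by have [K hK] := pil_ratio l; exact: ratio_small hK _. Qed.

Lemma pil_double l N : pil l N <= pil l.+1 (2 * N).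
Proof.
elim: N => [|N IH]; first by rewrite /pil big_geq // sumr_ge0.
rewrite pilS -(al_prime_mul l N.+1 (isT : prime 2)) mulnS !addSn add0n !pilS.
by rewrite lerD2r ler_wpDr.
Qed.

Lemma pil_unbounded l (B : R) : exists N0, forall N, (N0 <= N)%N -> B < pil l.+1 N.
Proof.
suff [N0 h] : exists N0, B < pil l.+1 N0.
  by exists N0 => N NN; apply: lt_le_trans h (pil_mono _ NN).
elim: l => [|l [N h]]; last by exists (2 * N)%N; apply: lt_le_trans h (pil_double _ _).
have [N h] := sum_recip_primes_unbounded B; exists N; apply: lt_le_trans h _.
apply: ler_sum_nat => n /andP[n0 _]; rewrite /ip; case: (boolP (prime n)) => [pn|_]; last by rewrite mul0r.
rewrite mul1r /al asboolT; first by rewrite invf_le1 ?ltr0n' // ler1n.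
by exists [:: n]; rewrite /= pn big_seq1.
Qed.

(** The largest prime makes the factorisation n = m p unique, so this is an identity, whereas
    [al_le_conv] and [conv_le_al] count n up to l + 1 times. *)
Lemma al_max_conv l n : (0 < n)%N -> al l.+1 n =
  dsum (fun m p => al l m * (ip R p * ((max_pdiv m <= p)%N)%:R)) n.
Proof.
move=> n0; rewrite dsum_sym dsum_dvd //; have [n1|n1] := leqP n 1.
  have -> : n = 1%N by lia.
  rewrite big1_seq => [|d]; last first.
    rewrite dvdn1 => /andP[/eqP -> _]; rewrite /ip [(prime 1)%:R]mulr0n mul0r mulr0 //.
  rewrite /al asboolF // => -[[|p s] [// _ /= /andP[pp ps]]]; rewrite big_cons => /esym/eqP.
  by rewrite muln_eq1 => /andP[/eqP p1 _]; move: pp; rewrite p1.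
set P := max_pdiv n; have Pp : prime P by rewrite max_pdiv_prime.
have Pn : (P %| n)%N by rewrite max_pdiv_dvd.
have Pmax d : prime d -> (d %| n)%N -> (d <= P)%N.
  by move=> pd dn; rewrite max_pdiv_max // mem_primes pd n0.
move: P Pp Pn Pmax => P Pp Pn Pmax.
have inP : P \in index_iota 1 n.+1 by rewrite mem_index_iota prime_gt0 // ltnS dvdn_leq.
rewrite big_mkcond (bigD1_seq P inP (iota_uniq _ _)) Pn.
rewrite big1_seq ?addr0 => [|d /andP[dP _]]; last first.
  case: ifP => // dn; rewrite /ip; case: (boolP (prime d)) => [pd|_]; last by rewrite mul0r mulr0.
  have [le|_] := leqP (max_pdiv (n %/ d)) d; last by rewrite !mulr0.
  have dP' : (d < P)%N.
    by rewrite ltn_neqAle dP Pmax.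
  have : (P %| n %/ d * d)%N by rewrite divnK.
  rewrite Euclid_dvdM // => /orP[h|]; last by rewrite dvdn_prime2 // eq_sym (negbTE dP).
  have nd0 : (0 < n %/ d)%N by rewrite divn_gt0 ?prime_gt0 // dvdn_leq.
  have : (P <= max_pdiv (n %/ d))%N by rewrite max_pdiv_max // mem_primes Pp nd0.
  by move=> h2; move: (leq_trans h2 le); rewrite leqNgt dP'.
rewrite /ip Pp mul1r.
have -> : (max_pdiv (n %/ P) <= P)%N.
  have nP0 : (0 < n %/ P)%N by rewrite divn_gt0 ?prime_gt0 // dvdn_leq.
  have [nP1|nP1] := leqP (n %/ P) 1.
    by have -> : (n %/ P)%N = 1%N by [lia]; rewrite prime_gt0.
  apply: Pmax; first exact: max_pdiv_prime.
  by apply: dvdn_trans (max_pdiv_dvd _) _; rewrite dvdn_div.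
by rewrite /= addr0 mulr1 -(al_prime_mul l _ Pp) mulnC divnK.
Qed.

End AlmostPrimes.

(** * Equidistribution in residue classes *)

Section Classes.
Variables (R : realType) (G : finGroupType) (cop : nat -> bool) (cl : nat -> G) (kap C : R).
Hypothesis mulGC : forall a b : G, (a * b = b * a)%g.
Hypothesis copM : forall m n, cop (m * n) = cop m && cop n.
Hypothesis cop1 : cop 1.
Hypothesis clM : forall m n, cop m -> cop n -> cl (m * n) = (cl m * cl n)%g.
Hypothesis kap_gt0 : 0 < kap.
Implicit Types (a b : G) (f g : nat -> R) (n d k N : nat).

(** The guard [cop n] matters: elsewhere the value of [cl] is arbitrary. *)
Definition dl a n : R := (cop n && (cl n == a))%:R.
Definition wt n : R := (cop n)%:R.

Hypothesis dens : forall a N, `|\sum_(1 <= n < N.+1) dl a n - kap * N%:R| <= C.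

Let h : R := #|G|%:R.
Let K := h * kap.

Let h_gt0 : 0 < h.
Proof. by rewrite ltr0n; apply/card_gt0P; exists 1%g. Qed.

Let K_gt0 : 0 < K. Proof. exact: mulr_gt0. Qed.

Let C_ge0 : 0 <= C. Proof. exact: le_trans (normr_ge0 _) (dens 1%g 0). Qed.

Lemma cl1 : cl 1 = 1%g.
Proof.
have := clM cop1 cop1; rewrite muln1 => /(congr1 (fun t => (t * (cl 1)^-1)%g)).
by rewrite mulgV mulgK => <-.
Qed.

Lemma dl_ge0 a n : 0 <= dl a n. Proof. by []. Qed.
Lemma wt_ge0 n : 0 <= wt n. Proof. by []. Qed.
Lemma wt_le1 n : wt n <= 1. Proof. by rewrite lern1 leq_b1. Qed.
Lemma dl_le1 a n : dl a n <= 1. Proof. by rewrite lern1 leq_b1. Qed.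

Lemma wt_norm n x : `|wt n * x| <= `|x|.
Proof. by rewrite normrM ger0_norm ?wt_ge0 // ler_piMl // wt_le1. Qed.

Lemma wtM d k : wt (d * k) = wt d * wt k.
Proof. by rewrite /wt copM -natrM mulnb. Qed.

Lemma wt1 : wt 1 = 1. Proof. by rewrite /wt cop1. Qed.

Lemma dl1 a : dl a 1 = (a == 1%g)%:R. Proof. by rewrite /dl cop1 cl1 eq_sym. Qed.

Lemma dl_mul a d k : dl a (d * k) = wt d * dl ((cl d)^-1 * a)%g k.
Proof.
rewrite /dl /wt copM; case cd: (cop d); rewrite ?mul0r ?mul1r //=.
case ck: (cop k) => //=; rewrite clM //.
by rewrite -[in RHS](inj_eq (mulgI (cl d))) mulKVg.
Qed.

Lemma sum_class (F : G -> R) n : \sum_a dl a n * F a = wt n * F (cl n).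
Proof.
rewrite (bigD1 (cl n)) //= big1 ?addr0; first by rewrite /dl eqxx andbT.
by move=> a na; rewrite /dl eq_sym (negbTE na) andbF mul0r.
Qed.

Lemma sum_dl n : \sum_a dl a n = wt n.
Proof. by rewrite -[RHS]mulr1 -(sum_class (fun=> 1)); apply: eq_bigr => a _; rewrite mulr1. Qed.

Lemma sum_by_class f (F : G -> R) m N :
  \sum_(m <= d < N) wt d * f d * F (cl d) = \sum_b (\sum_(m <= d < N) dl b d * f d) * F b.
Proof.
under [RHS]eq_bigr do rewrite mulr_suml.
rewrite exchange_big /=; apply: eq_bigr => d _.
rewrite mulrAC -sum_class mulr_suml; apply: eq_bigr => a _; ring.
Qed.

Lemma dens_wt N : `|\sum_(1 <= n < N.+1) wt n - K * N%:R| <= h * C.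
Proof.
under eq_bigr do rewrite -sum_dl.
rewrite exchange_big /= (_ : K * _ = \sum_(a : G) kap * N%:R); last first.
  by rewrite sumr_const -[X in _ = X]mulr_natl mulrA.
rewrite -sumrB; apply: le_trans (ler_norm_sum _ _ _) _.
apply: le_trans (ler_sum _ (fun a _ => dens a N)) _.
by rewrite sumr_const -mulr_natl.
Qed.

Lemma conv_class a f g N : \sum_(1 <= n < N.+1) dl a n * dconv f g n =
  \sum_(1 <= d < N.+1) wt d * f d *
    (\sum_(1 <= k < (N %/ d).+1) dl ((cl d)^-1 * a)%g k * g k).
Proof.
under eq_bigr do rewrite mulrC dsum_mulr.
rewrite sum_dsum; apply: eq_bigr => d _; rewrite mulr_sumr; apply: eq_bigr => k _.
rewrite dl_mul; ring.
Qed.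

Lemma conv_wt f g N : \sum_(1 <= n < N.+1) wt n * dconv f g n =
  \sum_(1 <= d < N.+1) wt d * f d * (\sum_(1 <= k < (N %/ d).+1) wt k * g k).
Proof.
under eq_bigr do rewrite mulrC dsum_mulr.
rewrite sum_dsum; apply: eq_bigr => d _; rewrite mulr_sumr; apply: eq_bigr => k _.
rewrite wtM; ring.
Qed.

Lemma dconv_div f g n : dconv (fun d => f d / d%:R) (fun d => g d / d%:R) n = dconv f g n / n%:R.
Proof.
rewrite /dconv (dsum_mulr _ (fun n => n%:R^-1)); apply: eq_dsum => d k d0 k0 _.
by rewrite natrM; field; rewrite !pnatr_eq0 -!lt0n d0 k0.
Qed.

Lemma conv_class_div a f g N : \sum_(1 <= n < N.+1) dl a n * (dconv f g n / n%:R) =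
  \sum_(1 <= d < N.+1) wt d * (f d / d%:R) *
    (\sum_(1 <= k < (N %/ d).+1) dl ((cl d)^-1 * a)%g k * (g k / k%:R)).
Proof. by rewrite -conv_class; apply: eq_bigr => n _; rewrite dconv_div. Qed.

Lemma conv_wt_div f g N : \sum_(1 <= n < N.+1) wt n * (dconv f g n / n%:R) =
  \sum_(1 <= d < N.+1) wt d * (f d / d%:R) *
    (\sum_(1 <= k < (N %/ d).+1) wt k * (g k / k%:R)).
Proof. by rewrite -conv_wt; apply: eq_bigr => n _; rewrite dconv_div. Qed.

Lemma sum_dunit (u : nat -> R) N : (0 < N)%N -> \sum_(1 <= n < N.+1) u n * dunit n = u 1%N.
Proof.
move=> N0; rewrite big_ltn // big1_seq ?addr0 ?mulr1 // => i; rewrite mem_index_iota => /andP[_ /andP[i1 _]].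
by rewrite /dunit gtn_eqF // mulr0.
Qed.

Lemma ln_ratio d N : (0 < d <= N)%N -> ln (N%:R / d%:R) = lnn N - lnn d :> R.
Proof. by move=> /andP[d0 dN]; rewrite ln_div // posrE ltr0n // (leq_trans d0). Qed.

Lemma sum_wt_floor d N : (0 < d <= N)%N ->
  `|\sum_(1 <= k < (N %/ d).+1) wt k * done_fun k - K * (N%:R / d%:R)| <= h * C + K.
Proof.
move=> dN; have := density_flr dens_wt (flr_div R dN); rewrite (gtr0_norm K_gt0).
suff -> : \sum_(1 <= k < (N %/ d).+1) wt k * done_fun k = \sum_(1 <= k < (N %/ d).+1) wt k by [].
by apply: eq_big_nat => k /andP[k0 _]; rewrite /done_fun k0 mulr1.
Qed.

(** * Mertens-type sums of Lambda and mu over the integers satisfying [cop] *)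

Lemma mertens : exists C' : R, forall N, (0 < N)%N ->
  `|\sum_(1 <= n < N.+1) wt n * (mangoldt n / n%:R) - lnn N| <= C'.
Proof.
have [D hD] := ln_density dens_wt.
exists ((12 * (h * C + K) + K + `|D|) / K) => N N0.
have n0 := ltr0n' R N0; have n1 := ler1n' R N0.
have e1 := hD _ _ (flr_nat R N0).
have e2 := @sum_approx R (fun d => wt d * mangoldt d)
  (fun d => \sum_(1 <= k < (N %/ d).+1) wt k * done_fun k) (fun d => K * (N%:R / d%:R))
  (fun=> h * C + K) N (@sum_wt_floor ^~ N).
move: e2; rewrite -conv_wt mangoldt_one.
rewrite [X in `|_ - X|](_ : _ = K * N%:R * \sum_(1 <= n < N.+1) wt n * (mangoldt n / n%:R)); last first.
  by rewrite mulr_sumr; apply: eq_bigr => d _; ring.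
rewrite [X in _ <= X](_ : _ = (\sum_(1 <= d < N.+1) `|wt d * mangoldt d|) * (h * C + K)); last first.
  by rewrite mulr_suml.
set S := \sum_(_ <= _ < _) wt _ * (_ / _); move=> e2.
have e3 : \sum_(1 <= d < N.+1) `|wt d * mangoldt d| <= 12 * N%:R.
  apply: le_trans (chebyshev_psi R N); apply: ler_sum_nat => d _.
  by apply: le_trans (wt_norm _ _) _; rewrite ger0_norm // mangoldt_ge0.
have q0 : 0 <= h * C + K by rewrite addr_ge0 ?mulr_ge0 // ltW.
have e4 := ler_wpM2r q0 e3.
have [z1 zz] := sqrt_facts n1.
have e5 : D * Num.sqrt N%:R <= `|D| * N%:R.
  apply: le_trans (ler_norm _) _; rewrite normrM ler_wpM2l // ger0_norm; nra.
have K0' := K_gt0.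
have KN := mulr_gt0 K0' n0; apply: (norm_scale KN).
have -> : K * N%:R * ((12 * (h * C + K) + K + `|D|) / K) = (12 * (h * C + K) + K + `|D|) * N%:R.
  by field; rewrite gt_eqF.
move: e1 e2; rewrite -/(lnn N) !ler_norml => /andP[? ?] /andP[? ?].
by apply/andP; split; lra.
Qed.

Lemma norm_mu_div d : `|wt d * (mu d / d%:R)| <= d%:R^-1 :> R.
Proof.
apply: le_trans (wt_norm _ _) _; rewrite normrM [`|_^-1|]ger0_norm ?invr_ge0 // ler_piMl ?invr_ge0 //.
exact: mu_norm.
Qed.

(** The convolution of mu and 1 sums to 1, while the density of the inner sums isolates the sum of
    mu d / d. [sum_mu_ln] repeats this with weights 1/n; [sum_mu_ln2] uses that mu convolved with ln
    is Lambda, [mertens] giving its main term. *)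
Lemma sum_mu_div : exists C' : R, forall N, (0 < N)%N ->
  `|\sum_(1 <= d < N.+1) wt d * (mu d / d%:R)| <= C'.
Proof.
exists ((h * C + K + 1) / K) => N N0; have n0 := ltr0n' R N0; have n1 := ler1n' R N0.
have e2 := @sum_approx R (fun d => wt d * mu d)
  (fun d => \sum_(1 <= k < (N %/ d).+1) wt k * done_fun k) (fun d => K * (N%:R / d%:R))
  (fun=> h * C + K) N (@sum_wt_floor ^~ N).
move: e2; rewrite -conv_wt mu_one sum_dunit // wt1.
rewrite [X in `|_ - X|](_ : _ = K * N%:R * \sum_(1 <= n < N.+1) wt n * (mu n / n%:R)); last first.
  by rewrite mulr_sumr; apply: eq_bigr => d _; ring.
rewrite -mulr_suml; set S := \sum_(_ <= _ < _) wt _ * (_ / _); move=> e2.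
have e3 : \sum_(1 <= d < N.+1) `|wt d * mu d| <= N%:R.
  apply: le_trans (_ : \sum_(1 <= d < N.+1) 1 <= _); last by rewrite sumr_const_nat subn1.
  by apply: ler_sum_nat => d _; apply: le_trans (wt_norm _ _) (mu_norm _ _).
have q0 : 0 <= h * C + K by rewrite addr_ge0 ?mulr_ge0 // ltW.
have e4 := ler_wpM2r q0 e3.
have KN := mulr_gt0 K_gt0 n0; apply: (norm_scale KN).
have -> : K * N%:R * ((h * C + K + 1) / K) = (h * C + K + 1) * N%:R by field; rewrite gt_eqF.
move: e2; rewrite !ler_norml => /andP[? ?].
by apply/andP; split; lra.
Qed.

Lemma class_harmonic : exists c : G -> R, exists C' : R, 0 <= C' /\ forall a x j, flr x j ->
  `|\sum_(1 <= n < j.+1) dl a n / n%:R - kap * ln x - c a| <= C' / x.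
Proof.
have /choice [c hc] := fun a => harmonic_density (dens a).
exists c; have [|C' [C'0 hC']] := @fin_bound R G (fun a (C' : R) => forall x j, flr x j ->
  `|\sum_(1 <= n < j.+1) dl a n / n%:R - kap * ln x - c a| <= C' / x) _ hc; last by exists C'.
move=> a D D' DD' H x j xj; apply: le_trans (H x j xj) _; rewrite ler_wpM2r // invr_ge0.
by case/flr_ln: xj; lra.
Qed.

Lemma sum_mu_ln : exists C' : R, forall N, (0 < N)%N ->
  `|\sum_(1 <= d < N.+1) wt d * (mu d / d%:R) * (lnn N - lnn d)| <= C'.
Proof.
have [c [D hD]] := harmonic_density dens_wt; have [E hE] := sum_mu_div.
exists ((1 + `|D| + `|c| * E) / K) => N N0; have n0 := ltr0n' R N0.
have e2 := @sum_approx R (fun d => wt d * (mu d / d%:R))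
  (fun d => \sum_(1 <= k < (N %/ d).+1) wt k * (done_fun k / k%:R))
  (fun d => K * (lnn N - lnn d) + c) (fun d => `|D| * (d%:R / N%:R)) N.
have {e2} := e2 _; rewrite -conv_wt_div mu_one => e2.
have {e2} : `|1 - \sum_(1 <= d < N.+1) wt d * (mu d / d%:R) * (K * (lnn N - lnn d) + c)| <= `|D|.
  have E1 : \sum_(1 <= n < N.+1) wt n * (dunit n / n%:R) = 1.
    by under eq_bigr do rewrite mulrCA mulrC; rewrite sum_dunit // wt1 divr1.
  rewrite E1 in e2; apply: le_trans (e2 _) _.
    move=> d dN; rewrite -ln_ratio // opprD addrA.
    have := hD _ _ (flr_div R dN); rewrite invf_div => H.
    apply: le_trans (le_trans _ H) _.
      rewrite le_eqVlt; apply/orP; left; apply/eqP; congr (`|_ - _ - _|).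
      by apply: eq_big_nat => k /andP[k0 _]; rewrite /done_fun k0 div1r.
    by rewrite ler_wpM2r ?divr_ge0 // ler_norm.
  apply: le_trans (_ : \sum_(1 <= d < N.+1) `|D| / N%:R <= _).
    apply: ler_sum_nat => d /andP[d0 dN]; have d0' := ltr0n' R d0.
    apply: le_trans (ler_wpM2r _ (norm_mu_div d)) _; first by rewrite mulr_ge0 // divr_ge0.
    by rewrite mulrCA mulKf ?gt_eqF.
  by rewrite sumr_const_nat subn1 -[_ *+ _]mulr_natr divfK ?gt_eqF.
under eq_bigr do rewrite mulrDr.
rewrite big_split /= -mulr_suml.
rewrite [X in _ - (X + _)](_ : _ = K * \sum_(1 <= d < N.+1) wt d * (mu d / d%:R) * (lnn N - lnn d)); last first.
  by rewrite mulr_sumr; apply: eq_bigr => d _; ring.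
set S := \sum_(1 <= d < _) _ * _ * _; set S1 := \sum_(_ <= _ < _) _ => e3.
have e4 : `|S1 * c| <= `|c| * E by rewrite normrM mulrC ler_wpM2l // hE.
rewrite ler_pdivlMr // -[K in _ * K]gtr0_norm // -normrM mulrC.
by move: e3 e4; rewrite !ler_norml => /andP[? ?] /andP[? ?]; apply/andP; split; lra.
Qed.

Lemma sum_mu_ln2 : exists C' : R, forall N, (0 < N)%N ->
  `|\sum_(1 <= d < N.+1) wt d * (mu d / d%:R) * (lnn N - lnn d) ^+ 2 - 2 / K * lnn N| <= C'.
Proof.
have [c [D hD]] := lnharmonic_density dens_wt; have [E hE] := sum_mu_div; have [F hF] := mertens.
exists ((F + 2 * `|D| + `|c| * E) / (K / 2)) => N N0; have n0 := ltr0n' R N0; have n1 := ler1n' R N0.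
have [s1 ss] := sqrt_facts n1; set s := Num.sqrt _ in s1 ss.
have s0 : 0 < s by lra.
have e2 := @sum_approx R (fun d => wt d * (mu d / d%:R))
  (fun d => \sum_(1 <= k < (N %/ d).+1) wt k * (lnn k / k%:R))
  (fun d => K / 2 * (lnn N - lnn d) ^+ 2 + c) (fun d => `|D| * (Num.sqrt d%:R / s)) N.
have {e2} := e2 _; rewrite -conv_wt_div -mangoldt_mu => e2.
have {e2} : `|\sum_(1 <= n < N.+1) wt n * (mangoldt n / n%:R) -
    \sum_(1 <= d < N.+1) wt d * (mu d / d%:R) * (K / 2 * (lnn N - lnn d) ^+ 2 + c)| <= 2 * `|D|.
  apply: le_trans (e2 _) _.
    move=> d dN; rewrite -ln_ratio // opprD addrA.
    have := hD _ _ (flr_div R dN); rewrite sqrt_div invf_div => H.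
    by apply: le_trans H _; rewrite ler_wpM2r ?divr_ge0 ?sqrtr_ge0 // ler_norm.
  apply: le_trans (_ : \sum_(1 <= d < N.+1) `|D| / s * (Num.sqrt d%:R)^-1 <= _).
    apply: ler_sum_nat => d /andP[d0 dN].
    apply: le_trans (ler_wpM2r _ (norm_mu_div d)) _; first by rewrite mulr_ge0 // divr_ge0 // sqrtr_ge0.
    have [t1 tt] := sqrt_facts (ler1n' R d0); rewrite -{1}tt; set t := Num.sqrt d%:R in t1 *.
    rewrite le_eqVlt; apply/orP; left; apply/eqP; field; rewrite !gt_eqF //; lra.
  rewrite -mulr_sumr; apply: le_trans (ler_wpM2l _ (sum_inv_sqrt R N)) _; first by rewrite divr_ge0 // ltW.
  by rewrite mulrA [_ * 2]mulrAC divfK ?gt_eqF // mulrC.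
under [X in _ - X]eq_bigr do rewrite mulrDr.
rewrite big_split /= -mulr_suml.
rewrite [X in _ - (X + _)](_ : _ = K / 2 * \sum_(1 <= d < N.+1) wt d * (mu d / d%:R) * (lnn N - lnn d) ^+ 2); last first.
  by rewrite mulr_sumr; apply: eq_bigr => d _; ring.
have := hF N N0; set S0 := \sum_(_ <= _ < _) wt _ * (mangoldt _ / _).
set S := \sum_(1 <= d < _) _ * _ * _; set S1 := \sum_(_ <= _ < _) _ => e1 e3.
have e4 : `|S1 * c| <= `|c| * E by rewrite normrM mulrC ler_wpM2l // hE.
have K2 : 0 < K / 2 by rewrite divr_gt0.
rewrite ler_pdivlMr // -[X in _ * X <= _]gtr0_norm // -normrM mulrBl mulrC.
have -> : 2 / K * lnn N * (K / 2) = lnn N by field; rewrite gt_eqF.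
by move: e1 e3 e4; rewrite !ler_norml => /andP[? ?] /andP[? ?] /andP[? ?]; apply/andP; split; lra.
Qed.


(** * Boundedness of the sums of mu n / n in classes *)

Definition muT a N : R := \sum_(1 <= d < N.+1) dl a d * (mu d / d%:R).
Definition LamP a N : R := \sum_(1 <= d < N.+1) dl a d * (mangoldt d / d%:R).

Lemma gconv_bound (f k : G -> R) E a : (forall b, `|f b| <= E) ->
  `|gconv f k a| <= E * \sum_b `|k b|.
Proof.
move=> h0; apply: le_trans (ler_norm_sum _ _ _) _; rewrite mulr_sumr.
rewrite [X in _ <= X](reindex_inj (h := fun b => (b^-1 * a)%g)) /=; last first.
  by move=> b b' /mulIg /invg_inj.
by apply: ler_sum => b _; rewrite normrM ler_wpM2r.
Qed.

Definition harmonic_constants (c : G -> R) (D : R) := forall a x j, flr x j ->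
  `|\sum_(1 <= n < j.+1) dl a n / n%:R - kap * ln x - c a| <= D / x.

Lemma harmonic_constants_div c D a d N : harmonic_constants c D -> (0 < d <= N)%N ->
  `|\sum_(1 <= k < (N %/ d).+1) dl a k * (done_fun k / k%:R) -
    (kap * (lnn N - lnn d) + c a)| <= D * (d%:R / N%:R).
Proof.
move=> H dN; rewrite -ln_ratio // opprD addrA.
have := H a _ _ (flr_div R dN); rewrite invf_div => {}H; apply: le_trans H.
rewrite le_eqVlt; apply/orP; left; apply/eqP; congr (`|_ - _ - _|).
by apply: eq_big_nat => k /andP[k0 _]; rewrite /done_fun k0 div1r.
Qed.

(** Expanding the inner harmonic sums leaves a multiple of kap that is the same for every class, and
    a group-ring convolution by c that carries all the dependence on a. *)
Lemma conv_harmonic f c D a N : harmonic_constants c D -> 0 <= D -> (0 < N)%N ->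
  `|\sum_(1 <= n < N.+1) dl a n * (dconv f done_fun n / n%:R) -
    (kap * (\sum_(1 <= d < N.+1) wt d * (f d / d%:R) * (lnn N - lnn d)) +
     gconv (fun b => \sum_(1 <= d < N.+1) dl b d * (f d / d%:R)) c a)| <=
  D / N%:R * \sum_(1 <= d < N.+1) `|f d|.
Proof.
move=> H D0 N0; rewrite conv_class_div.
have <- : \sum_(1 <= d < N.+1) wt d * (f d / d%:R) * (kap * (lnn N - lnn d) + c ((cl d)^-1 * a)%g) =
  kap * (\sum_(1 <= d < N.+1) wt d * (f d / d%:R) * (lnn N - lnn d)) +
     gconv (fun b => \sum_(1 <= d < N.+1) dl b d * (f d / d%:R)) c a.
  rewrite /gconv -(sum_by_class (fun d => f d / d%:R) (fun b => c (b^-1 * a)%g)).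
  by rewrite mulr_sumr -big_split; apply: eq_bigr => d _ /=; ring.
apply: le_trans (sum_approx (e := fun d => D * (d%:R / N%:R)) _ _) _.
  by move=> d dN; exact: harmonic_constants_div.
rewrite mulr_sumr; apply: ler_sum_nat => d /andP[d0 dN]; have d0' := ltr0n' R d0.
apply: le_trans (ler_wpM2r _ (wt_norm _ _)) _; first by rewrite mulr_ge0 // divr_ge0.
rewrite normrM (ger0_norm (x := d%:R^-1)) ?invr_ge0 //.
rewrite le_eqVlt; apply/orP; left; apply/eqP; field.
by rewrite !gt_eqF // (ltr0n' R N0).
Qed.

Lemma muT_conv c D : harmonic_constants c D -> 0 <= D ->
  exists E : R, forall a N, (0 < N)%N -> `|gconv (muT ^~ N) c a| <= E.
Proof.
move=> H D0; have [E hE] := sum_mu_ln; exists (1 + kap * E + D) => a N N0.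
have := conv_harmonic mu a H D0 N0; rewrite mu_one.
have -> : \sum_(1 <= n < N.+1) dl a n * (dunit n / n%:R) = dl a 1.
  by under eq_bigr do rewrite mulrCA mulrC; rewrite sum_dunit // divr1.
have e1 : D / N%:R * \sum_(1 <= d < N.+1) `|mu d : R| <= D.
  rewrite mulrAC ler_pdivrMr ?ltr0n // ler_wpM2l //.
  apply: le_trans (_ : \sum_(1 <= d < N.+1) 1 <= _); last by rewrite sumr_const_nat subn1.
  by apply: ler_sum_nat => d _; exact: mu_norm.
move=> /le_trans /(_ e1).
have e2 : `|kap * (\sum_(1 <= d < N.+1) wt d * (mu d / d%:R) * (lnn N - lnn d))| <= kap * E.
  by rewrite normrM (gtr0_norm kap_gt0) ler_wpM2l ?hE // ltW.
have := dl_le1 a 1; have := dl_ge0 a 1; move: e2; rewrite -/(gconv (muT ^~ N) c a).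
by rewrite !ler_norml => /andP[? ?] ? ? /andP[? ?]; apply/andP; split; lra.
Qed.

Lemma LamP_conv c D : harmonic_constants c D -> 0 <= D ->
  exists X : nat -> R, exists E : R, forall a N, (0 < N)%N -> `|gconv (LamP ^~ N) c a - X N| <= E.
Proof.
move=> H D0.
have [||E [E0 hE]] := @fin_bound R G (fun a (E : R) => forall N, (0 < N)%N ->
  `|\sum_(1 <= n < N.+1) dl a n * (lnn n / n%:R) - kap / 2 * lnn N ^+ 2| <= E).
- by move=> a E E' EE' h0 N N0; apply: le_trans (h0 N N0) EE'.
- move=> a; have [c' [E hE]] := lnharmonic_density (dens a).
  exists (`|c'| + `|E|) => N N0; have [s1 _] := sqrt_facts (ler1n' R N0).
  have := hE _ _ (flr_nat R N0); rewrite -/(lnn N).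
  have : E / Num.sqrt N%:R <= `|E|.
    by rewrite ler_pdivrMr; [apply: le_trans (ler_norm _) _; rewrite ler_peMr | lra].
  have := ler_norm c'; have := ler_norm (- c'); rewrite normrN.
  by rewrite !ler_norml => ? ? ? /andP[? ?]; apply/andP; split; lra.
exists (fun N => kap / 2 * lnn N ^+ 2 -
  kap * \sum_(1 <= d < N.+1) wt d * (mangoldt d / d%:R) * (lnn N - lnn d)), (E + 12 * D) => a N N0.
have := conv_harmonic mangoldt a H D0 N0; rewrite mangoldt_one.
have e1 : D / N%:R * \sum_(1 <= d < N.+1) `|mangoldt d : R| <= 12 * D.
  rewrite mulrAC ler_pdivrMr ?ltr0n // -mulrA mulrCA ler_wpM2l //.
  by under eq_bigr do rewrite ger0_norm ?mangoldt_ge0 //; exact: chebyshev_psi.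
move=> /le_trans /(_ e1); have := hE a N N0; rewrite -/(gconv (LamP ^~ N) c a).
by rewrite !ler_norml => /andP[? ?] /andP[? ?]; apply/andP; split; lra.
Qed.

Lemma dconv_mu_lnratio N n : (0 < n)%N ->
  dconv (fun d => mu d * (lnn N - lnn d)) done_fun n = lnn N * dunit n + mangoldt n :> R.
Proof.
move=> n0.
have -> : (fun d => mu d * (lnn N - lnn d)) = (fun d => lnn N * mu d + - dln mu d) :> (nat -> R).
  by apply/funext => d; rewrite /dln; ring.
rewrite dconvDl /= dconvNl dln_mu dconvNl -dconvA mu_one opprK.
congr (_ + _); last by rewrite dconvC dconv1.
by rewrite -mu_one /dconv -dsumZ; apply: eq_dsum => *; rewrite mulrA.
Qed.

(** Lambda plus ln N at n = 1 is the convolution of mu d * ln (N / d) with 1. Against e the inner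
    sums lose the kap ln term, as e has sum 0, and the constants, as c * e = 0; the remaining errors
    D d / N, weighted by ln (N / d) / d, are bounded by [sum_ln_ratio]. *)
Lemma LamP_kernel c D (e : G -> R) : harmonic_constants c D -> 0 <= D ->
  (forall a, gconv c e a = 0) -> \sum_a e a = 0 ->
  exists E : R, forall a N, (0 < N)%N -> `|gconv (LamP ^~ N) e a + lnn N * e a| <= E.
Proof.
move=> H D0 ce e0; exists (D * \sum_b `|e b|) => a N N0.
have N0' := ltr0n' R N0.
pose f d : R := mu d * (lnn N - lnn d).
pose L b := \sum_(1 <= n < N.+1) dl b n * (dconv f done_fun n / n%:R).
have LE b : L b = lnn N * gdelta R b + LamP b N.
  have -> : gdelta R b = dl b 1 / 1%:R by rewrite dl1 divr1.
  rewrite /L /LamP.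
  rewrite -(@sum_dunit (fun n => dl b n / n%:R) N N0) mulr_sumr -big_split.
  by apply: eq_big_nat => n /andP[n0 _]; rewrite /f dconv_mu_lnratio //=; ring.
have -> : gconv (LamP ^~ N) e a + lnn N * e a = gconv L e a.
  rewrite -{2}(gconv_delta mulGC e) (gconvC mulGC e) [in RHS]/gconv mulr_sumr addrC -big_split.
  by apply: eq_bigr => b _; rewrite LE /=; ring.
have -> : gconv L e a = \sum_(1 <= d < N.+1) wt d * (f d / d%:R) *
   gconv (fun b => \sum_(1 <= k < (N %/ d).+1) dl b k * (done_fun k / k%:R)) e ((cl d)^-1 * a)%g.
  rewrite /gconv; under eq_bigr do rewrite /L conv_class_div mulr_suml.
  rewrite exchange_big; apply: eq_bigr => d _ /=; rewrite mulr_sumr.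
  rewrite (reindex_inj (mulgI (cl d))); apply: eq_bigr => b _.
  by rewrite mulKg invMg -mulgA [RHS]mulrA.
apply: le_trans (ler_norm_sum_nat (e := fun d => (lnn N - lnn d) / N%:R * (D * \sum_b `|e b|)) _) _.
  move=> d /andP[d0 dN]; have d0' := ltr0n' R d0.
  have dN' : (0 < d <= N)%N by rewrite d0.
  rewrite normrM.
  have e1 : `|wt d * (f d / d%:R)| <= (lnn N - lnn d) / d%:R.
    apply: le_trans (wt_norm _ _) _; rewrite /f !normrM (ger0_norm (x := _^-1)) ?invr_ge0 //.
    rewrite ler_wpM2r ?invr_ge0 // (ger0_norm (x := _ - _)); last by rewrite subr_ge0 ler_lnn.
    by rewrite ler_piMl ?mu_norm // subr_ge0 ler_lnn.
  apply: le_trans (_ : (lnn N - lnn d) / d%:R * (D * (d%:R / N%:R) * \sum_b `|e b|) <= _); last first.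
    by rewrite le_eqVlt; apply/orP; left; apply/eqP; field; rewrite !gt_eqF.
  apply: ler_pM => //.
  set b := (_ * _)%g; pose F b := \sum_(1 <= k < (N %/ d).+1) dl b k * (done_fun k / k%:R).
  have -> : gconv F e b = gconv (fun b => F b - (kap * (lnn N - lnn d) + c b)) e b.
    rewrite /gconv; under [RHS]eq_bigr do rewrite mulrBl mulrDl.
    rewrite sumrB big_split /= -/(gconv c e b) ce -mulr_sumr.
    by rewrite sum_shift e0 mulr0 addr0 subr0.
  by apply: gconv_bound => b'; exact: harmonic_constants_div.
rewrite -!mulr_suml ler_piMl ?mulr_ge0 ?sumr_ge0 // ler_pdivrMr // mul1r.
exact: sum_ln_ratio.
Qed.

Lemma lnn_unbounded (B : R) : exists2 N, (0 < N)%N & B < lnn N.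
Proof.
exists (Num.bound (expR B)).+1 => //; rewrite -{1}[B]expRK /lnn ltr_ln ?posrE ?expR_gt0 //.
by apply: lt_le_trans (archi_boundP (ltW (expR_gt0 _))) _; rewrite ler_nat.
Qed.

Lemma sum_LamP N : \sum_b LamP b N = \sum_(1 <= n < N.+1) wt n * (mangoldt n / n%:R).
Proof.
rewrite exchange_big; apply: eq_bigr => n _ /=.
by rewrite -sum_dl mulr_suml.
Qed.

Lemma sum_muT N : \sum_b muT b N = \sum_(1 <= n < N.+1) wt n * (mu n / n%:R).
Proof.
rewrite exchange_big; apply: eq_bigr => n _ /=.
by rewrite -sum_dl mulr_suml.
Qed.

(** chi lifts to the integers, with value 0 off [cop]. Its zero sum cancels the densities and bounds
    the partial sums; orthogonality to c cancels the constants, that is, L(1, chi) = 0. *)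
Lemma character_absurd c D (chi : G -> R) : harmonic_constants c D -> 0 <= D ->
  (forall a, chi a = 1 \/ chi a = -1) -> (forall a b, chi (a * b)%g = chi a * chi b) ->
  \sum_a chi a = 0 -> \sum_a c a * chi a = 0 -> False.
Proof.
move=> H D0 chi1 chiM chi0 cchi.
have chiN a : `|chi a| = 1 by have [->|->] := chi1 a; rewrite ?normrN1 ?normr1.
apply: (@real_character_absurd R (fun n => wt n * chi (cl n)) (h * C + h * D)).
- move=> m n; rewrite wtM /wt; case cm: (cop m); rewrite ?mul0r // !mul1r.
  by case cn: (cop n); rewrite ?mul0r ?mulr0 // !mul1r clM.
- move=> n; rewrite /wt; case: (cop n); last by constructor 1; rewrite mul0r.
  by rewrite mul1r; have [|] := chi1 (cl n); [constructor 2|constructor 3].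
- rewrite wt1 mul1r cl1; have := chiM 1%g 1%g; rewrite mulg1.
  by have [|->] := chi1 1%g => //; lra.
- move=> N; under eq_bigr do rewrite -(mulr1 (wt _)) (_ : 1 = (fun=> 1) 0%N) //.
  rewrite sum_by_class.
  have -> : \sum_b (\sum_(1 <= d < N.+1) dl b d * 1) * chi b =
    \sum_b (\sum_(1 <= d < N.+1) dl b d - kap * N%:R) * chi b.
    under [RHS]eq_bigr do rewrite mulrBl.
    rewrite sumrB -mulr_sumr chi0 mulr0 subr0.
    by apply: eq_bigr => b _; under eq_bigr do rewrite mulr1.
  apply: le_trans (ler_norm_sum _ _ _) _.
  apply: le_trans (_ : \sum_(b : G) C <= _); last first.
    by rewrite sumr_const -mulr_natl lerDl mulr_ge0 // ltW.
  by apply: ler_sum => b _; rewrite normrM chiN mulr1.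
- move=> N N0; under eq_bigr do rewrite mulrAC.
  rewrite (sum_by_class (fun n => n%:R^-1)).
  have -> : \sum_b (\sum_(1 <= d < N.+1) dl b d / d%:R) * chi b =
    \sum_b (\sum_(1 <= d < N.+1) dl b d / d%:R - kap * ln N%:R - c b) * chi b.
    under [RHS]eq_bigr do rewrite !mulrBl.
    by rewrite !sumrB -mulr_sumr chi0 mulr0 cchi !subr0.
  apply: le_trans (ler_norm_sum _ _ _) _.
  apply: le_trans (_ : \sum_(b : G) D / N%:R <= _); last first.
    rewrite sumr_const -[_ *+ _]mulr_natl mulrA ler_wpM2r ?invr_ge0 // lerDr.
    by rewrite mulr_ge0 // ltW.
  by apply: ler_sum => b _; rewrite normrM chiN mulr1; exact: H (flr_nat R N0).
Qed.

(* Were the harmonic constants singular in the group ring, the kernel projector would be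
   a real character with vanishing L(1). *)
Lemma muT_bounded : exists E : R, forall a N, (0 < N)%N -> `|muT a N| <= E.
Proof.
have [c [D [D0 H]]] := class_harmonic.
(* The shift gives c1 sum 1 and alters only the component along the trivial character: whatever c1
   annihilates has sum 0, and is annihilated by c as well. *)
pose t := (1 - \sum_a c a) / h; pose c1 a := c a + t.
have sc1 : \sum_a c1 a = 1.
  rewrite big_split /= sumr_const -[t *+ _]mulr_natl -/h /t mulrCA mulfV ?gt_eqF // mulr1.
  by rewrite addrC subrK.
have gc1 (f : G -> R) a : gconv f c1 a = gconv f c a + t * \sum_b f b.
  rewrite /gconv; under eq_bigr do rewrite mulrDr.
  by rewrite big_split /= -mulr_suml [t * _]mulrC.
have [e [k [dE ce er ee]]] := gconv_kernel mulGC c1.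
have e0 : \sum_a e a = 0.
  have := sum_gconv c1 e; rewrite ce sc1 mul1r => <-; by rewrite big1.
have ce' a : gconv c e a = 0.
  have := congr1 (@^~ a) ce; rewrite (gconvC mulGC c1) gc1 e0 mulr0 addr0.
  by rewrite (gconvC mulGC e).
have fE (f : G -> R) (a : G) : f a = gconv f e a + gconv (gconv f c1) k a.
  by rewrite -{1}(gconv_delta mulGC f) dE gconvDr gconvA.
have [E1 hE1] := LamP_kernel H D0 ce' e0.
have [X [E2 hE2]] := LamP_conv H D0.
have [F hF] := mertens.
pose Y N := (X N + t * \sum_b LamP b N) * \sum_b k b.
(* LamP a N = Y N - ln N * e a + O(1) with Y independent of a: [LamP_kernel] gives the part along e,
   and on the rest k inverts c1, where [LamP_conv] applies. *)
have hY a N : (0 < N)%N -> `|LamP a N + lnn N * e a - Y N| <= E1 + E2 * \sum_b `|k b|.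
  move=> N0; rewrite (fE (LamP ^~ N)).
  have -> : Y N = gconv (fun=> X N + t * \sum_b LamP b N) k a.
    rewrite /Y /gconv -mulr_sumr; congr (_ * _).
    rewrite (reindex_inj (h := fun b => (b^-1 * a)%g)) //= => b b'.
    by move=> /mulIg /invg_inj.
  rewrite [X in `|X|](_ : _ = (gconv (LamP ^~ N) e a + lnn N * e a) +
    gconv (fun b => gconv (LamP ^~ N) c b - X N) k a); last first.
    have -> : gconv (fun b => gconv (LamP ^~ N) c b - X N) k a =
       gconv (gconv (LamP ^~ N) c1) k a - gconv (fun=> X N + t * \sum_b LamP b N) k a.
      rewrite /gconv -sumrB; apply: eq_bigr => b _; rewrite -mulrBl; congr (_ * _).
      by have := gc1 (LamP ^~ N) b; rewrite /gconv => ->; rewrite opprD addrACA subrr addr0.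
    ring.
  apply: le_trans (ler_normD _ _) _; apply: lerD; first exact: hE1.
  by apply: gconv_bound => b; exact: hE2.
set B := E1 + E2 * \sum_b `|k b| in hY.
have hY2 N : (0 < N)%N -> `|lnn N - h * Y N| <= F + h * B.
  move=> N0; have s1 : `|\sum_b (LamP b N + lnn N * e b - Y N)| <= h * B.
    apply: le_trans (ler_norm_sum _ _ _) _.
    apply: le_trans (ler_sum _ (fun b _ => hY b N N0)) _.
    by rewrite sumr_const -[_ *+ _]mulr_natl.
  move: s1; rewrite sumrB big_split /= -mulr_sumr e0 mulr0 addr0 sum_LamP sumr_const.
  rewrite -[Y N *+ _]mulr_natl -/h; have := hF N N0.
  by rewrite !ler_norml => /andP[? ?] /andP[? ?]; apply/andP; split; lra.
(* Summing over a gave h Y N = ln N + O(1), so LamP a N = (1/h - e a) ln N + O(1); since LamP is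
   nonnegative, the coefficient cannot be negative. *)
have e_le a : e a <= h^-1.
  rewrite leNgt; apply/negP => lt.
  pose g := e a - h^-1; have g0 : 0 < g by rewrite subr_gt0.
  have [N N0 hN] := lnn_unbounded ((F + 2 * h * B) / (h * g)).
  have hg : 0 < h * g by rewrite mulr_gt0.
  rewrite ltr_pdivrMr // in hN.
  have p0 : 0 <= LamP a N.
    by apply: sumr_ge0 => n _; rewrite mulr_ge0 // divr_ge0 // mangoldt_ge0.
  have := hY a N N0; have := hY2 N N0; rewrite !ler_norml => /andP[l1 _] /andP[_ l2].
  have l3 : h * (LamP a N + lnn N * e a - Y N) <= h * B by rewrite ler_wpM2l // ltW.
  have l4 : 0 <= h * LamP a N by rewrite mulr_ge0 // ltW.
  have l5 : h * (lnn N * e a) = lnn N * (h * g) + lnn N.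
    by rewrite /g; field; rewrite gt_eqF.
  lra.
have e_eq0 a : e a = 0.
  apply/eqP; apply: contraT => ea.
  have [v chiM] := idempotent_is_character er ee e_le (ex_intro _ a ea) (erefl (fun a => h * e a)).
  exfalso; apply: (character_absurd H D0 v chiM); first by rewrite -mulr_sumr e0 mulr0.
  transitivity (h * gconv c e 1%g); last by rewrite ce' mulr0.
  rewrite mulr_sumr; apply: eq_bigr => b _; rewrite mulg1 -[e b^-1%g]/(grev e b) er; ring.
(* Now e = 0, so k inverts c1 and recovers muT from its convolution with c1, which is bounded. *)
have [E3 hE3] := muT_conv H D0; have [E4 hE4] := sum_mu_div.
exists ((E3 + `|t| * E4) * \sum_b `|k b|) => a N N0.
rewrite (fE (muT ^~ N)) {1}/gconv big1 ?add0r; last by move=> b _; rewrite e_eq0 mulr0.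
apply: gconv_bound => b; rewrite gc1; apply: le_trans (ler_normD _ _) _.
apply: lerD; first exact: hE3.
by rewrite normrM ler_wpM2l // sum_muT hE4.
Qed.

(** * Sums of mu in classes are o(N) *)

Definition muM a N : R := \sum_(1 <= n < N.+1) dl a n * mu n.

Let ln2_class : exists E : R, 0 <= E /\ forall a x j, flr x j ->
  `|\sum_(1 <= n < j.+1) dl a n * lnn n ^+ 2 - kap * (x * ln x ^+ 2 - 2 * x * ln x + 2 * x)|
    <= E * Num.sqrt x.
Proof.
apply: fin_bound => [a E E' EE' H x j xj|a]; last exact: ln2_density.
by apply: le_trans (H x j xj) _; rewrite ler_wpM2r // sqrtr_ge0.
Qed.

(** With L = ln (N / d) the inner sums of ln^2 are about kap (N / d) (L^2 - 2 L + 2), whatever the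
    class. [sum_mu_ln2] yields the main term kap N (2/K) ln N, the sums with L and 1 stay
    bounded. *)
Lemma selberg_class : exists E : R, 0 <= E /\ forall a N, (0 < N)%N ->
  `|\sum_(1 <= n < N.+1) dl a n * selberg_fun n - 2 / h * N%:R * lnn N| <= E * N%:R.
Proof.
have [E [E0 hE]] := ln2_class; have [C1 h1] := sum_mu_div.
have [C2 h2] := sum_mu_ln; have [C3 h3] := sum_mu_ln2.
have kg := kap_gt0.
have C1' : 0 <= C1 by apply: le_trans (h1 1%N isT).
have C2' : 0 <= C2 by apply: le_trans (h2 1%N isT).
have C3' : 0 <= C3 by apply: le_trans (h3 1%N isT).
exists (2 * E + kap * (C3 + 2 * C2 + 2 * C1)); split.
  by rewrite addr_ge0 ?mulr_ge0 ?(ltW kg) //; lra.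
move=> a N N0; have N0' := ltr0n' R N0.
rewrite selberg_fun_mu conv_class.
pose S d := \sum_(1 <= k < (N %/ d).+1) dl ((cl d)^-1 * a)%g k * dln lnn k : R.
pose Md d : R := kap * (N%:R / d%:R * ((lnn N - lnn d) ^+ 2 - 2 * (lnn N - lnn d) + 2)).
have e1 := sum_approx (fun d => wt d * mu d) (S := S) (M := Md)
  (e := fun d => E * Num.sqrt (N%:R / d%:R)) (N := N).
have {}e1 : `|\sum_(1 <= d < N.+1) wt d * mu d * S d - \sum_(1 <= d < N.+1) wt d * mu d * Md d| <= 2 * E * N%:R.
  apply: le_trans (e1 _) _.
    move=> d dN; have := hE ((cl d)^-1 * a)%g _ _ (flr_div R dN); rewrite ln_ratio // /S /Md /dln.
    move=> H; apply: le_trans H; rewrite le_eqVlt; apply/orP; left; apply/eqP; congr (`|_ - _|); ring.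
  apply: le_trans (_ : \sum_(1 <= d < N.+1) E * Num.sqrt (N%:R / d%:R) <= _).
    apply: ler_sum_nat => d _; rewrite ler_piMl ?mulr_ge0 ?sqrtr_ge0 //.
    exact: le_trans (wt_norm _ _) (mu_norm _ _).
  by rewrite -mulr_sumr -mulrA mulrCA ler_wpM2l // sum_sqrt_ratio.
have e2 : \sum_(1 <= d < N.+1) wt d * mu d * Md d = kap * N%:R *
  (\sum_(1 <= d < N.+1) wt d * (mu d / d%:R) * (lnn N - lnn d) ^+ 2 -
   2 * (\sum_(1 <= d < N.+1) wt d * (mu d / d%:R) * (lnn N - lnn d)) +
   2 * \sum_(1 <= d < N.+1) wt d * (mu d / d%:R)).
  rewrite !mulr_sumr -sumrB -big_split mulr_sumr; apply: eq_bigr => d _ /=.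
  by rewrite /Md; ring.
have := h1 N N0; have := h2 N N0; have := h3 N N0; move: e1; rewrite e2.
set S1 := \sum_(1 <= d < N.+1) wt d * (mu d / d%:R) * (lnn N - lnn d) ^+ 2.
set S2 := \sum_(1 <= d < N.+1) wt d * (mu d / d%:R) * (lnn N - lnn d).
set S3 := \sum_(1 <= d < N.+1) wt d * (mu d / d%:R).
move=> e1 b3 b2 b1.
have e4 : `|kap * N%:R * (S1 - 2 / K * lnn N - 2 * S2 + 2 * S3)| <= kap * N%:R * (C3 + 2 * C2 + 2 * C1).
  rewrite normrM (gtr0_norm (mulr_gt0 kg N0')) ler_wpM2l ?mulr_ge0 ?(ltW kg) //.
  by move: b1 b2 b3; rewrite !ler_norml => /andP[? ?] /andP[? ?] /andP[? ?]; apply/andP; split; lra.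
have e5 : 2 / h * N%:R * lnn N = kap * N%:R * (2 / K * lnn N).
  by rewrite /K; field; rewrite !gt_eqF.
move: e1 e4; rewrite e5 -/S !ler_norml => /andP[? ?] /andP[? ?]; apply/andP; split; lra.
Qed.

Lemma muM0 a : muM a 0 = 0. Proof. by rewrite /muM big_geq. Qed.

Lemma muMS a n : muM a n.+1 = muM a n + dl a n.+1 * mu n.+1.
Proof. by rewrite /muM big_nat_recr. Qed.

Lemma muM_lip a n : `|muM a n.+1 - muM a n| <= 1.
Proof.
rewrite muMS addrAC subrr add0r normrM -[X in _ <= X]mulr1 ler_pM ?mu_norm //.
by rewrite ger0_norm ?dl_ge0 // dl_le1.
Qed.

Lemma norm_muM_lip a m n : (m <= n)%N -> `|(`|muM a n|) - (`|muM a m|)| <= (n - m)%:R.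
Proof.
move=> mn; rewrite -(subnKC mn) addKn; elim: (n - m)%N => [|i IH].
  by rewrite addn0 subrr normr0.
rewrite addnS -[i.+1%:R]natr1.
have := ler_dist_dist (muM a (m + i).+1) (muM a (m + i)); have := muM_lip a (m + i).
move=> h1 h2; rewrite -(subrK (`|muM a (m + i)%N|) (`|muM a (m + i).+1|)) -addrA.
by apply: le_trans (ler_normD _ _) _; lra.
Qed.

Lemma muM_le a n : `|muM a n| <= n%:R.
Proof.
by have := norm_muM_lip a (leq0n n); rewrite muM0 normr0 subr0 subn0 normr_id.
Qed.

Let err N : R := N%:R * (1 + lnn N).

Let errN N : (0 < N)%N -> N%:R <= err N.
Proof. by move=> N0; rewrite /err ler_peMr // lerDl lnn_ge0. Qed.

(** In [dln_dln_mu] the signed kernel is dominated by [selberg_fun]; replacing ln^2 n by ln^2 N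
    costs at most 2 ln N times the sum of ln (N / n). *)
Lemma muM_ln2_le a N : (0 < N)%N -> `|muM a N| * lnn N ^+ 2 <=
  \sum_b \sum_(1 <= n < N.+1) dl b n * selberg_fun n * `|muM (b^-1 * a)%g (N %/ n)| + 2 * err N.
Proof.
move=> N0; have lN := lnn_ge0 R N.
have e1 : `|\sum_(1 <= n < N.+1) dl a n * dln (dln mu) n| <=
   \sum_b \sum_(1 <= n < N.+1) dl b n * selberg_fun n * `|muM (b^-1 * a)%g (N %/ n)|.
  have -> : dln (dln mu) = dconv (fun n => dconv mangoldt mangoldt n - dln mangoldt n) mu :> (nat -> R).
    by rewrite dln_dln_mu dconvDl dconvNl.
  rewrite conv_class exchange_big /=; apply: ler_norm_sum_nat => d _.
  rewrite -/(muM ((cl d)^-1 * a)%g (N %/ d)).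
  have -> : \sum_(b : G) dl b d * selberg_fun d * `|muM (b^-1 * a)%g (N %/ d)| =
     wt d * (selberg_fun d * `|muM ((cl d)^-1 * a)%g (N %/ d)|).
    rewrite -(sum_class (fun b => selberg_fun d * `|muM (b^-1 * a)%g (N %/ d)|)).
    by apply: eq_bigr => b _; rewrite mulrA.
  rewrite !normrM (ger0_norm (wt_ge0 d)) -mulrA ler_wpM2l ?wt_ge0 //.
  rewrite ler_wpM2r //; apply: le_trans (ler_normB _ _) _.
  rewrite addrC /selberg_fun lerD // ger0_norm ?mulr_ge0 ?mangoldt_ge0 ?lnn_ge0 //.
  by apply: sumr_ge0 => i _; apply: sumr_ge0 => k _; rewrite mulr_ge0 ?mangoldt_ge0.
have e2 : `|muM a N * lnn N ^+ 2 - \sum_(1 <= n < N.+1) dl a n * dln (dln mu) n| <= 2 * err N.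
  rewrite /muM mulr_suml -sumrB.
  apply: le_trans (_ : \sum_(1 <= n < N.+1) 2 * lnn N * (lnn N - lnn n) <= _).
    apply: ler_norm_sum_nat => n /andP[n0 nN]; rewrite /dln.
    have ln1 := lnn_ge0 R n; have ln2 : lnn n <= lnn N :> R by apply: ler_lnn.
    have -> : dl a n * mu n * lnn N ^+ 2 - dl a n * (mu n * lnn n * lnn n) =
      dl a n * mu n * (lnn N ^+ 2 - lnn n ^+ 2) by ring.
    have d0 : 0 <= lnn N ^+ 2 - lnn n ^+ 2 :> R by nra.
    rewrite normrM (ger0_norm d0); apply: le_trans (_ : 1 * (lnn N ^+ 2 - lnn n ^+ 2) <= _); last nra.
    rewrite ler_wpM2r // normrM -[X in _ <= X]mulr1 ler_pM ?mu_norm //.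
    by rewrite ger0_norm ?dl_ge0 // dl_le1.
  rewrite -mulr_sumr; apply: le_trans (ler_wpM2l _ (sum_ln_ratio R N)) _; first by rewrite mulr_ge0.
  rewrite /err; have : 0 <= N%:R :> R by []. nra.
have -> : `|muM a N| * lnn N ^+ 2 = `|muM a N * lnn N ^+ 2|.
  by rewrite normrM [`|lnn N ^+ 2|]ger0_norm // sqr_ge0.
rewrite -(subrK (\sum_(1 <= n < N.+1) dl a n * dln (dln mu) n) (muM a N * _)).
by apply: le_trans (ler_normD _ _) _; rewrite addrC lerD.
Qed.

(** By [selberg_class] the function [selberg_fun] in a class and 2/h ln n have the same sums up to
    O(n), and |muM c (N %/ n)| varies no faster than N %/ n itself; summation by parts compares the
    two averages. *)
Lemma selberg_average : exists E : R, 0 <= E /\ forall b c N, (0 < N)%N ->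
  \sum_(1 <= n < N.+1) dl b n * selberg_fun n * `|muM c (N %/ n)| <=
  2 / h * \sum_(1 <= n < N.+1) lnn n * `|muM c (N %/ n)| + E * err N.
Proof.
have [E [E0 hE]] := selberg_class.
exists (2 * (E + 2 / h)); split; first by rewrite mulr_ge0 // addr_ge0 // divr_ge0 // ltW.
move=> b c N N0; set B := E + 2 / h.
have B0 : 0 <= B by rewrite addr_ge0 // divr_ge0 // ltW.
pose f j := `|muM c j|; pose a n := dl b n * selberg_fun n - 2 / h * lnn n.
have ra n : `|\sum_(1 <= m < n.+1) a m| <= B * n%:R.
  case: n => [|n]; first by rewrite big_geq // normr0 mulr0.
  rewrite sumrB -mulr_sumr.
  have := hE b n.+1 isT; have := sum_lnn_ge R n.+1; have := sum_lnn_le R n.+1.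
  set T := \sum_(_ <= _ < _) lnn _ => t1 t2.
  have h2 : 0 <= 2 / h by rewrite divr_ge0 // ltW.
  have := ler_wpM2l h2 t1; have := ler_wpM2l h2 t2; rewrite /B.
  by rewrite !ler_norml => ? ? /andP[? ?]; apply/andP; split; lra.
have -> : \sum_(1 <= n < N.+1) dl b n * selberg_fun n * `|muM c (N %/ n)| =
  2 / h * (\sum_(1 <= n < N.+1) lnn n * `|muM c (N %/ n)|) + \sum_(1 <= n < N.+1) a n * f (N %/ n)%N.
  by rewrite mulr_sumr -big_split; apply: eq_bigr => n _ /=; rewrite /a /f; ring.
rewrite lerD2l; apply: le_trans (ler_norm _) _; rewrite (abel a (fun n => f (N %/ n)%N)).
apply: le_trans (ler_normD _ _) _.
have e1 : `|(\sum_(1 <= n < N.+1) a n) * f (N %/ N)%N| <= B * N%:R.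
  rewrite normrM -[X in _ <= X]mulr1 ler_pM // divnn N0 ger0_norm ?normr_ge0 //.
  by apply: le_trans (muM_le c 1) _.
pose g n : R := (N %/ n)%:R.
have e2 : `|\sum_(1 <= n < N) (\sum_(1 <= m < n.+1) a m) * (f (N %/ n)%N - f (N %/ n.+1)%N)| <=
   B * \sum_(1 <= n < N) n%:R * (g n - g n.+1).
  rewrite mulr_sumr; apply: ler_norm_sum_nat => n /andP[n0 _]; rewrite normrM mulrA ler_pM //.
  have le : (N %/ n.+1 <= N %/ n)%N by rewrite leq_div2l.
  by rewrite /g -natrB // norm_muM_lip.
have e3 : \sum_(1 <= n < N) n%:R * (g n - g n.+1) = \sum_(1 <= n < N.+1) g n - N%:R * g N.
  have := abel (fun=> 1) g N; under eq_bigr do rewrite mul1r.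
  move=> ->; rewrite sumr_const_nat subn1 /= addrAC subrr add0r.
  by apply: eq_bigr => n _; rewrite sumr_const_nat subn1.
have e4 : \sum_(1 <= n < N.+1) g n <= err N.
  apply: le_trans (_ : \sum_(1 <= n < N.+1) N%:R * n%:R^-1 <= _).
    apply: ler_sum_nat => n /andP[n0 nN]; have nN' : (0 < n <= N)%N by rewrite n0.
    by have [] := flr_ln (flr_div R nN').
  by rewrite -mulr_sumr ler_wpM2l // sum_inv.
have e5 : 0 <= N%:R * g N by rewrite mulr_ge0.
have e6 : B * \sum_(1 <= n < N) n%:R * (g n - g n.+1) <= B * err N by rewrite ler_wpM2l // e3; lra.
have := ler_wpM2l B0 (errN N0); lra.
Qed.

Lemma muM_ln2_logavg : exists E : R, 0 <= E /\ forall a N, (0 < N)%N ->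
  `|muM a N| * lnn N ^+ 2 <=
  2 / h * N%:R * \sum_b (\sum_(1 <= j < N) logavg (fun k => `|muM b k|) j / j%:R) + E * err N.
Proof.
have [E1 [E10 h1]] := selberg_average.
have [||E2 [E20 h2]] := @fin_bound R G (fun b (E : R) => forall N, (0 < N)%N ->
  \sum_(1 <= n < N.+1) lnn n * `|muM b (N %/ n)| <=
  N%:R * (\sum_(1 <= j < N) logavg (fun k => `|muM b k|) j / j%:R) + E * err N).
- move=> b E E' EE' H N N0; apply: le_trans (H N N0) _; rewrite lerD2l ler_wpM2r //.
  by rewrite mulr_ge0 // addr_ge0 // lnn_ge0.
- move=> b; have [||E [_ hE]] := @sum_ln_floor_le R (fun k => `|muM b k|) (fun k => normr_ge0 _).
  + by move=> n; have := norm_muM_lip b (leqnSn n); rewrite subSnn.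
  + by rewrite muM0 normr0.
  by exists E => N N0; have := hE N N0; rewrite /err mulrA.
exists (h * (2 / h * E2 + E1) + 2); split.
  by rewrite addr_ge0 // mulr_ge0 ?(ltW h_gt0) // addr_ge0 // mulr_ge0 // divr_ge0 // ltW.
move=> a N N0; apply: le_trans (muM_ln2_le a N0) _.
rewrite [X in _ <= _ + X]mulrDl addrA lerD2r.
have h2' : 0 <= 2 / h by rewrite divr_ge0 // ltW.
pose X b := \sum_(1 <= j < N) logavg (fun k => `|muM b k|) j / j%:R.
apply: le_trans (_ : \sum_b (2 / h * N%:R * X (b^-1 * a)%g + (2 / h * E2 + E1) * err N) <= _).
  apply: ler_sum => b _; apply: le_trans (h1 b (b^-1 * a)%g N N0) _.
  have := ler_wpM2l h2' (h2 (b^-1 * a)%g N N0); rewrite -/(X _); lra.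
rewrite big_split /= -mulr_sumr sum_shift sumr_const -[X in _ + X <= _]mulr_natl -/h.
by rewrite [h * _]mulrA.
Qed.

(** Summation by parts from [muT_bounded]; the boundary term |muM a j| / j is at most 1. *)
Lemma muM_avg : exists B : R, 0 <= B /\ forall a j, `|\sum_(1 <= k < j) muM a k / (k%:R * k.+1%:R)| <= B.
Proof.
have [E hE] := muT_bounded; have E0 : 0 <= E by apply: le_trans (hE 1%g 1%N isT).
exists (E + 1); split => [|a j]; first lra.
case: j => [|j]; first by rewrite big_geq // normr0; lra.
have := abel (fun n => dl a n * mu n) (fun n => n%:R^-1) j.+1.
have -> : \sum_(1 <= n < j.+2) dl a n * mu n / n%:R = muT a j.+1.
  by apply: eq_bigr => n _; rewrite mulrA.
rewrite -/(muM a j.+1).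
have -> : \sum_(1 <= n < j.+1) (\sum_(1 <= m < n.+1) dl a m * mu m) * (n%:R^-1 - n.+1%:R^-1) =
   \sum_(1 <= k < j.+1) muM a k / (k%:R * k.+1%:R).
  by apply: eq_big_nat => n /andP[n0 _]; rewrite inv_diffE.
move=> e; have e1 : `|muM a j.+1 / j.+1%:R| <= 1.
  by rewrite normrM (ger0_norm (x := _^-1)) // ler_pdivrMr ?ltr0n // mul1r muM_le.
set x := _ / _ in e e1; have := hE a j.+1 isT; move: e1; rewrite e !ler_norml => /andP[? ?] /andP[? ?].
by apply/andP; split; lra.
Qed.

Let good (al : R) := exists C' : R, 0 <= C' /\ forall a N, `|muM a N| <= al * N%:R + C'.

(** With logavg at most (al - ka) ln j + F, the sum of ln j / j gives ln^2 N / 2, and the factor 2/h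
    over h classes returns exactly al - ka. Giving back ka/2 absorbs the terms of order ln N once N
    > N1; smaller N go into the constant. *)
Let good_step be : 0 < be -> be <= 1 -> exists ka : R, 0 < ka /\
  forall al, be <= al -> good al -> good (al - ka / 2).
Proof.
move=> be0 be1; have [B [B0 hB]] := muM_avg; have [E [E0 hE]] := muM_ln2_logavg.
have [D hD] := sum_lnn_div R.
have [ka [ka0 [kab hka]]] := logavg_contraction be0 be1 B0.
exists ka; split => // al bal [C' [C'0 hC']].
have [||F [F0 hF]] := @fin_bound R G (fun b (F : R) => forall j, (0 < j)%N ->
  logavg (fun k => `|muM b k|) j <= (al - ka) * lnn j + F).
- by move=> b F F' FF' H j j0; apply: le_trans (H j j0) _; rewrite lerD2l.
- move=> b; have [F [_ hF]] := hka (muM b) al C' (muM_lip b) (hC' b) (hB b) bal C'0.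
  by exists F.
have ak : 0 <= al - ka by lra.
pose Z := 2 * (al - ka) * `|D| + 2 * F + E.
have Z0 : 0 <= Z by rewrite /Z !addr_ge0 ?mulr_ge0.
have main a N : (0 < N)%N -> `|muM a N| * lnn N ^+ 2 <= N%:R * ((al - ka) * lnn N ^+ 2 + Z * (1 + lnn N)).
  move=> N0; apply: le_trans (hE a N N0) _; have lN := lnn_ge0 R N.
  have e1 b : \sum_(1 <= j < N) logavg (fun k => `|muM b k|) j / j%:R <=
     (al - ka) * (lnn N ^+ 2 / 2 + `|D|) + F * (1 + lnn N).
    apply: le_trans (_ : \sum_(1 <= j < N.+1) ((al - ka) * (lnn j / j%:R) + F * j%:R^-1) <= _).
      rewrite [X in _ <= X]big_nat_recr //= ler_wpDr //.
        by rewrite addr_ge0 // mulr_ge0 // divr_ge0 // lnn_ge0.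
      apply: ler_sum_nat => j /andP[j0 _]; rewrite mulrA -mulrDl ler_wpM2r ?invr_ge0 //.
      exact: hF.
    rewrite big_split /= -!mulr_sumr lerD // ler_wpM2l ?sum_inv //.
    by apply: le_trans (hD N N0) _; rewrite lerD2l ler_norm.
  have e2 : \sum_b (\sum_(1 <= j < N) logavg (fun k => `|muM b k|) j / j%:R) <=
     h * ((al - ka) * (lnn N ^+ 2 / 2 + `|D|) + F * (1 + lnn N)).
    apply: le_trans (ler_sum _ (fun b _ => e1 b)) _.
    by rewrite sumr_const -[_ *+ _]mulr_natl.
  have h2 : 0 <= 2 / h * N%:R by rewrite mulr_ge0 // divr_ge0 // ltW.
  apply: le_trans (lerD (ler_wpM2l h2 e2) (lexx _)) _.
  have -> : 2 / h * N%:R * (h * ((al - ka) * (lnn N ^+ 2 / 2 + `|D|) + F * (1 + lnn N))) =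
    N%:R * ((al - ka) * lnn N ^+ 2 + 2 * (al - ka) * `|D| + 2 * F * (1 + lnn N)).
    by field; rewrite gt_eqF.
  have -> : E * err N = N%:R * (E * (1 + lnn N)) by rewrite /err; ring.
  rewrite -mulrDr ler_wpM2l // /Z.
  have : 0 <= 2 * (al - ka) * `|D| * lnn N by rewrite !mulr_ge0.
  lra.
have [N1 N10 hN1] := lnn_unbounded (2 + 4 * Z / ka).
exists N1%:R; split => // a N.
case: (leqP N N1) => NN.
  have n0 : 0 <= (al - ka / 2) * N%:R by rewrite mulr_ge0 //; lra.
  apply: le_trans (muM_le a N) _; have : N%:R <= N1%:R :> R by rewrite ler_nat.
  lra.
have N0 : (0 < N)%N by apply: leq_trans N10 (ltnW NN).
have l1 : lnn N1 <= lnn N :> R by apply: ler_lnn => //; exact: ltnW.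
have z0 : 0 <= Z / ka by rewrite divr_ge0 // ltW.
have lN : 2 + 4 * Z / ka < lnn N by apply: lt_le_trans l1.
have l0 : 0 < lnn N ^+ 2 :> R by rewrite exprn_gt0 //; lra.
apply: ler_wpDr => //; rewrite -(ler_pM2r l0); apply: le_trans (main a N N0) _.
rewrite [X in _ <= X](_ : _ = N%:R * ((al - ka / 2) * lnn N ^+ 2)); last by ring.
rewrite ler_wpM2l //.
have zk : Z * (1 + lnn N) <= ka / 2 * lnn N ^+ 2.
  have zE : Z = ka * (Z / ka) by field; rewrite gt_eqF.
  rewrite [X in _ <= X](_ : _ = ka * (lnn N ^+ 2 / 2)); last by ring.
  rewrite {1}zE -mulrA ler_wpM2l ?(ltW ka0) //.
  have {}lN : 2 + 4 * (Z / ka) < lnn N by rewrite mulrA.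
  set w := Z / ka in z0 lN *; set L := lnn N in lN *.
  have : 4 * w * L <= L * L by rewrite ler_wpM2r //; lra.
  have : w * 1 <= w * L by rewrite ler_wpM2l //; lra.
  rewrite expr2; lra.
lra.
Qed.

(* Iterating the contraction step would otherwise drive the constant below any bound. *)
Lemma muM_small eps : 0 < eps -> exists C' : R, 0 <= C' /\ forall a N, `|muM a N| <= eps * N%:R + C'.
Proof.
move=> eps0; apply: contrapT => H.
have mono (al be : R) : al <= be -> good al -> good be.
  move=> ab [C' [C'0 hC]]; exists C'; split => // a N.
  by apply: le_trans (hC a N) _; rewrite lerD2r ler_wpM2r.
have Hal al : good al -> eps < al.
  by move=> g; rewrite ltNge; apply/negP => le; exact: H (mono _ _ le g).
have g1 : good 1 by exists 0; split => // a N; rewrite mul1r addr0 muM_le.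
have [ka [ka0 step]] := good_step eps0 (ltW (Hal 1 g1)).
have all i : good (1 - i%:R * (ka / 2)).
  elim: i => [|i IH]; first by rewrite mul0r subr0.
  rewrite -[i.+1%:R]natr1 mulrDl mul1r opprD addrA; apply: step => //.
  exact/ltW/Hal.
have k2 : 0 < ka / 2 by rewrite divr_gt0.
have := Hal _ (all (Num.bound (ka / 2)^-1)).
have : (ka / 2)^-1 < (Num.bound (ka / 2)^-1)%:R by apply: archi_boundP; rewrite invr_ge0 ltW.
rewrite -(ltr_pM2r k2) mulVf ?gt_eqF //; lra.
Qed.

(** * From mu to Lambda, primes and almost primes in classes *)

Definition Dl a n : R := dl a n - wt n / h.

Lemma Dl_norm a n : `|Dl a n| <= 1.
Proof.
have h1 : 1 <= h by rewrite ler1n; apply/card_gt0P; exists 1%g.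
have w0 := wt_ge0 n; have w1 := wt_le1 n; have d0 := dl_ge0 a n; have d1 := dl_le1 a n.
have q0 : 0 <= wt n / h by rewrite divr_ge0 // ltW.
have q1 : wt n / h <= 1 by rewrite ler_pdivrMr; lra.
by rewrite /Dl ler_norml; apply/andP; split; lra.
Qed.

Lemma Dl_mul a d k : Dl a (d * k) = wt d * Dl ((cl d)^-1 * a)%g k.
Proof. by rewrite /Dl dl_mul wtM; ring. Qed.

(** Subtracting the average over the classes cancels the main term kap N. *)
Lemma Dl_sum a N : `|\sum_(1 <= n < N.+1) Dl a n| <= 2 * C.
Proof.
have h0 := h_gt0; rewrite sumrB -mulr_suml.
have -> : \sum_(1 <= n < N.+1) dl a n - (\sum_(1 <= n < N.+1) wt n) / h =
  (\sum_(1 <= n < N.+1) dl a n - kap * N%:R) - (\sum_(1 <= n < N.+1) wt n - K * N%:R) / h.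
  by rewrite /K; field; rewrite gt_eqF.
apply: le_trans (ler_normB _ _) _; rewrite mulr_natl mulr2n; apply: lerD; first exact: dens.
by rewrite normrM normfV (gtr0_norm h0) ler_pdivrMr // [C * _]mulrC dens_wt.
Qed.

Lemma Dl_lnn a N : `|\sum_(1 <= n < N.+1) Dl a n * lnn n| <= 4 * C * lnn N.
Proof.
have -> : 4 * C = 2 * (2 * C) by ring.
apply: abel_nondecreasing => [|n|n|n n0]; rewrite ?mulr_ge0 ?lnn_ge0 //; first exact: Dl_sum.
by rewrite ler_lnn.
Qed.

Lemma Dl_lnn_tail a Q M : `|\sum_(1 <= n < M.+1) ((Q < n)%N)%:R * (Dl a n * lnn n)| <=
  ((Q < M)%N)%:R * (8 * C * lnn M).
Proof.
rewrite sum_tail; case: (ltnP Q M) => QM; last by rewrite subrr normr0 mul0r.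
rewrite mul1r; apply: le_trans (ler_normB _ _) _.
have := Dl_lnn a M; have := Dl_lnn a Q.
have : 4 * C * lnn Q <= 4 * C * lnn M.
  case: Q QM => [|Q] QM; first by rewrite /lnn ln0 // mulr0 !mulr_ge0 // lnn_ge0.
  by rewrite ler_wpM2l ?mulr_ge0 // ler_lnn // ltnW.
lra.
Qed.

Lemma muD_small eps : 0 < eps -> exists C' : R, 0 <= C' /\
  forall a N, `|\sum_(1 <= n < N.+1) mu n * Dl a n| <= eps * N%:R + C'.
Proof.
move=> e0; have e2 : 0 < eps / 2 by rewrite divr_gt0.
have [C1 [C10 hC]] := muM_small e2; exists (2 * C1); split => [|a N]; first lra.
have h0 := h_gt0.
have -> : \sum_(1 <= n < N.+1) mu n * Dl a n = muM a N - (\sum_b muM b N) / h.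
  rewrite [\sum_b _]exchange_big /= mulr_suml -sumrB; apply: eq_bigr => n _.
  by rewrite -mulr_suml sum_dl /Dl; ring.
have s : `|(\sum_b muM b N) / h| <= eps / 2 * N%:R + C1.
  rewrite normrM normfV (gtr0_norm h0) ler_pdivrMr //.
  apply: le_trans (ler_norm_sum _ _ _) _.
  apply: le_trans (ler_sum _ (fun b _ => hC b N)) _.
  by rewrite sumr_const -[X in X <= _]mulr_natr.
apply: le_trans (ler_normB _ _) _; have := hC a N; lra.
Qed.

(** Stopping at N/Q saves a factor of order Q / ln Q over [sum_ln_ratio], which makes the part k > Q
    of the hyperbola method small. *)
Lemma sum_ln_ratio_le Q N : (0 < Q)%N ->
  \sum_(1 <= d < (N %/ Q).+1) (lnn N - lnn d) <= (N %/ Q)%:R * (1 + lnn (2 * Q)) :> R.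
Proof.
move=> Q0; have [M0|M0] := posnP (N %/ Q); first by rewrite M0 big_geq // mul0r.
have l : lnn N <= lnn (N %/ Q) + lnn (2 * Q) :> R.
  rewrite -lnnM ?muln_gt0 //; apply: ler_lnn.
    by move: M0; rewrite divn_gt0 //; exact: leq_trans.
  have := ltn_ceil N Q0; nia.
set M := (N %/ Q)%N in M0 l *; have s := sum_ln_ratio R M.
have -> : \sum_(1 <= d < M.+1) (lnn N - lnn d) =
  M%:R * (lnn N - lnn M) + \sum_(1 <= d < M.+1) (lnn M - lnn d) :> R.
  rewrite !sumrB !sumr_const_nat subn1 /= -(mulr_natl (lnn N) M) -(mulr_natl (lnn M) M); ring.
have : M%:R * (lnn N - lnn M) <= M%:R * lnn (2 * Q) :> R by rewrite ler_wpM2l //; lra.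
lra.
Qed.

(* Hyperbola method for Lambda = mu * ln: for k <= Q the sum over d is a sum of mu in
   classes, for k > Q partial summation in k applies and d runs only up to N / Q. *)
Lemma Dl_mangoldt eps : 0 < eps -> exists C' : R, 0 <= C' /\
  forall a N, `|\sum_(1 <= n < N.+1) Dl a n * mangoldt n| <= eps * N%:R + C'.
Proof.
move=> e0; have C0 := C_ge0.
(* The part with k > Q will be at most 8 C * 3 eta N, which must stay below eps/2 N; the + 1 covers
   C = 0. *)
pose eta := eps / (48 * C + 1); have eta0 : 0 < eta by rewrite divr_gt0 //; lra.
have [C1 [C10 hC1]] := lnn_small eta0.
pose Q := (Num.bound ((1 + C1) / eta)).+1; have Q0 : (0 < Q)%N by [].
have hQ : 1 + lnn (2 * Q) <= 3 * eta * Q%:R.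
  have : (1 + C1) / eta <= Q%:R.
    have b0 : 0 <= (1 + C1) / eta by rewrite divr_ge0 ?(ltW eta0) //; lra.
    by apply: le_trans (ltW (archi_boundP b0)) _; rewrite ler_nat.
  rewrite ler_pdivrMr // => q1; have := hC1 (2 * Q)%N; rewrite natrM; lra.
pose L := Q%:R * lnn Q + 1 : R; have L1 : 1 <= L by rewrite lerDr mulr_ge0 // lnn_ge0.
have d0 : 0 < eps / (2 * L) by rewrite divr_gt0 // mulr_gt0 //; lra.
have [C2 [C20 hC2]] := muD_small d0.
exists (L * C2); split => [|a N]; first by rewrite mulr_ge0 //; lra.
pose X d k := mu d * lnn k * Dl a (d * k).
have -> : \sum_(1 <= n < N.+1) Dl a n * mangoldt n =
  \sum_(1 <= d < N.+1) \sum_(1 <= k < (N %/ d).+1) ((k <= Q)%N)%:R * X d k +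
  \sum_(1 <= d < N.+1) \sum_(1 <= k < (N %/ d).+1) ((Q < k)%N)%:R * X d k.
  rewrite -big_split mangoldt_mu; under [LHS]eq_bigr do rewrite mulrC dsum_mulr.
  rewrite sum_dsum; apply: eq_bigr => d _ /=; rewrite -big_split; apply: eq_bigr => k _ /=.
  by rewrite -/(X d k); case: (leqP k Q) => _; rewrite mul1r mul0r ?addr0 ?add0r.
apply: le_trans (ler_normD _ _) _.
have p1 : `|\sum_(1 <= d < N.+1) \sum_(1 <= k < (N %/ d).+1) ((k <= Q)%N)%:R * X d k| <=
   eps / 2 * N%:R + L * C2.
  rewrite sum_floor_swap.
  apply: le_trans (_ : \sum_(1 <= k < N.+1) ((k <= Q)%N)%:R *
     (lnn Q * (eps / (2 * L) * N%:R + C2)) <= _).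
    apply: ler_norm_sum_nat => k /andP[k0 kN].
    rewrite -mulr_sumr normrM (ger0_norm (ler0n _ _)).
    case: (leqP k Q) => kQ; last by rewrite !mul0r.
    rewrite !mul1r.
    have -> : \sum_(1 <= d < (N %/ k).+1) X d k =
      lnn k * (wt k * \sum_(1 <= d < (N %/ k).+1) mu d * Dl ((cl k)^-1 * a)%g d).
      rewrite !mulr_sumr; apply: eq_bigr => d _.
      by rewrite /X mulnC Dl_mul; ring.
    rewrite normrM (ger0_norm (lnn_ge0 _ _)) ler_pM ?lnn_ge0 ?ler_lnn //.
    apply: le_trans (wt_norm _ _) _; apply: le_trans (hC2 _ _) _.
    by rewrite lerD2r ler_wpM2l ?(ltW d0) // ler_nat leq_div.
  rewrite -mulr_suml sum_leq_nat.
  have b1 : 0 <= eps / (2 * L) * N%:R + C2 by rewrite addr_ge0 // mulr_ge0 // ltW.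
  apply: le_trans (_ : Q%:R * (lnn Q * (eps / (2 * L) * N%:R + C2)) <= _).
    by rewrite ler_wpM2r ?mulr_ge0 ?lnn_ge0 // ler_nat geq_minr.
  rewrite mulrA; apply: le_trans (_ : L * (eps / (2 * L) * N%:R + C2) <= _).
    by rewrite ler_wpM2r // /L lerDl.
  have -> : L * (eps / (2 * L) * N%:R + C2) = eps / 2 * N%:R + L * C2.
    by field; rewrite gt_eqF //; lra.
  by [].
have p2 : `|\sum_(1 <= d < N.+1) \sum_(1 <= k < (N %/ d).+1) ((Q < k)%N)%:R * X d k| <=
   eps / 2 * N%:R.
  have MN : (N %/ Q <= N)%N by rewrite leq_div.
  apply: le_trans (_ : \sum_(1 <= d < N.+1) ((d <= N %/ Q)%N)%:R * (8 * C * (lnn N - lnn d)) <= _).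
    apply: ler_norm_sum_nat => d /andP[d0' dN].
    have -> : \sum_(1 <= k < (N %/ d).+1) ((Q < k)%N)%:R * X d k =
      mu d * (wt d * \sum_(1 <= k < (N %/ d).+1) ((Q < k)%N)%:R * (Dl ((cl d)^-1 * a)%g k * lnn k)).
      by rewrite !mulr_sumr; apply: eq_bigr => k _; rewrite /X Dl_mul; ring.
    rewrite normrM; apply: le_trans (_ : 1 * (((Q < N %/ d)%N)%:R * (8 * C * lnn (N %/ d))) <= _).
      by rewrite ler_pM ?mu_norm //; apply: le_trans (wt_norm _ _) _; exact: Dl_lnn_tail.
    rewrite mul1r; case: (ltnP Q (N %/ d)) => Qd; last first.
      by rewrite mul0r !mulr_ge0 // subr_ge0 ler_lnn.
    have -> : (d <= N %/ Q)%N by rewrite leq_divRL // mulnC -leq_divRL // ltnW.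
    rewrite !mul1r ler_wpM2l ?mulr_ge0 // lerBrDr -lnnM //; last by apply: leq_trans Qd.
    apply: ler_lnn; rewrite ?leq_trunc_div // muln_gt0 d0' andbT; exact: leq_trans Qd.
  rewrite (@big_cat_nat _ _ _ (N %/ Q).+1) //= [X in _ + X]big1_seq ?addr0; last first.
    move=> d; rewrite mem_index_iota => /andP[_ /andP[d1 _]].
    by rewrite leqNgt d1 mul0r.
  apply: le_trans (_ : 8 * C * \sum_(1 <= d < (N %/ Q).+1) (lnn N - lnn d) <= _).
    by rewrite mulr_sumr; apply: ler_sum_nat => d /andP[_ dM]; rewrite -ltnS dM mul1r.
  have s1 := sum_ln_ratio_le N Q0.
  have s2 : (N %/ Q)%:R * (1 + lnn (2 * Q)) <= 3 * eta * N%:R.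
    have t3 : 0 <= 3 * eta by lra.
    apply: le_trans (ler_wpM2l (ler0n _ _) hQ) _; rewrite mulrCA ler_wpM2l //.
    by rewrite -natrM ler_nat leq_trunc_div.
  have C8 : 0 <= 8 * C by lra.
  have s3 := ler_wpM2l C8 (le_trans s1 s2); apply: le_trans s3 _.
  rewrite mulrA ler_wpM2r // /eta.
  have -> : 8 * C * (3 * (eps / (48 * C + 1))) = eps / 2 * (48 * C / (48 * C + 1)) by field; rewrite gt_eqF //; lra.
  rewrite ler_piMr ?divr_ge0 ?(ltW e0) // ler_pdivrMr; lra.
lra.
Qed.

Lemma Dl_prime_ln eps : 0 < eps -> exists C' : R, 0 <= C' /\
  forall a N, `|\sum_(1 <= n < N.+1) Dl a n * (ip R n * lnn n)| <= eps * N%:R + C'.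
Proof.
move=> e0; have e2 : 0 < eps / 2 by rewrite divr_gt0.
have [C1 [C10 h1]] := Dl_mangoldt e2; have [C2 [C20 h2]] := psi_theta_small e2.
exists (C1 + C2); split => [|a N]; first lra.
have -> : \sum_(1 <= n < N.+1) Dl a n * (ip R n * lnn n) =
  \sum_(1 <= n < N.+1) Dl a n * mangoldt n - \sum_(1 <= n < N.+1) Dl a n * (mangoldt n - ip R n * lnn n).
  by rewrite -sumrB; apply: eq_bigr => n _; ring.
apply: le_trans (ler_normB _ _) _.
have : `|\sum_(1 <= n < N.+1) Dl a n * (mangoldt n - ip R n * lnn n)| <= psi R N - theta R N.
  rewrite /psi /theta -sumrB; apply: ler_norm_sum_nat => n _.
  have q0 : 0 <= mangoldt n - ip R n * lnn n by rewrite subr_ge0; exact: prime_le_mangoldt.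
  by rewrite normrM (ger0_norm q0) ler_piMl ?Dl_norm.
have := h1 a N; have := h2 N; lra.
Qed.

(** ln n is traded for the constant ln N at a cost o(N), by [sum_prime_ln_ratio_small]; the
    Chebyshev bound c N <= ppi N ln N then turns o(N) into o(ppi N ln N). *)
Lemma prime_class_small eps : 0 < eps -> exists C' : R, 0 <= C' /\
  forall a N, `|\sum_(1 <= n < N.+1) ip R n * Dl a n| <= eps * ppi R N + C'.
Proof.
move=> e0; have [c [c0 [N0 N02 hc]]] := ppi_lower R.
pose del := c * eps / 4; have d0 : 0 < del by rewrite divr_gt0 // mulr_gt0.
have [C1 [C10 h1]] := Dl_prime_ln d0; have [C2 [C20 h2]] := sum_prime_ln_ratio_small d0.
pose N1 := maxn N0 (Num.bound ((C1 + C2) / (2 * del))).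
exists N1%:R; split => // a N.
have triv : `|\sum_(1 <= n < N.+1) ip R n * Dl a n| <= N%:R.
  apply: le_trans (ppi_le R N); apply: ler_norm_sum_nat => n _.
  by rewrite normrM ger0_norm // ler_piMr // Dl_norm.
case: (leqP N1 N) => NN; last first.
  apply: le_trans triv _; apply: ler_wpDl; first by rewrite mulr_ge0 ?ppi_ge0 // ltW.
  by rewrite ler_nat ltnW.
apply: ler_wpDr => //.
have N0N : (N0 <= N)%N by apply: leq_trans NN; rewrite leq_maxl.
have l0 : 0 < lnn N :> R by rewrite /lnn ln_gt0 // ltr1n; exact: leq_trans N02 N0N.
have hN : C1 + C2 <= 2 * del * N%:R.
  rewrite mulrC -ler_pdivrMr ?mulr_gt0 //.
  have b0 : 0 <= (C1 + C2) / (2 * del) by rewrite divr_ge0 ?addr_ge0 // mulr_ge0 // ltW.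
  apply: le_trans (ltW (archi_boundP b0)) _; rewrite ler_nat.
  by apply: leq_trans NN; rewrite leq_maxr.
rewrite -(ler_pM2r l0) -{1}(gtr0_norm l0) -normrM.
have -> : (\sum_(1 <= n < N.+1) ip R n * Dl a n) * lnn N =
  \sum_(1 <= n < N.+1) Dl a n * (ip R n * lnn n) +
  \sum_(1 <= n < N.+1) Dl a n * (ip R n * (lnn N - lnn n)).
  by rewrite mulr_suml -big_split; apply: eq_bigr => n _ /=; ring.
have e3 : `|\sum_(1 <= n < N.+1) Dl a n * (ip R n * (lnn N - lnn n))| <= del * N%:R + C2.
  apply: le_trans (h2 N); apply: ler_norm_sum_nat => n /andP[n0 nN].
  have q0 : 0 <= ip R n * (lnn N - lnn n) by rewrite mulr_ge0 // subr_ge0 ler_lnn.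
  by rewrite normrM (ger0_norm q0) ler_piMl // Dl_norm.
apply: le_trans (ler_normD _ _) _.
have h3 := ler_wpM2l (ltW e0) (hc N N0N); have h4 := h1 a N.
have : 4 * del * N%:R = eps * (c * N%:R) by rewrite /del; field.
rewrite -[eps * ppi R N * _]mulrA; lra.
Qed.

(** For each cofactor m the largest prime runs over a tail of the primes up to N/m in one class. The
    main errors add up to a small multiple of pil l.+1 N by [sum_le_pil], the constants to 2 C1 *
    pil l N, negligible by [pil_small]. *)
Lemma almost_prime_class_small l eps : 0 < eps -> exists C' : R, 0 <= C' /\
  forall a N, `|\sum_(1 <= n < N.+1) al R l.+1 n * Dl a n| <= eps * pil R l.+1 N + C'.
Proof.
move=> e0; have l0 := @ltr0n' R l.+1 isT.
pose del := eps / (4 * l.+1%:R); have d0 : 0 < del by rewrite divr_gt0 // mulr_gt0.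
have [C1 [C10 h1]] := prime_class_small d0.
have d2 : 0 < eps / (4 * (C1 + 1)) by rewrite divr_gt0 // mulr_gt0 //; lra.
have [C2 [C20 h2]] := pil_small l d2.
exists (2 * C1 * C2); split => [|a N]; first by rewrite !mulr_ge0.
have tail b t M : `|\sum_(1 <= p < M.+1) ((t < p)%N)%:R * (ip R p * Dl b p)| <= 2 * (del * ppi R M + C1).
  rewrite sum_tail; apply: le_trans (ler_normB _ _) _.
  have : ppi R (minn t M) <= ppi R M by rewrite ppi_mono // geq_minr.
  move=> /(ler_wpM2l (ltW d0)); have := h1 b M; have := h1 b (minn t M); lra.
(* The condition max_pdiv m <= p is put as (max_pdiv m).-1 < p, so that the inner sum is a tail in
   the sense of [sum_tail]. *)
have -> : \sum_(1 <= n < N.+1) al R l.+1 n * Dl a n = \sum_(1 <= m < N.+1) al R l m * (wt m *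
   \sum_(1 <= p < (N %/ m).+1) (((max_pdiv m).-1 < p)%N)%:R * (ip R p * Dl ((cl m)^-1 * a)%g p)).
  transitivity (\sum_(1 <= n < N.+1)
    dsum (fun m p => al R l m * (ip R p * ((max_pdiv m <= p)%N)%:R) * Dl a (m * p)) n).
    by apply: eq_big_nat => n /andP[n0 _]; rewrite al_max_conv // dsum_mulr.
  rewrite sum_dsum; apply: eq_bigr => m _; rewrite !mulr_sumr; apply: eq_bigr => p _.
  by rewrite Dl_mul prednK ?max_pdiv_gt0 //; ring.
have s1 := sum_le_pil R l N; have s2 := h2 N.
apply: le_trans (_ : 2 * del * (\sum_(1 <= m < N.+1) al R l m * ppi R (N %/ m)) + 2 * C1 * pil R l N <= _).
  rewrite /pil !mulr_sumr -big_split; apply: ler_norm_sum_nat => m _ /=.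
  rewrite normrM (ger0_norm (al_ge0 _ _ _)).
  have := ler_wpM2l (al_ge0 R l m) (le_trans (wt_norm m _) (tail ((cl m)^-1 * a)%g (max_pdiv m).-1 (N %/ m)%N)).
  lra.
have d20 : 0 <= 2 * del by lra.
have c10 : 0 <= 2 * C1 by lra.
have := ler_wpM2l d20 s1; have := ler_wpM2l c10 s2.
have -> : 2 * del * (l.+1%:R * pil R l.+1 N) = eps / 2 * pil R l.+1 N by rewrite /del; field; rewrite gt_eqF.
have : 2 * C1 * (eps / (4 * (C1 + 1)) * pil R l.+1 N) <= eps / 2 * pil R l.+1 N.
  have -> : 2 * C1 * (eps / (4 * (C1 + 1)) * pil R l.+1 N) = eps / 2 * pil R l.+1 N * (C1 / (C1 + 1)).
    by field; rewrite gt_eqF //; lra.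
  rewrite ler_piMr ?mulr_ge0 ?pil_ge0 ?(ltW e0) //; rewrite ler_pdivrMr; lra.
lra.
Qed.

End Classes.

(** * Almost primes in residue classes modulo q *)

Section Residues.
Variable R : realType.
Implicit Types (n q r l N : nat) (eps : R).

(** A prime p dividing both n and q is at most q, and n / p is l-almost prime: at most q choices of
    p. *)
Lemma almost_prime_noncoprime q l N : (0 < q)%N ->
  \sum_(1 <= n < N.+1) al R l.+1 n * (1 - (coprime q n)%:R) <= q%:R * pil R l N.
Proof.
move=> q0.
apply: le_trans (_ : \sum_(1 <= n < N.+1) dsum (fun d m => ((d <= q)%N)%:R * al R l m) n <= _).
  apply: ler_sum_nat => n /andP[n0 _].
  have s0 : 0 <= dsum (fun d m => ((d <= q)%N)%:R * al R l m) n :> R.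
    by apply: dsum_ge0 => d m; rewrite mulr_ge0.
  case: (boolP (coprime q n)) => [_|cq]; first by rewrite subrr mulr0.
  rewrite subr0 mulr1 {1}/al; case: asboolP => [ap|//].
  have g1 : (1 < gcdn q n)%N.
    by rewrite ltn_neqAle eq_sym cq gcdn_gt0 q0.
  have [pp pg] := (pdiv_prime g1, pdiv_dvd (gcdn q n)); move: (pdiv _) pp pg => p pp pg.
  have pq : (p %| q)%N := dvdn_trans pg (dvdn_gcdl _ _).
  have pn : (p %| n)%N := dvdn_trans pg (dvdn_gcdr _ _).
  rewrite dsum_dvd //.
  have inP : p \in index_iota 1 n.+1 by rewrite mem_index_iota prime_gt0 // ltnS dvdn_leq.
  rewrite big_mkcond (bigD1_seq p inP (iota_uniq _ _)) pn (dvdn_leq q0 pq).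
  have -> : al R l (n %/ p) = 1 by rewrite -(al_prime_mul R l _ pp) mulnC divnK // /al asboolT.
  set S := (X in _ <= _ _ X); rewrite /= mulr1 lerDl.
  by apply: sumr_ge0 => d _; case: ifP => // _; rewrite mulr_ge0.
rewrite sum_dsum; under eq_bigr do rewrite -mulr_sumr -/(pil R l _).
apply: le_trans (_ : \sum_(1 <= d < N.+1) ((d <= q)%N)%:R * pil R l N <= _).
  by apply: ler_sum_nat => d _; rewrite ler_wpM2l // pil_mono // leq_div.
rewrite -mulr_suml sum_leq_nat ler_wpM2r ?pil_ge0 // ler_nat geq_minr //.
Qed.

Lemma count_residue q r N : (0 < q)%N -> (r < q)%N ->
  `|\sum_(1 <= n < N.+1) ((n %% q == r)%N)%:R - q%:R^-1 * N%:R| <= q%:R :> R.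
Proof.
move=> q0 rq; have q0' := ltr0n' R q0; have q1 := ler1n' R q0.
have blk m : \sum_(m <= n < m + q) ((n %% q == r)%N)%:R = 1 :> R.
  elim: m => [|m IH].
    rewrite add0n (bigD1_seq r) ?iota_uniq ?mem_index_iota //= modn_small // eqxx big1_seq ?addr0 //.
    move=> n /andP[nr]; rewrite mem_index_iota => /andP[_ nq].
    by rewrite modn_small // (negbTE nr).
  move: IH; rewrite big_ltn ?addSn; last by rewrite -{1}[m]addn0 ltn_add2l.
  rewrite [in X in _ -> X]big_nat_recr //=; last by rewrite -addn1 leq_add2l.
  by rewrite modnDr addrC.
elim/ltn_ind: N => N IH; case: (ltnP N q) => [Nq|qN].
  have a0 : 0 <= \sum_(1 <= n < N.+1) ((n %% q == r)%N)%:R :> R by apply: sumr_ge0.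
  have a1 : \sum_(1 <= n < N.+1) ((n %% q == r)%N)%:R <= N%:R :> R.
    apply: le_trans (_ : \sum_(1 <= n < N.+1) 1 <= _); last by rewrite sumr_const_nat subn1.
    by apply: ler_sum_nat => n _; rewrite lern1 leq_b1.
  have Nq' : N%:R <= q%:R :> R by rewrite ler_nat ltnW.
  have b0 : 0 <= q%:R^-1 * N%:R :> R by rewrite mulr_ge0 // invr_ge0 ltW.
  have b1 : q%:R^-1 * N%:R <= 1 :> R by rewrite mulrC ler_pdivrMr // mul1r.
  by rewrite ler_norml; apply/andP; split; lra.
have := IH (N - q)%N; rewrite ltn_subrL q0 (leq_trans q0 qN) => /(_ isT).
rewrite -{3 4}(subnK qN) natrD mulrDr mulVf ?gt_eqF // -addSn.
rewrite (@big_cat_nat _ _ _ (N - q).+1 1 (_ + _)) //= ?leq_addr // blk.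
by set x := \sum_(1 <= n < _) _; set y := _ * _; have -> : x + 1 - (y + 1) = x - y by ring.
Qed.

(** The modulus 1 is kept apart because ['Z_1] has two elements and is not the ring of residues
    modulo 1. *)
Lemma almost_prime_residue_ge2 q l eps : (1 < q)%N -> 0 < eps -> exists C : R, 0 <= C /\
  forall r N, (r < q)%N -> `|\sum_(1 <= n < N.+1) al R l.+1 n *
    (((n %% q == r)%N)%:R - (coprime q r)%:R / (totient q)%:R)| <= eps * pil R l.+1 N + C.
Proof.
move=> q2 e0; have q0 : (0 < q)%N by apply: ltnW.
have e2 : 0 < eps / 2 by rewrite divr_gt0.
have q0' := ltr0n' R q0.
have e3 : 0 < eps / (2 * q%:R) by rewrite divr_gt0 // mulr_gt0.
have [C2 [C20 h2]] := pil_small l e3.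
have nat_unit n : ((n%:R : 'Z_q) \is a GRing.unit) = coprime q n by rewrite unitZpE.
pose cl n : {unit 'Z_q} := insubd (1%g : {unit 'Z_q}) (n%:R : 'Z_q).
have clE n : coprime q n -> val (cl n) = n%:R.
  by move=> cn; rewrite /cl insubdK // -topredE /= nat_unit.
have clM m n : coprime q m -> coprime q n -> cl (m * n)%N = (cl m * cl n)%g.
  move=> cm cn; apply: val_inj; rewrite /= clE; last by rewrite coprimeMr cm.
  by rewrite natrM -!clE.
have dlE (u : {unit 'Z_q}) n : dl R (coprime q) cl u n = ((n %% q == nat_of_ord (val u))%N)%:R.
  rewrite /dl; congr (nat_of_bool _)%:R.
  have vu : (nat_of_ord (val u))%:R = val u :> 'Z_q by rewrite natr_Zp.
  apply/andP/eqP => [[cn /eqP <-]|nu].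
    by rewrite clE // val_Zp_nat.
  have nE : n%:R = val u :> 'Z_q by apply: val_inj; rewrite /= val_Zp_nat.
  have cn : coprime q n by rewrite -nat_unit nE; exact: (valP u).
  by split => //; apply/eqP/val_inj; rewrite /= clE.
have q0i : 0 < q%:R^-1 :> R by rewrite invr_gt0.
have dens (u : {unit 'Z_q}) N : `|\sum_(1 <= n < N.+1) dl R (coprime q) cl u n - q%:R^-1 * N%:R| <= q%:R.
  under eq_bigr do rewrite dlE; apply: count_residue => //.
  by have := ltn_ord (val u); rewrite [X in (_ < X)%N -> _]Zp_cast.
have card : #|{: {unit 'Z_q}}| = totient q by rewrite -(card_units_Zp q0) cardsT.
have [C1 [C10 h1]] := almost_prime_class_small (@unit_Zp_mulgC _) (fun m n => coprimeMr q m n) (coprimen1 q) clM q0i dens l e2.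
have f1 : 1 <= (totient q)%:R :> R by rewrite ler1n totient_gt0.
have f0 : 0 < (totient q)%:R :> R by lra.
exists (C1 + q%:R * C2); split => [|r N rq]; first by rewrite addr_ge0 // mulr_ge0.
pose nc := \sum_(1 <= n < N.+1) al R l.+1 n * (1 - (coprime q n)%:R).
have nc0 : 0 <= nc.
  by apply: sumr_ge0 => n _; rewrite mulr_ge0 // subr_ge0 lern1 leq_b1.
have ncle : nc <= eps / 2 * pil R l.+1 N + q%:R * C2.
  apply: le_trans (almost_prime_noncoprime l N q0) _.
  have -> : eps / 2 * pil R l.+1 N + q%:R * C2 = q%:R * (eps / (2 * q%:R) * pil R l.+1 N + C2).
    by field; rewrite gt_eqF.
  by rewrite ler_pM2l.
have p0 : 0 <= eps / 2 * pil R l.+1 N by rewrite mulr_ge0 ?pil_ge0 // ltW.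
case: (boolP (coprime q r)) => [cr|ncr].
  (* [Dl] subtracts the average only at n prime to q; [nc] accounts for the other n. *)
  have -> : \sum_(1 <= n < N.+1) al R l.+1 n * (((n %% q == r)%N)%:R - true%:R / (totient q)%:R) =
    \sum_(1 <= n < N.+1) al R l.+1 n * Dl R (coprime q) cl (cl r) n - nc / (totient q)%:R.
    rewrite /nc mulr_suml -sumrB; apply: eq_bigr => n _.
    rewrite /Dl dlE clE // val_Zp_nat // (modn_small rq) /wt card.
    by rewrite [true%:R]mulr1n; field; rewrite gt_eqF.
  apply: le_trans (ler_normB _ _) _.
  have : `|nc / (totient q)%:R| <= nc.
    by rewrite normrM normfV (ger0_norm nc0) (gtr0_norm f0) ler_pdivrMr // ler_peMr.
  have := h1 (cl r) N; lra.
have -> : false%:R / (totient q)%:R = 0 :> R by rewrite [false%:R]mulr0n mul0r.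
rewrite ger0_norm; last by apply: sumr_ge0 => n _; rewrite subr0 mulr_ge0.
apply: le_trans (_ : nc <= _); last by lra.
apply: ler_sum => n _; rewrite subr0 ler_wpM2l //.
case: eqP => [nr|_]; last by rewrite subr_ge0 lern1 leq_b1.
by rewrite -coprime_modr nr (negbTE ncr) subr0.
Qed.

Lemma almost_prime_residue q l eps : (0 < q)%N -> 0 < eps -> exists C : R, 0 <= C /\
  forall r N, (r < q)%N -> `|\sum_(1 <= n < N.+1) al R l.+1 n *
    (((n %% q == r)%N)%:R - (coprime q r)%:R / (totient q)%:R)| <= eps * pil R l.+1 N + C.
Proof.
move=> q0 e0; case: (leqP q 1) => q1; last exact: almost_prime_residue_ge2.
have -> : q = 1%N by apply/eqP; rewrite eqn_leq q1.
exists 0; split => // r N r1; have -> : r = 0%N by apply/eqP; rewrite -leqn0.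
rewrite big1_seq ?normr0 => [|n _].
  by rewrite addr0 mulr_ge0 ?pil_ge0 // ltW.
by rewrite modn1 eqxx coprime1n (_ : totient 1 = 1%N) // divr1 subrr mulr0.
Qed.

End Residues.

(** * Toeplitz sequences *)

Local Open Scope classical_set_scope.

Section Cylinders.
Variable A : finType.
Implicit Types (x y z : zseq A) (w : nat).

Definition agree w z z' := forall j : int, (absz j <= w)%N -> z j = z' j.

Lemma agree_trans w z1 z2 z3 : agree w z1 z2 -> agree w z2 z3 -> agree w z1 z3.
Proof. by move=> h1 h2 j jw; rewrite h1 // h2. Qed.

Lemma agree_le w w' z z' : (w <= w')%N -> agree w' z z' -> agree w z z'.
Proof. by move=> le h j jw; apply: h; apply: leq_trans le. Qed.

Lemma coord_nbhs z (j : int) : nbhs z [set z' : zseq A | z' j = z j].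
Proof.
have := @proj_continuous int (fun=> discrete_topology A) j z.
move=> /(_ [set z j]); apply.
exact: (@discrete_set1 (discrete_topology A)).
Qed.

Lemma cylinder_nbhs w z : nbhs z [set z' : zseq A | agree w z z'].
Proof.
elim: w => [|w IH].
  apply: filterS (coord_nbhs z 0) => z' /= h j; rewrite leqn0 absz_eq0 => /eqP ->.
  by rewrite h.
apply: (filterS _ (filterI IH (filterI (coord_nbhs z w.+1%:Z) (coord_nbhs z (- w.+1%:Z))))) => z' /= [h1 [h2 h3]] j; rewrite leq_eqVlt => /orP[/eqP jw|]; last exact: h1.
have [->|->] : j = w.+1%:Z \/ j = - w.+1%:Z by move: jw; clear; lia.
  by rewrite h2.
by rewrite h3.
Qed.

Lemma zseq_compact : compact [set: zseq A].
Proof.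
have := @tychonoff int (fun=> discrete_topology A) (fun=> setT) (fun=> finite_compact _).
have fA : finite_set [set: discrete_topology A] by exact: (@finite_finset A).
by move=> /(_ (fun=> fA)); congr (compact _); rewrite eqEsubset.
Qed.

(* By compactness: a point other than z is separated from z by one coordinate. *)
Lemma cylinder_basis z (U : set (zseq A)) : nbhs z U ->
  exists w, forall z', agree w z z' -> U z'.
Proof.
move=> zU; have /compact_near_coveringP cov := zseq_compact.
have [|N _ hN] := cov nat \oo (fun w z' => agree w z z' -> U z') _.
- move=> z' _; have [->|nz] := pselect (z' = z).
    by exists (U, setT); [split => //; exact: filterT | case=> z'' w [/= Uz _] _].
  have [j nj] : exists j, z' j <> z j.
    by apply: contrapT => h; apply: nz; apply/funext => j; apply: contrapT => h'; apply: h; exists j.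
  exists ([set z'' : zseq A | z'' j = z' j], [set w | (absz j <= w)%N]).
    split; first exact: coord_nbhs.
    exact: nbhs_infty_ge.
  by case=> z'' w [/= h1 h2] /(_ j h2); rewrite h1 => h3; case: nj.
by exists N => z' h; apply: (hN N) => //=.
Qed.

Definition zshift (s : int) x : zseq A := fun a : int => x (a + s).

Lemma iter_shift n x : iter n (@left_shift A) x = zshift n%:Z x.
Proof.
elim: n => [|n IH]; first by apply/funext => a; rewrite /zshift addr0.
by rewrite iterS IH; apply/funext => a; rewrite /left_shift /zshift -addrA -[n.+1]add1n PoszD.
Qed.

Lemma zshiftD s t x : zshift s (zshift t x) = zshift (s + t) x.
Proof. by apply/funext => a; rewrite /zshift addrA. Qed.

Lemma shift_orbitP x z : shift_orbit x z <-> exists s, z = zshift s x.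
Proof.
split=> [[n [->|xE]]|[s ->]].
- by exists n; rewrite iter_shift.
- exists (- n%:Z); rewrite xE iter_shift zshiftD addNr.
  by apply/funext => a; rewrite /zshift addr0.
- exists (absz s); rewrite !iter_shift; case: (lerP 0 s) => s0; [left|right].
    by rewrite gez0_abs.
  rewrite zshiftD ltz0_abs // addNr.
  by apply/funext => a; rewrite /zshift addr0.
Qed.

Lemma orbit_closureP x y : orbit_closure x y <->
  forall W, exists s, agree W y (zshift s x).
Proof.
split=> [h W|h B /cylinder_basis[w hw]].
  have [z [/shift_orbitP[s ->] hs]] := h _ (cylinder_nbhs W y).
  by exists s.
have [s hs] := h w; exists (zshift s x); split; last exact: hw.
by apply/shift_orbitP; exists s.
Qed.

Lemma orbit_closure_shift x y s : orbit_closure x y -> orbit_closure x (zshift s y).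
Proof.
move=> /orbit_closureP h; apply/orbit_closureP => W.
have [t ht] := h (W + absz s)%N; exists (s + t) => j jW.
rewrite -zshiftD /zshift ht //; move: jW; clear; lia.
Qed.

Section Continuous.
Variables (K : numFieldType) (x : zseq A) (F : zseq A -> K^o).
Hypothesis cF : {within orbit_closure x, continuous F}.

(** Compactness of the whole sequence space: near a point of the orbit closure continuity applies
    twice with eps/2, and elsewhere the property is vacuous because the complement is open. *)
Lemma cylinder_uniform (eps : K) : 0 < eps -> exists w, forall z z',
  orbit_closure x z -> orbit_closure x z' -> agree w z z' -> `|F z - F z'| <= eps.
Proof.
move=> e0; have /compact_near_coveringP cov := zseq_compact.
pose P w z := orbit_closure x z -> forall z', orbit_closure x z' -> agree w z z' -> `|F z - F z'| <= eps.
have [|N _ hN] := cov nat \oo P _.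
- move=> z _; have [Xz|nX] := pselect (orbit_closure x z); last first.
    exists (~` orbit_closure x, setT).
      split; last exact: filterT.
      apply: open_nbhs_nbhs; split => //; apply: closed_openC; exact: closed_closure.
    by case=> z' w [/= h _].
  have /subspace_continuousP/(_ z Xz)/cvgrPdist_lt/(_ (eps / 2)) := cF.
  rewrite divr_gt0 // => /(_ isT) near_z.
  have [w hw] := cylinder_basis near_z.
  exists ([set z' | agree w z z'], [set w' | (w <= w')%N]).
    split; [exact: cylinder_nbhs|exact: nbhs_infty_ge].
  case=> z1 w' [/= a1 ww] X1 z2 X2 a2.
  have b1 := hw _ a1 X1; have b2 := hw _ (agree_trans a1 (agree_le ww a2)) X2.
  rewrite -(subrKA (F z)) -(opprB (F z) (F z1)); apply: le_trans (ler_normD _ _) _.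
  by rewrite normrN [eps in leRHS]splitr; apply: lerD; apply: ltW.
by exists N => z z' Xz Xz' a; apply: (hN N _ z) => //=.
Qed.

End Continuous.
End Cylinders.

(** * Windows of y determined by a residue modulo the period *)

Section Residues.
Variables (A : finType) (x : zseq A).
Implicit Types (y : zseq A) (m w : nat) (t : int).

Lemma Per_addM m (a k : int) : Per m x a -> Per m x (a + k * m%:Z).
Proof. by move=> h j; rewrite -addrA -mulrDl -!h. Qed.

Lemma Per_mod m (a b : int) : (a = b %[mod m%:Z])%Z -> Per m x a -> Per m x b /\ x b = x a.
Proof.
move=> /eqP; rewrite eqz_mod_dvd => /dvdzP[k kE] h.
have -> : b = a + (- k) * m%:Z by rewrite mulNr -kE opprB addrC subrK.
by split; [exact: Per_addM | rewrite -h].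
Qed.

(** At positions of [Per m x] only the shift modulo m matters. If every residue r failed at some a
    r, a shift of x agreeing with y on a window containing all the a r would contradict the failure
    recorded for its own residue. *)
Lemma toeplitz_shift y m : (0 < m)%N -> orbit_closure x y ->
  exists t : int, forall a, Per m x (a + t) -> y a = x (a + t).
Proof.
move=> m0 /orbit_closureP yX; apply: contrapT => no.
have ex (r : 'I_m) : exists a : int, Per m x (a + r%:Z) /\ y a <> x (a + r%:Z).
  apply: contrapT => h; apply: no; exists r%:Z => a Pa.
  by apply: contrapT => ne; apply: h; exists a.
have [a ha] := choice ex.
have [s hs] := yX (\max_(r < m) absz (a r)).
have m0' : 0 < m%:Z by [].
pose r0 := absz (s %% m%:Z)%Z.
have r0E : r0%:Z = (s %% m%:Z)%Z by rewrite /r0 gez0_abs // modz_ge0 // gt_eqF.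
have r0m : (r0 < m)%N by rewrite -ltz_nat r0E ltz_pmod.
have [P ne] := ha (Ordinal r0m); apply: ne.
rewrite hs /zshift; last exact: (@leq_bigmax _ (fun r => absz (a r)) (Ordinal r0m)).
apply: (proj2 (Per_mod _ P)) => /=.
by rewrite r0E modzDmr.
Qed.

(** When r is not bad, the window of y around any q congruent to r is read off x at positions of
    [Per m x], and so depends on r only. *)
Definition bad_residue m w t (r : nat) : bool :=
  ~~ `[< forall j : int, (absz j <= w)%N -> Per m x (r%:Z + j + t) >].

Lemma bad_residueP y m w t (q q' : nat) :
  (forall a, Per m x (a + t) -> y a = x (a + t)) ->
  (q %% m = q' %% m)%N -> ~~ bad_residue m w t (q %% m) ->
  agree w (zshift q%:Z y) (zshift q'%:Z y).
Proof.
move=> ht qq /negbNE/asboolP good j jw; rewrite /zshift.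
have key (p : nat) : (p %% m = q %% m)%N -> y (j + p%:Z) = x ((q %% m)%N%:Z + j + t).
  move=> pq; have [|P1 e1] := @Per_mod m ((q %% m)%N%:Z + j + t) (j + p%:Z + t) _ (good j jw).
    by rewrite -pq -(modz_nat p m) -addrA modzDml addrA [p%:Z + j]addrC.
  by rewrite ht.
by rewrite !key.
Qed.

(** A hole spoils at most one residue for each of the 2 w + 1 offsets, since each offset acts as a
    rotation of the residues. *)
Lemma count_bad_residue m w t : (0 < m)%N ->
  (\sum_(r < m) bad_residue m w t r <= (2 * w).+1 * holes x m)%N.
Proof.
case: m => // m _.
pose f (c : int) (r : 'I_m.+1) : 'I_m.+1 := inord (absz ((r%:Z + c) %% m.+1%:Z)%Z).
have fE c r : (f c r)%:Z = ((r%:Z + c) %% m.+1%:Z)%Z.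
  have g0 : 0 <= ((r%:Z + c) %% m.+1%:Z)%Z by rewrite modz_ge0.
  rewrite /f inordK ?gez0_abs // -ltz_nat gez0_abs //; exact: ltz_pmod.
have finj c : injective (f c).
  move=> r1 r2 /(congr1 (fun r : 'I_m.+1 => (nat_of_ord r)%:Z)); rewrite !fE => /eqP.
  rewrite eqz_modDr !modz_nat !modn_small // => /eqP[e].
  exact: val_inj.
pose H : {set 'I_m.+1} := [set j : 'I_m.+1 | (j : nat)%:Z \notin Per m.+1 x]%SET.
apply: leq_trans (_ : \sum_(r < m.+1) \sum_(i < (2 * w).+1) (f (i%:Z - w%:Z + t)%R r \in H) <= _)%N.
  apply: leq_sum => r _; case: (boolP (bad_residue _ _ _ _)) => // /asboolPn.
  move=> /existsNP[j /not_implyP[jw nP]].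
  have iw : (absz (j + w%:Z)%R < (2 * w).+1)%N by move: jw; clear; lia.
  rewrite (bigD1 (Ordinal iw)) //=; suff -> : f ((absz (j + w%:Z))%:Z - w%:Z + t) r \in H by [].
  have -> : (absz (j + w%:Z))%:Z - w%:Z + t = j + t by move: jw; clear; lia.
  rewrite inE notin_setE fE => hP; apply: nP.
  rewrite -addrA; apply: (proj1 (Per_mod _ hP)); exact: modz_mod.
rewrite exchange_big /= -[X in (_ <= X * _)%N]card_ord -sum_nat_const leq_sum // => i _.
have -> : holes x m.+1 = #|H| by [].
rewrite -sum1_card [X in (_ <= X)%N]big_mkcond [X in (_ <= X)%N](reindex_inj (finj (i%:Z - w%:Z + t))).
by apply: leq_sum => r _; case: (_ \in H).
Qed.

End Residues.

(** * Averages along almost primes *)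

Section Averages.
Variable R : realType.

(** Bad classes are measured against totient m because a class carries at most about 1/totient m of
    the almost primes. The averages end up within e of the mean of G over the residues prime to m;
    this mean depends on e, so the Cauchy criterion is used. *)
Lemma average_cvg l (G : nat -> R) (M : R) : (forall q, `|G q| <= M) ->
  (forall eps : R, 0 < eps -> exists (m : nat) (B : nat -> bool), [/\ (0 < m)%N,
     \sum_(r < m) (B r)%:R <= eps * (totient m)%:R &
     forall q q', (q %% m = q' %% m)%N -> ~~ B (q %% m)%N -> `|G q - G q'| <= eps]) ->
  cvg ((fun N : nat => (pil R l.+1 N)^-1 * \sum_(1 <= q < N.+1) al R l.+1 q * G q) @ \oo).
Proof.
move=> bG H; have M0 : 0 <= M by apply: le_trans (bG 0%N).
apply: cauchy_cvg; apply: cauchy_exP => e e0.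
(* Relative to pil, [t1] and [t2] cost (1 + 5 M) eps plus 3 M m C, and the latter is below eps for N
   >= N0: in total (2 + 5 M) eps < e. *)
pose eps := e / (4 + 6 * M); have eps0 : 0 < eps by rewrite divr_gt0 //; lra.
have [m [B [m0 hB hG]]] := H _ eps0.
have m0' := ltr0n' R m0.
have f1 : 1 <= (totient m)%:R :> R by rewrite ler1n totient_gt0.
have f0 : 0 < (totient m)%:R :> R by lra.
have del0 : 0 < eps / m%:R by rewrite divr_gt0.
have [C [C0 hC]] := almost_prime_residue l m0 del0.
pose c := \sum_(r < m) G r * ((coprime m r)%:R / (totient m)%:R).
exists c.
have [N0 hN0] := pil_unbounded l (3 * M * m%:R * C / eps).
exists N0 => //= N /hN0 NN.
have pil0 : 0 < pil R l.+1 N.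
  by apply: le_lt_trans NN; rewrite divr_ge0 ?(ltW eps0) // mulr_ge0 // mulr_ge0 // mulr_ge0.
have NN' : 3 * M * m%:R * C <= eps * pil R l.+1 N.
  by have := ltW NN; rewrite ler_pdivrMr // [X in _ <= X]mulrC.
pose res r := \sum_(1 <= q < N.+1) al R l.+1 q * ((q %% m == r)%N)%:R.
have resE r : (r < m)%N -> `|res r - (coprime m r)%:R / (totient m)%:R * pil R l.+1 N| <=
    eps / m%:R * pil R l.+1 N + C.
  move=> rm; apply: le_trans (hC r N rm); rewrite /res /pil mulr_sumr -sumrB.
  by rewrite le_eqVlt; apply/orP; left; apply/eqP; congr (`|_|); apply: eq_bigr => q _; ring.
have byres (g : nat -> R) : \sum_(1 <= q < N.+1) al R l.+1 q * g (q %% m)%N = \sum_(r < m) g r * res r.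
  under [RHS]eq_bigr do rewrite /res mulr_sumr.
  rewrite exchange_big /=; apply: eq_bigr => q _.
  rewrite (bigD1 (Ordinal (ltn_pmod q m0))) //= eqxx mulr1 mulrC big1 ?addr0 // => r nr.
  case: eqP => [e1|_]; last by rewrite !mulr0.
  by case/eqP: nr; apply: val_inj.
have sumB (X : R) : 0 <= X -> \sum_(r < m) (B r)%:R * X <= m%:R * X.
  move=> X0; rewrite -mulr_suml ler_wpM2r // -[X in _ <= X%:R]card_ord -[X in _ <= X%:R]sum1_card natr_sum.
  by apply: ler_sum => r _; rewrite ler_nat leq_b1.
have err0 : 0 <= eps / m%:R * pil R l.+1 N + C by rewrite addr_ge0 // mulr_ge0 // ltW.
have merr : m%:R * (eps / m%:R * pil R l.+1 N + C) = eps * pil R l.+1 N + m%:R * C.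
  by field; rewrite gt_eqF.
have bres : \sum_(r < m) (B r)%:R * res r <= 2 * eps * pil R l.+1 N + m%:R * C.
  apply: le_trans (_ : \sum_(r < m) ((B r)%:R * (pil R l.+1 N / (totient m)%:R) +
     (B r)%:R * (eps / m%:R * pil R l.+1 N + C)) <= _).
    apply: ler_sum => r _; rewrite -mulrDr ler_wpM2l //.
    have := resE r (ltn_ord r); rewrite ler_norml => /andP[_ h].
    have : (coprime m r)%:R / (totient m)%:R * pil R l.+1 N <= pil R l.+1 N / (totient m)%:R.
      by rewrite mulrAC -mulrA ler_piMl ?lern1 ?leq_b1 // divr_ge0 // ltW.
    lra.
  rewrite big_split /=; have := sumB _ err0; rewrite merr.
  have : \sum_(r < m) (B r)%:R * (pil R l.+1 N / (totient m)%:R) <= eps * pil R l.+1 N.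
    rewrite -mulr_suml mulrA ler_pdivrMr // mulrAC; exact: ler_wpM2r (ltW pil0) _ _ hB.
  lra.
have t1 : `|\sum_(1 <= q < N.+1) al R l.+1 q * (G q - G (q %% m)%N)| <=
    eps * pil R l.+1 N + 2 * M * (2 * eps * pil R l.+1 N + m%:R * C).
  apply: le_trans (_ : \sum_(1 <= q < N.+1) (eps * al R l.+1 q + 2 * M * (al R l.+1 q * (B (q %% m)%N)%:R)) <= _).
    apply: ler_norm_sum_nat => q _; rewrite normrM (ger0_norm (al_ge0 _ _ _)).
    have -> : eps * al R l.+1 q + 2 * M * (al R l.+1 q * (B (q %% m)%N)%:R) =
      al R l.+1 q * (eps + 2 * M * (B (q %% m)%N)%:R) by ring.
    rewrite ler_wpM2l //; case: (boolP (B _)) => [_|nB]; last first.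
      rewrite [false%:R]mulr0n mulr0 addr0; apply: hG => //.
      by rewrite modn_mod.
    apply: ler_wpDl (ltW eps0) _; rewrite [true%:R]mulr1n mulr1.
    apply: le_trans (ler_normB _ _) _; have := bG q; have := bG (q %% m)%N; lra.
  rewrite big_split /= -!mulr_sumr (byres (fun r => (B r)%:R)) lerD2l.
  by rewrite ler_wpM2l // mulr_ge0.
have t2 : `|\sum_(r < m) G r * res r - c * pil R l.+1 N| <= M * (eps * pil R l.+1 N + m%:R * C).
  rewrite /c mulr_suml -sumrB; apply: le_trans (ler_norm_sum _ _ _) _.
  rewrite -merr mulrCA -[X in _ <= X%:R * _]card_ord mulr_natl -sumr_const; apply: ler_sum => r _.
  by rewrite -mulrA -mulrBr normrM ler_pM // resE.
have bd : `|\sum_(1 <= q < N.+1) al R l.+1 q * G q - c * pil R l.+1 N| < e * pil R l.+1 N.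
  have -> : \sum_(1 <= q < N.+1) al R l.+1 q * G q - c * pil R l.+1 N =
    \sum_(1 <= q < N.+1) al R l.+1 q * (G q - G (q %% m)%N) + (\sum_(r < m) G r * res r - c * pil R l.+1 N).
    rewrite -(byres G) addrA -big_split; congr (_ - _); apply: eq_bigr => q _ /=; ring.
  apply: le_lt_trans (ler_normD _ _) _.
  have -> : e = (4 + 6 * M) * eps by rewrite /eps; field; rewrite gt_eqF //; lra.
  have := mulr_gt0 eps0 pil0; have := mulr_ge0 M0 (ltW (mulr_gt0 eps0 pil0)); lra.
change (ball c e ((pil R l.+1 N)^-1 * \sum_(1 <= q < N.+1) al R l.+1 q * G q)).
rewrite -ball_normE /= distrC -(ltr_pM2r pil0); apply: le_lt_trans bd.
rewrite -[X in _ * X <= _](gtr0_norm pil0) -normrM mulrBl mulrAC mulVf ?gt_eqF // mul1r //.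
Qed.

End Averages.

Section Bounded.
Variables (A : finType) (x : zseq A) (K : numFieldType) (F : zseq A -> K^o).
Hypothesis cF : {within orbit_closure x, continuous F}.

(** F varies by at most 1 among points sharing a central window, and there are finitely many
    windows; patterns that do not occur are represented by x. *)
Lemma orbit_closure_bounded : exists M : K, forall z, orbit_closure x z -> `|F z| <= M.
Proof.
have [w hw] := cylinder_uniform cF ltr01.
pose pat (z : zseq A) : {ffun 'I_(2 * w).+1 -> A} := [ffun i : 'I_(2 * w).+1 => z (i%:Z - w%:Z)%R].
have xX : orbit_closure x x.
  apply/orbit_closureP => W; exists 0 => j _; by rewrite /zshift addr0.
have ex p : exists z', orbit_closure x z' /\ forall z, orbit_closure x z -> pat z = p -> pat z' = p.
  have [[z [zX zp]]|no] := pselect (exists z, orbit_closure x z /\ pat z = p).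
    by exists z.
  by exists x; split => // z zX zp; case: no; exists z.
have [rep hrep] := choice ex.
exists (1 + \sum_p `|F (rep p)|) => z zX.
have [rX rp] := hrep (pat z); have rE := rp z zX erefl.
rewrite -(subrK (F (rep (pat z))) (F z)); apply: le_trans (ler_normD _ _) _; apply: lerD.
  apply: hw => // j jw; move/ffunP: rE.
  have jw' : (absz (j + w%:Z)%R < (2 * w).+1)%N by move: jw; clear; lia.
  move=> /(_ (Ordinal jw')); rewrite !ffunE /=.
  have -> : (absz (j + w%:Z)%R)%:Z - w%:Z = j by move: jw; clear; lia.
  by [].
by rewrite (bigD1 (pat z)) //= lerDl sumr_ge0.
Qed.

End Bounded.

(** * Complex values, by real and imaginary parts *)

Section ComplexAverage.
Variable R : realType.
Local Notation C := (R[i]).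

Lemma normc_ge_Im (z : C) : (`|complex.Im z|)%:C%C <= `|z|.
Proof.
rewrite normc_def lecR -sqrtr_sqr ler_sqrt ?addr_ge0 ?sqr_ge0 //.
by rewrite lerDr sqr_ge0.
Qed.

Lemma normc_le_add (a b : R) : `|(a +i* b)%C| <= (`|a| + `|b|)%:C%C.
Proof.
rewrite normc_def lecR /= -[leRHS]ger0_norm ?addr_ge0 // -sqrtr_sqr ler_sqrt ?sqr_ge0 //.
rewrite sqrrD !real_normK ?num_real //.
have : 0 <= `|a| * `|b| by rewrite mulr_ge0.
lra.
Qed.

Lemma cvg_complex (u v : nat -> R) (f : nat -> C^o) : (forall N, f N = (u N +i* v N)%C) ->
  cvg (u @ \oo) -> cvg (v @ \oo) -> cvg (f @ \oo).
Proof.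
move=> fE /cvgrPdist_le cu /cvgrPdist_le cv; apply/cvg_ex; exists ((lim (u @ \oo) +i* lim (v @ \oo))%C : C^o).
apply/cvgrPdist_le => e e0.
have [re eE] : exists r : R, 0 < r /\ e = r%:C%C.
  case: e e0 => a b; rewrite ltcE /= => /andP[/eqP -> a0]; by exists a.
case: eE => r0 ->; have r2 : 0 < re / 2 by rewrite divr_gt0.
near=> N; rewrite fE.
have -> : ((lim (u @ \oo) +i* lim (v @ \oo)) - (u N +i* v N))%C =
   ((lim (u @ \oo) - u N) +i* (lim (v @ \oo) - v N))%C by [].
apply: le_trans (normc_le_add _ _) _; rewrite lecR [re]splitr; apply: lerD.
  by near: N; exact: cu.
by near: N; exact: cv.
Unshelve. all: by end_near. Qed.

Lemma sum_almost_primes (V : nmodType) l N (f : nat -> V) :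
  \sum_(q in almost_primes l N) f q = \sum_(1 <= q < N.+1 | `[< almost_prime l q >]) f q.
Proof.
rewrite big_mkcond [RHS]big_mkcond /=.
transitivity (\sum_(0 <= q < N.+1) if `[< almost_prime l q >] then f q else 0).
  by rewrite big_mkord; apply: eq_bigr => q _; rewrite inE.
rewrite [LHS]big_ltn // asboolF ?add0r // => /almost_prime_gt0; by rewrite ltnn.
Qed.

Lemma sum_al l N (f : nat -> R) :
  \sum_(1 <= q < N.+1 | `[< almost_prime l q >]) f q = \sum_(1 <= q < N.+1) al R l q * f q.
Proof.
rewrite big_mkcond; apply: eq_bigr => q _; rewrite /al.
by case: ifP; rewrite ?mul1r // [false%:R]mulr0n mul0r.
Qed.

Lemma almost_prime_piE l N : (almost_prime_pi l N)%:R = pil R l N.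
Proof.
rewrite /almost_prime_pi -sum1_card natr_sum (sum_almost_primes l N (fun=> 1)) sum_al.
by apply: eq_bigr => q _; rewrite mulr1.
Qed.

Lemma complex_average_cvg l (G : nat -> C^o) (M : C) : (forall q, `|G q| <= M) ->
  (forall eps : R, 0 < eps -> exists (m : nat) (B : nat -> bool), [/\ (0 < m)%N,
     \sum_(r < m) (B r)%:R <= eps * (totient m)%:R &
     forall q q', (q %% m = q' %% m)%N -> ~~ B (q %% m)%N -> `|G q - G q'| <= eps%:C%C]) ->
  cvg ((fun N : nat => (almost_prime_pi l.+1 N)%:R^-1 * \sum_(q in almost_primes l.+1 N) G q : C^o) @ \oo).
Proof.
move=> bG H.
have part (P : {additive C -> R}) : (forall z, (`|P z|)%:C%C <= `|z|) ->
  cvg ((fun N : nat => (pil R l.+1 N)^-1 * \sum_(1 <= q < N.+1) al R l.+1 q * P (G q)) @ \oo).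
  move=> hP; apply: (@average_cvg R l (P \o G) (complex.Re M)) => [q|eps e0].
    by have := le_trans (hP _) (bG q); rewrite lecE => /andP[].
  have [m [B [m0 hB hG]]] := H eps e0; exists m, B; split => // q q' qq nB.
  have := le_trans (hP _) (hG q q' qq nB); rewrite lecR /=; by rewrite raddfB.
apply: (cvg_complex _ (part (@complex.Re R) (@normc_ge_Re R)) (part (@complex.Im R) normc_ge_Im)) => N /=.
rewrite sum_almost_primes -!sum_al -!raddf_sum -almost_prime_piE.
have -> : (almost_prime_pi l.+1 N)%:R = ((almost_prime_pi l.+1 N)%:R : R)%:C%C by rewrite rmorph_nat.
rewrite -fmorphV; case: (\sum_(_ <= _ < _ | _) _) => a b.
by simpc.
Qed.

End ComplexAverage.

Local Open Scope complex_scope.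

Theorem theorem5p1 (R : realType) (l : nat) (A : finType) (x : zseq A)
    (n : nat -> nat) :
  (1 <= l)%N ->
  toeplitz x ->
  periodic_structure x n ->
  (fun k => (holes x (n k))%:R : R^o) =o_\oo (fun k => (totient (n k))%:R : R^o) ->
  forall F : zseq A -> R[i]^o, {within orbit_closure x, continuous F} ->
  forall y : zseq A, orbit_closure x y ->
  cvg ((fun N : nat => (almost_prime_pi l N)%:R^-1 *
          \sum_(q in almost_primes l N) F (iter q (@left_shift A) y)) @ \oo).
Proof.
move=> l1 _ [n0 _ _] ho F cF y yX.
case: l l1 => // l _.
have [M bM] := orbit_closure_bounded cF.
under eq_fun => N do under eq_bigr => q _ do rewrite iter_shift.
apply: (@complex_average_cvg R l (fun q => F (zshift q%:Z y)) M) => [q|eps eps0].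
  by apply: bM; exact: orbit_closure_shift.
have eps0' : 0 < eps%:C by rewrite ltcR.
have [w hw] := cylinder_uniform cF eps0'.
(* A hole accounts for at most 2 w + 1 bad residues, so the ratio of holes to totient has to be this
   much smaller than eps. *)
have d0 : 0 < eps / (2 * w).+1%:R by rewrite divr_gt0 // ltr0n.
have [k _ hk] := (iffLR (eqoP _ _ _) ho) _ d0.
have {hk} := hk k (leqnn k); rewrite /= !ger0_norm // => hk.
have [t ht] := toeplitz_shift (n0 k) yX.
exists (n k), (bad_residue x (n k) w t); split => //.
  rewrite -natr_sum; apply: le_trans (_ : ((2 * w).+1 * holes x (n k))%N%:R <= _).
    by rewrite ler_nat; exact: count_bad_residue.
  by rewrite natrM mulrC -ler_pdivlMr ?ltr0n // mulrAC.
move=> q q' qq nB; apply: hw; try exact: orbit_closure_shift.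
exact: bad_residueP ht qq nB.
Qed.
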